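(* Let $k\ge2$ be even and let $\Phi:(0,\infty)\to\mathbb C$ be a smooth function with compact support in $(0,\infty)$ such that $\int_0^\infty\Phi(u)u^2\frac{du}{u}\neq0$. Define, for $y\ge0$, \[ \mathcal{M}^k_\Phi(y):=\Big(\int_0^\infty\mathcal{M}_k(y/u)\Phi(u)u^2\frac{du}{u}\Big)\Big/\int_0^\infty\Phi(u)u^2\frac{du}{u}. \] Then $\mathcal{M}^k_\Phi$ is continuous on $(0,\infty)$, $\mathcal{M}^k_\Phi(0)=0$, and as $y\to\infty$, $\mathcal{M}^k_\Phi(y)=\frac12+o_k(1)$.
   Context: For $y>0$, \[\mathcal{M}_k(y)=\frac{\alpha(-1)^{k/2-1}}{k-1}\sum_{1\le r\le 2\sqrt y}\nu(r)\sqrt{4y-r^2}\,U_{k-2}\Big(\frac{r}{2\sqrt y}\Big)+\frac{\beta}{k-1}\sqrt y-\gamma\,\delta_{k=2}\,y,\] and $\mathcal{M}_k(0)=0$, where $U_n(\cos\theta)=\sin((n+1)\theta)/\sin\theta$ is the Chebyshev polynomial, $\delta_{k=2}$ is $1$ if $k=2$ and $0$ otherwise, $\alpha=2\pi\prod_p\frac{1-p-2p^2+p^4}{p^4-2p^2+p}$, $\beta=2\pi\prod_p\frac{-1+p^2+p^3}{p(-1+p+p^2)}$, $\gamma=12\prod_p\frac{p(1+p)}{-1+p+p^2}$ (products over all primes), and $\nu(r)=\prod_{p\mid r}\big(1+\frac{p^2}{p^4-2p^2-p+1}\big)$. *)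

(* Defs.v *)
From Stdlib Require Import Reals ZArith Znumtheory Lra Lia.
From Coquelicot Require Import Coquelicot.

Open Scope R_scope.

Fixpoint chebyshevU (n : nat) (x : R) : R :=
  match n with
  | O => 1
  | S m => match m with
           | O => 2 * x
           | S l => 2 * x * chebyshevU m x - chebyshevU l x
           end
  end.

Lemma chebyshevU_cos (n : nat) (t : R) :
  sin t <> 0 -> chebyshevU n (cos t) = sin ((INR n + 1) * t) / sin t.
Proof.
intros ht.
assert (H : chebyshevU n (cos t) * sin t = sin ((INR n + 1) * t) /\
            chebyshevU (S n) (cos t) * sin t = sin ((INR (S n) + 1) * t)).
{ induction n as [|n [IH1 IH2]].
  - split; simpl.
    + rewrite !Rplus_0_l, !Rmult_1_l; reflexivity.
    + replace ((1 + 1) * t) with (2 * t) by ring.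
      rewrite sin_2a; ring.
  - split; [exact IH2|].
    change (chebyshevU (S (S n)) (cos t)) with
      (2 * cos t * chebyshevU (S n) (cos t) - chebyshevU n (cos t)).
    replace ((2 * cos t * chebyshevU (S n) (cos t) - chebyshevU n (cos t)) * sin t)
      with (2 * cos t * (chebyshevU (S n) (cos t) * sin t)
            - chebyshevU n (cos t) * sin t) by ring.
    rewrite IH1, IH2, !S_INR.
    set (s := (INR n + 1 + 1) * t).
    replace ((INR n + 1) * t) with (s - t) by (unfold s; ring).
    replace ((INR n + 1 + 1 + 1) * t) with (s + t) by (unfold s; ring).
    rewrite sin_minus, sin_plus; ring. }
destruct H as [H _].
rewrite <- H; field; exact ht.
Qed.

Definition prime_product_upto (N : nat) (f : R -> R) : R :=
  prod_f_R0 (fun n => if prime_dec (Z.of_nat n) then f (INR n) else 1) N.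

Definition prime_product (f : R -> R) : R :=
  real (Lim_seq (fun N => prime_product_upto N f)).

Definition alpha : R :=
  2 * PI * prime_product (fun p =>
    (1 - p - 2 * p ^ 2 + p ^ 4) / (p ^ 4 - 2 * p ^ 2 + p)).

Definition beta : R :=
  2 * PI * prime_product (fun p =>
    (-1 + p ^ 2 + p ^ 3) / (p * (-1 + p + p ^ 2))).

Definition gamma : R :=
  12 * prime_product (fun p => p * (1 + p) / (-1 + p + p ^ 2)).

(* A prime divisor of r >= 1 is at most r; only r >= 1 is used. *)
Definition nu (r : nat) : R :=
  prod_f_R0 (fun n =>
    if prime_dec (Z.of_nat n) then
      if Zdivide_dec (Z.of_nat n) (Z.of_nat r) then
        let p := INR n in 1 + p ^ 2 / (p ^ 4 - 2 * p ^ 2 - p + 1)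
      else 1
    else 1) r.

(* Int_part is the floor function. The value for y < 0 is a dummy. *)
Definition murm (k : nat) (y : R) : R :=
  if Rlt_dec 0 y then
    alpha * (-1) ^ (k / 2 - 1) / (INR k - 1)
      * sum_n_m (fun r => nu r * sqrt (4 * y - INR r ^ 2)
                          * chebyshevU (k - 2) (INR r / (2 * sqrt y)))
          1 (Z.to_nat (Int_part (2 * sqrt y)))
    + beta / (INR k - 1) * sqrt y
    - gamma * (if Nat.eqb k 2 then 1 else 0) * y
  else 0.

(* Functions on (0, oo) are represented by functions on R of which only the
   values at positive arguments are used. *)

(* D n is the n-th derivative of Phi. *)
Definition smooth_on_pos (Phi : R -> C) : Prop :=
  exists D : nat -> R -> C,
    (forall u, 0 < u -> D O u = Phi u) /\
    (forall n u, 0 < u ->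
       @is_derive R_AbsRing C_R_NormedModule (D n) u (D (S n) u)).

Definition compact_support_in_pos (Phi : R -> C) : Prop :=
  exists a b : R, 0 < a /\ a <= b /\
    forall u, 0 < u -> Phi u <> RtoC 0 -> a <= u <= b.

Definition integral_pos (f : R -> C) : C :=
  @RInt_gen C_R_CompleteNormedModule f (at_right 0) (Rbar_locally p_infty).

Definition murm_avg (k : nat) (Phi : R -> C) (y : R) : C :=
  (integral_pos (fun u => RtoC (murm k (y / u)) * Phi u * RtoC (u ^ 2 / u))
   / integral_pos (fun u => Phi u * RtoC (u ^ 2 / u)))%C.

(* Main.v *)
(** Up to the factor [2 sqrt y], the sum in [murm k (y / u)], integrated against
    [Phi u * u], is [sum_r nu(r) H(r / Y)] with [Y = 2 sqrt y]. In the variable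
    [t = 1 / u] the function [H(x) = h(x^2)] is a convolution of a test function with
    the square root, hence smooth, compactly supported and even.
    Write [T_p f(x) = f(p x)]. Then [sum_r nu(r) H(r x)] is obtained from
    [D(x) = sum_(a, m) a^-2 H(a m x)] by applying
    [prod_p (1 + g(p) T_p) (1 - p^-2 T_p)], where [nu(r) = prod_(p | r) (1 + g(p))];
    this product converges absolutely on functions of size [O(x)], and its local factors
    on [x^-1], [1] and [x] turn [alpha] into [gamma], [beta] and [1 / zeta(2)].
    Euler-Maclaurin summation gives
    [D(x) = zeta(3) c / x - zeta(2) H(0) / 2 - kappa x / 12 + o(x)] with [c] the integral
    of [H] and [kappa] that of [H'(v) / v]. The first two terms cancel against the
    [gamma] and [beta] terms of [murm], and the third one yields [1 / 2], because
    [kappa] is an integral of [cos((k - 1) t) / cos t] and [zeta(2) = PI^2 / 6]. *)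

Require Import Defs.
From Stdlib Require Import Reals ZArith Znumtheory Lra Lia.
From Coquelicot Require Import Coquelicot.

Open Scope R_scope.

(** * Smooth functions *)

(** The factor [1 - p^-2 T_p] is there for convergence. On the function [x], [T_p] multiplies by
    [p], and [g(p)] is close to [p^-2], so [1 + g(p) T_p] alone has local factor about [1 + 1/p], a
    divergent product. After the correction the factors are [1 + O(p^-2)]; the sum over [a] with
    weight [a^-2] undoes the correction. The linear term of [D] cannot be read off term by term in
    [a], because the expansion of the inner sum fails once [a x] is of order 1. If [E] is the error
    of its two leading terms, the sum of [E(a x) / a^2] is [x] times a Riemann sum of mesh [x] for
    the integral of [E(v) / v^2] over the half-line. This integrand has an explicit primitive built
    from the dilated sum of a second function [B], and Euler-Maclaurin for [B] gives [- kappa / 12],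
    where a contour shift would use [zeta(-1)]. The kernel before smoothing has an infinite
    derivative at the edge of its support, so the value of [kappa] is obtained from integrated
    identities instead of differentiation under the integral. *)

Fixpoint derivable_upto (P : R -> Prop) (n : nat) (f : R -> R) : Prop :=
  match n with
  | O => True
  | S m => exists f' : R -> R,
      (forall x, P x -> is_derive f x (f' x)) /\ derivable_upto P m f'
  end.

Definition smooth_on (P : R -> Prop) (f : R -> R) : Prop :=
  forall n, derivable_upto P n f.

Definition smooth (f : R -> R) : Prop := smooth_on (fun _ => True) f.

Lemma derivable_upto_ext (P : R -> Prop) (n : nat) (f g : R -> R) :
  open P -> (forall x, P x -> f x = g x) ->
  derivable_upto P n f -> derivable_upto P n g.
Proof.
intros oP. destruct n as [|n]; [easy|].
intros e [f' [H1 H2]]. exists f'. split; [|exact H2].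
intros x Px. apply is_derive_ext_loc with f; [|now apply H1].
generalize (oP x Px). apply filter_imp. exact e.
Qed.

Lemma derivable_upto_S (P : R -> Prop) (n : nat) (f : R -> R) :
  derivable_upto P (S n) f -> derivable_upto P n f.
Proof.
revert f. induction n as [|n IH]; intros f; [easy|].
intros [f' [H1 H2]]. exists f'. split; [exact H1|]. now apply IH.
Qed.

Lemma derivable_upto_const (P : R -> Prop) (n : nat) (c : R) :
  derivable_upto P n (fun _ => c).
Proof.
revert c. induction n as [|n IH]; intros c; [exact I|].
exists (fun _ => 0). split; [|apply IH].
intros x _. apply (is_derive_const (V := R_NormedModule)).
Qed.

Lemma derivable_upto_id (P : R -> Prop) (n : nat) :
  derivable_upto P n (fun x => x).
Proof.
destruct n as [|n]; [exact I|].
exists (fun _ => 1). split; [|apply derivable_upto_const].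
intros x _. apply is_derive_Reals, derivable_pt_lim_id.
Qed.

Lemma derivable_upto_plus (P : R -> Prop) (n : nat) (f g : R -> R) :
  derivable_upto P n f -> derivable_upto P n g ->
  derivable_upto P n (fun x => f x + g x).
Proof.
revert f g. induction n as [|n IH]; intros f g; [easy|].
intros [f' [F1 F2]] [g' [G1 G2]].
exists (fun x => f' x + g' x). split; [|now apply IH].
intros x Px. apply (is_derive_plus (V := R_NormedModule)); auto.
Qed.

Lemma derivable_upto_mult (P : R -> Prop) (n : nat) (f g : R -> R) :
  derivable_upto P n f -> derivable_upto P n g ->
  derivable_upto P n (fun x => f x * g x).
Proof.
revert f g. induction n as [|n IH]; intros f g; [easy|].
intros Hf Hg. pose proof (derivable_upto_S _ _ _ Hf) as Hf0.
pose proof (derivable_upto_S _ _ _ Hg) as Hg0.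
destruct Hf as [f' [F1 F2]], Hg as [g' [G1 G2]].
exists (fun x => f' x * g x + f x * g' x).
split; [|now apply derivable_upto_plus; apply IH].
intros x Px. apply (is_derive_mult f g); auto. intros; apply Rmult_comm.
Qed.

Lemma derivable_upto_comp (P Q : R -> Prop) (n : nat) (f g : R -> R) :
  (forall x, P x -> Q (g x)) ->
  derivable_upto Q n f -> derivable_upto P n g ->
  derivable_upto P n (fun x => f (g x)).
Proof.
intros PQ. revert f. induction n as [|n IH]; intros f; [easy|].
intros [f' [F1 F2]] Hg. pose proof (derivable_upto_S _ _ _ Hg) as Hg0.
destruct Hg as [g' [G1 G2]].
exists (fun x => g' x * f' (g x)).
split; [|now apply derivable_upto_mult; [|apply IH]].
intros x Px. apply (is_derive_comp (V := R_NormedModule)); auto.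
Qed.

Lemma derivable_upto_inv (n : nat) :
  derivable_upto (fun x => 0 < x) n Rinv.
Proof.
induction n as [|n IH]; [exact I|].
exists (fun x => (-1) * (/ x * / x)). split.
- intros x hx. auto_derive; [lra|]. field. lra.
- apply derivable_upto_mult; [apply derivable_upto_const|].
  now apply derivable_upto_mult.
Qed.

Lemma smooth_on_plus (P : R -> Prop) (f g : R -> R) :
  smooth_on P f -> smooth_on P g -> smooth_on P (fun x => f x + g x).
Proof. intros Hf Hg n. now apply derivable_upto_plus. Qed.

Lemma smooth_on_mult (P : R -> Prop) (f g : R -> R) :
  smooth_on P f -> smooth_on P g -> smooth_on P (fun x => f x * g x).
Proof. intros Hf Hg n. now apply derivable_upto_mult. Qed.

Lemma smooth_on_const (P : R -> Prop) (c : R) : smooth_on P (fun _ => c).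
Proof. intros n. apply derivable_upto_const. Qed.

Lemma smooth_on_id (P : R -> Prop) : smooth_on P (fun x => x).
Proof. intros n. apply derivable_upto_id. Qed.

Lemma smooth_on_ext (P : R -> Prop) (f g : R -> R) :
  open P -> (forall x, P x -> f x = g x) -> smooth_on P f -> smooth_on P g.
Proof. intros oP e Hf n. now apply derivable_upto_ext with f. Qed.

Lemma smooth_ext (f g : R -> R) :
  (forall x, f x = g x) -> smooth f -> smooth g.
Proof. intros e. apply smooth_on_ext; [apply open_true|auto]. Qed.

Lemma smooth_restrict (P : R -> Prop) (f : R -> R) : smooth f -> smooth_on P f.
Proof.
intros H n. generalize (H n). clear H. revert f.
induction n as [|n IH]; intros f; [easy|].
intros [f' [H1 H2]]. exists f'. split; auto.
Qed.

(* Any two choices of the derivative agree on the open set. *)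
Lemma smooth_on_derivative (P : R -> Prop) (f : R -> R) : open P ->
  smooth_on P f ->
  exists f', (forall x, P x -> is_derive f x (f' x)) /\ smooth_on P f'.
Proof.
intros oP H. destruct (H 1%nat) as [f' [H1 _]]. exists f'. split; [exact H1|].
intros n. destruct (H (S n)) as [g [G1 G2]].
apply derivable_upto_ext with g; [exact oP| |exact G2].
intros x Px. rewrite <- (is_derive_unique _ _ _ (H1 x Px)).
symmetry. now apply is_derive_unique, G1.
Qed.

Lemma smooth_derivative (f : R -> R) : smooth f ->
  exists f', (forall x, is_derive f x (f' x)) /\ smooth f'.
Proof.
intros H. destruct (smooth_on_derivative _ _ open_true H) as [f' [H1 H2]].
exists f'. split; auto.
Qed.

Lemma smooth_continuous (f : R -> R) (x : R) : smooth f -> continuous f x.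
Proof.
intros H. destruct (smooth_derivative f H) as [f' [H1 _]].
apply (ex_derive_continuous (V := R_NormedModule)). now exists (f' x).
Qed.

(** Since [f] vanishes up to [e > 0], the two regions [x < e] and [x > 0] overlap and cover the
    line. The glued derivative vanishes up to [e] as well, which lets the induction repeat. *)
Lemma derivable_upto_glue (n : nat) (f : R -> R) (e : R) : 0 < e ->
  (forall x, x < e -> f x = 0) ->
  derivable_upto (fun x => 0 < x) n f -> derivable_upto (fun _ => True) n f.
Proof.
intros he. revert f. induction n as [|n IH]; intros f Hz; [easy|].
intros [f' [H1 H2]].
assert (D0 : forall x, x < e -> is_derive f x 0).
{ intros x hx. apply is_derive_ext_loc with (fun _ => 0).
  - generalize (open_lt e x hx). apply filter_imp. intros t ht. now rewrite Hz.
  - apply (is_derive_const (V := R_NormedModule)). }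
exists (fun x => if Rlt_dec 0 x then f' x else 0). split.
- intros x _. destruct (Rlt_dec 0 x); [now apply H1|]. apply D0. lra.
- apply IH.
  + intros x hx. destruct (Rlt_dec 0 x); [|reflexivity].
    rewrite <- (is_derive_unique _ _ _ (D0 x hx)). symmetry.
    now apply is_derive_unique, H1.
  + apply derivable_upto_ext with f'; [apply open_gt| |exact H2].
    intros x hx. destruct (Rlt_dec 0 x); [reflexivity|lra].
Qed.

Lemma smooth_glue (f : R -> R) (e : R) : 0 < e ->
  (forall x, x < e -> f x = 0) -> smooth_on (fun x => 0 < x) f -> smooth f.
Proof. intros he Hz H n. now apply derivable_upto_glue with e. Qed.

Lemma smooth_antiderivative (f : R -> R) (a : R) : smooth f ->
  smooth (RInt f a) /\ forall x, is_derive (RInt f a) x (f x).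
Proof.
intros H.
assert (D : forall x, is_derive (RInt f a) x (f x)).
{ intros x. apply (is_derive_RInt (V := R_NormedModule) f (RInt f a) a x).
  - apply filter_forall. intros t. apply (RInt_correct (V := R_CompleteNormedModule)).
    apply (ex_RInt_continuous (V := R_CompleteNormedModule)).
    intros z _. now apply smooth_continuous.
  - now apply smooth_continuous. }
split; [|exact D].
intros [|n]; [exact I|]. exists f. split; auto.
Qed.

Lemma bounded_of_continuous_vanishing (f : R -> R) (L : R) :
  (forall x, continuous f x) -> (forall x, L <= x -> f x = 0) ->
  exists M, 0 <= M /\ forall x, 0 <= x -> Rabs (f x) <= M.
Proof.
intros Hc Hz.
destruct (continuity_ab_maj (fun x => Rabs (f x)) 0 (Rmax 0 L)) as [m [Hm _]].
- apply Rmax_l.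
- intros c _. apply continuity_pt_filterlim.
  apply (continuous_comp f Rabs); [apply Hc|apply continuous_Rabs].
- exists (Rabs (f m)). split; [apply Rabs_pos|].
  intros x hx. destruct (Rle_dec x (Rmax 0 L)); [apply Hm; lra|].
  rewrite Hz; [rewrite Rabs_R0; apply Rabs_pos|].
  pose proof (Rmax_r 0 L). lra.
Qed.

(** * The value of zeta at 2 *)

Definition zeta (s : nat) : R := Series (fun n => / INR (S n) ^ s).

Lemma RInt_linear (f g : R -> R) (a b u v : R) :
  (forall x, continuous f x) -> (forall x, continuous g x) ->
  RInt (fun x => a * f x + b * g x) u v = a * RInt f u v + b * RInt g u v.
Proof.
intros Hf Hg. apply (is_RInt_unique (V := R_CompleteNormedModule)).
assert (C : forall h : R -> R, (forall x, continuous h x) -> is_RInt h u v (RInt h u v)).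
{ intros h Hh. apply (RInt_correct (V := R_CompleteNormedModule)).
  apply (ex_RInt_continuous (V := R_CompleteNormedModule)). auto. }
apply (is_RInt_plus (V := R_NormedModule));
  apply (is_RInt_scal (V := R_NormedModule)); auto.
Qed.

Lemma RInt_of_derivative (f df : R -> R) (a b : R) :
  (forall x, is_derive f x (df x)) -> (forall x, continuous df x) ->
  RInt df a b = f b - f a.
Proof.
intros H1 H2. apply (is_RInt_unique (V := R_CompleteNormedModule)).
apply (is_RInt_derive (V := R_CompleteNormedModule)); auto.
Qed.

Lemma continuous_of_ex_derive (f : R -> R) (x : R) : ex_derive f x -> continuous f x.
Proof. apply (ex_derive_continuous (V := R_NormedModule)). Qed.

Lemma continuity_pt_of_ex_derive (f : R -> R) (x : R) :
  ex_derive f x -> continuity_pt f x.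
Proof. intros H. apply continuity_pt_filterlim. now apply continuous_of_ex_derive. Qed.

Lemma is_series_of_lim (u : nat -> R) (l : R) :
  is_lim_seq (sum_n u) (Finite l) -> is_series u l.
Proof. intros H. exact H. Qed.

Lemma Derive_of_is_derive (f : R -> R) (x l : R) :
  is_derive f x l -> Derive (fun t : R => f t) x = l.
Proof. exact (is_derive_unique f x l). Qed.

Definition cosI (n : nat) : R := RInt (fun x => cos x ^ (2 * n)) 0 (PI / 2).
Definition cosJ (n : nat) : R := RInt (fun x => x ^ 2 * cos x ^ (2 * n)) 0 (PI / 2).

Lemma continuous_cosI (n : nat) (x : R) : continuous (fun x => cos x ^ (2 * n)) x.
Proof. apply continuous_of_ex_derive. auto_derive. exact I. Qed.

Lemma continuous_cosJ (n : nat) (x : R) :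
  continuous (fun x => x ^ 2 * cos x ^ (2 * n)) x.
Proof. apply continuous_of_ex_derive. auto_derive. exact I. Qed.

Lemma sin2_cos2 (x : R) : sin x * sin x = 1 - cos x * cos x.
Proof. pose proof (sin2 x) as H. unfold Rsqr in H. lra. Qed.

Lemma cosI_S (m : nat) : 2 * (INR m + 1) * cosI (S m) = (2 * INR m + 1) * cosI m.
Proof.
assert (H : RInt (fun x => 2 * (INR m + 1) * cos x ^ (2 * S m)
                    + - (2 * INR m + 1) * cos x ^ (2 * m)) 0 (PI / 2) = 0 :> R).
{ rewrite (RInt_of_derivative (fun x => sin x * cos x ^ (2 * m + 1))).
  - rewrite cos_PI2, sin_0, pow_ne_zero by lia. ring.
  - intros x. auto_derive; [exact I|].
    replace (2 * S m)%nat with (S (S (2 * m))) by lia.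
    replace (pred (m + (m + 0) + 1)) with (2 * m)%nat by lia.
    replace (m + (m + 0) + 1)%nat with (S (2 * m)) by lia.
    rewrite S_INR, mult_INR; simpl (INR 2); simpl pow.
    generalize (cos x ^ (m + (m + 0))); intros c.
    apply Rminus_diag_uniq.
    match goal with |- ?e = 0 => replace e with
      ((2 * INR m + 1) * c * ((1 - cos x * cos x) - sin x * sin x)) by ring end.
    rewrite sin2_cos2. ring.
  - intros x. apply continuous_of_ex_derive. auto_derive. exact I. }
rewrite RInt_linear in H by (intros; apply continuous_cosI).
unfold cosI. lra.
Qed.

(** Two integrations by parts of [cosI (S m)], packaged as the integral of one exact derivative
    whose primitive vanishes at both ends. *)
Lemma cosI_cosJ (m : nat) :
  cosI (S m) + 2 * (INR m + 1) ^ 2 * cosJ (S m)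
    - (INR m + 1) * (2 * INR m + 1) * cosJ m = 0.
Proof.
assert (H : RInt (fun x => 1 * (1 * cos x ^ (2 * S m)
     + 2 * (INR m + 1) ^ 2 * (x ^ 2 * cos x ^ (2 * S m)))
     + - ((INR m + 1) * (2 * INR m + 1)) * (x ^ 2 * cos x ^ (2 * m))) 0 (PI / 2) = 0 :> R).
{ rewrite (RInt_of_derivative (fun x => x * cos x ^ (2 * m + 2)
      + (INR m + 1) * x ^ 2 * sin x * cos x ^ (2 * m + 1))).
  - rewrite cos_PI2, sin_0, !pow_ne_zero by lia. ring.
  - intros x. auto_derive; [exact I|].
    replace (2 * S m)%nat with (S (S (2 * m))) by lia.
    replace (pred (m + (m + 0) + 1)) with (2 * m)%nat by lia.
    replace (pred (m + (m + 0) + 2)) with (S (2 * m)) by lia.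
    replace (m + (m + 0) + 1)%nat with (S (2 * m)) by lia.
    replace (m + (m + 0) + 2)%nat with (S (S (2 * m))) by lia.
    rewrite !S_INR, mult_INR; simpl (INR 2); simpl pow.
    generalize (cos x ^ (m + (m + 0))); intros c.
    apply Rminus_diag_uniq.
    match goal with |- ?e = 0 => replace e with
      ((INR m + 1) * (2 * INR m + 1) * (x * x) * c
        * ((1 - cos x * cos x) - sin x * sin x)) by ring end.
    rewrite sin2_cos2. ring.
  - intros x. apply continuous_of_ex_derive. auto_derive. exact I. }
rewrite RInt_linear in H; [rewrite RInt_linear in H| |].
- unfold cosI, cosJ. lra.
- intros; apply continuous_cosI.
- intros; apply continuous_cosJ.
- intros x. apply continuous_of_ex_derive. auto_derive. exact I.
- intros; apply continuous_cosJ.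
Qed.

Lemma cosI_0 : cosI 0 = PI / 2.
Proof.
unfold cosI. rewrite (RInt_of_derivative (fun x => x)).
- lra.
- intros x. simpl. apply is_derive_Reals, derivable_pt_lim_id.
- intros x. apply continuous_cosI.
Qed.

Lemma cosJ_0 : cosJ 0 = PI ^ 3 / 24.
Proof.
unfold cosJ. rewrite (RInt_of_derivative (fun x => x ^ 3 / 3)).
- field.
- intros x. auto_derive; [exact I|]. simpl. field.
- intros x. apply continuous_cosJ.
Qed.

Lemma cosI_pos (n : nat) : 0 < cosI n.
Proof.
induction n as [|m IH]; [rewrite cosI_0; pose proof PI_RGT_0; lra|].
pose proof (cosI_S m). pose proof (pos_INR m). nra.
Qed.

Lemma x_cos_le_sin (x : R) : 0 <= x <= PI / 2 -> x * cos x <= sin x.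
Proof.
intros hx. destruct (MVT_gen (fun x => sin x - x * cos x) 0 x (fun x => x * sin x))
  as [c [hc e]].
- intros t _. auto_derive; [exact I|]. ring.
- intros t _. apply continuity_pt_of_ex_derive. auto_derive. exact I.
- rewrite Rmin_left, Rmax_right in hc by lra.
  rewrite sin_0 in e. pose proof (sin_ge_0 c). pose proof PI_RGT_0.
  assert (0 <= sin c) by (apply H; lra).
  assert (0 <= c * sin c * (x - 0))
    by (apply Rmult_le_pos; [apply Rmult_le_pos|]; lra). lra.
Qed.

(** Multiply [(x cos x)^2 <= sin^2 x] by [cos^(2m) x] and integrate. By [cosI_S] the upper bound is
    [cosI (S m) / (2 m + 1)], which makes the remainder of the telescoping sum vanish. *)
Lemma cosJ_bound (m : nat) : 0 <= cosJ (S m) <= cosI m - cosI (S m).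
Proof.
pose proof PI_RGT_0.
assert (E : forall h : R -> R, (forall x, continuous h x) -> ex_RInt h 0 (PI / 2)).
{ intros h Hh. apply (ex_RInt_continuous (V := R_CompleteNormedModule)). auto. }
split.
- apply RInt_ge_0; [lra|apply E, continuous_cosJ|].
  intros x _. apply Rmult_le_pos; [apply pow2_ge_0|].
  rewrite pow_mult. apply pow_le, pow2_ge_0.
- replace (cosI m - cosI (S m)) with (1 * cosI m + -1 * cosI (S m)) by ring.
  unfold cosI, cosJ. rewrite <- RInt_linear by apply continuous_cosI.
  apply RInt_le; [lra|apply E, continuous_cosJ| |].
  + apply E. intros x. apply continuous_of_ex_derive. auto_derive. exact I.
  + intros x hx. assert (h : 0 <= x <= PI / 2) by lra.
    pose proof (x_cos_le_sin x h). pose proof (cos_ge_0 x).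
    replace (2 * S m)%nat with (2 + 2 * m)%nat by lia.
    rewrite pow_add.
    assert (0 <= cos x ^ (2 * m)) by (rewrite pow_mult; apply pow_le, pow2_ge_0).
    set (c := cos x ^ (2 * m)) in *.
    replace (1 * c + -1 * (cos x ^ 2 * c)) with ((1 - cos x * cos x) * c) by ring.
    rewrite <- sin2_cos2. rewrite <- Rmult_assoc. apply Rmult_le_compat_r; [easy|].
    assert (0 <= x * cos x) by (apply Rmult_le_pos; [lra|apply H1; lra]). nra.
Qed.

(* Matsuoka's proof: the recurrences make [1 / (m + 1)^2] telescope. *)
Lemma is_series_inv_squares : is_series (fun n => / INR (S n) ^ 2) (PI ^ 2 / 6).
Proof.
assert (P : forall M, sum_n (fun n => / INR (S n) ^ 2) M
          = 2 * (PI ^ 2 / 12 - cosJ (S M) / cosI (S M)) :> R).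
{ assert (St : forall m, / INR (S m) ^ 2
       = 2 * (cosJ m / cosI m - cosJ (S m) / cosI (S m))).
  { intros m. pose proof (cosI_S m) as H1. pose proof (cosI_cosJ m) as H2.
    pose proof (pos_INR m). pose proof (cosI_pos m).
    assert (H4 : cosI (S m) = (2 * INR m + 1) * cosI m / (2 * (INR m + 1))).
    { rewrite <- H1. field. lra. }
    assert (H3 : cosJ (S m) = ((INR m + 1) * (2 * INR m + 1) * cosJ m - cosI (S m))
              / (2 * (INR m + 1) ^ 2)).
    { replace ((INR m + 1) * (2 * INR m + 1) * cosJ m - cosI (S m))
        with (2 * (INR m + 1) ^ 2 * cosJ (S m)) by lra. field. lra. }
    rewrite H3, H4, S_INR. field. repeat split; lra. }
  induction M as [|M IH].
  - rewrite sum_O, St, cosI_0, cosJ_0. pose proof PI_RGT_0.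
    pose proof (cosI_pos 1). field. split; lra.
  - rewrite sum_Sn, IH, St. unfold plus; simpl. ring. }
apply is_series_of_lim. apply is_lim_seq_ext with
  (fun M => 2 * (PI ^ 2 / 12 - cosJ (S M) / cosI (S M))); [now intros; rewrite P|].
replace (PI ^ 2 / 6) with (2 * (PI ^ 2 / 12 - 0)) by field.
apply (is_lim_seq_scal_l _ 2 (Finite (PI ^ 2 / 12 - 0))).
apply is_lim_seq_minus'; [apply is_lim_seq_const|].
apply is_lim_seq_le_le with (fun _ => 0) (fun M => / (INR M + 1)).
- intros m. pose proof (cosJ_bound m). pose proof (cosI_pos (S m)).
  pose proof (cosI_S m). pose proof (pos_INR m).
  split; [apply Rdiv_le_0_compat; lra|].
  apply Rmult_le_reg_r with (cosI (S m)); [lra|].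
  unfold Rdiv. rewrite Rmult_assoc, Rinv_l, Rmult_1_r by lra.
  apply Rle_trans with (cosI m - cosI (S m)); [lra|].
  apply Rmult_le_reg_l with (INR m + 1); [lra|].
  rewrite <- Rmult_assoc, Rinv_r, Rmult_1_l by lra. nra.
- apply is_lim_seq_const.
- apply is_lim_seq_ext with (fun M => / INR (S M)); [now intros; rewrite S_INR|].
  apply (is_lim_seq_incr_1 (fun M => / INR M)).
  replace (Finite 0) with (Rbar_inv p_infty) by reflexivity.
  apply is_lim_seq_inv; [apply is_lim_seq_INR|easy].
Qed.

Lemma zeta_2 : zeta 2 = PI ^ 2 / 6.
Proof. apply is_series_unique, is_series_inv_squares. Qed.

Lemma ex_series_inv_pow (s : nat) : (2 <= s)%nat ->
  ex_series (fun n => / INR (S n) ^ s).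
Proof.
intros hs. apply (ex_series_le (V := R_CompleteNormedModule)
  _ (fun n => / INR (S n) ^ 2)).
- intros n. assert (1 <= INR (S n)) by (rewrite S_INR; pose proof (pos_INR n); lra).
  change (norm (/ INR (S n) ^ s)) with (Rabs (/ INR (S n) ^ s)).
  rewrite Rabs_pos_eq by (left; apply Rinv_0_lt_compat, pow_lt; lra).
  apply Rinv_le_contravar; [apply pow_lt; lra|]. now apply Rle_pow.
- eexists. apply is_series_inv_squares.
Qed.

(** * Euler-Maclaurin summation of dilated sums *)

Definition dilated_sum (f : R -> R) (x : R) : R :=
  Series (fun m => f (INR (S m) * x)).

Lemma is_series_finite_support (u : nat -> R) (M : nat) :
  (forall m, (M < m)%nat -> u m = 0) -> is_series u (sum_n u M).
Proof.
intros Hz. apply is_series_of_lim.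
apply (is_lim_seq_ext_loc (fun _ => sum_n u M)); [|apply is_lim_seq_const].
exists M. intros n hn. induction hn as [|n hn IH]; [reflexivity|].
rewrite sum_Sn, <- IH, Hz by lia. symmetry. apply Rplus_0_r.
Qed.

Lemma Series_finite_support (u : nat -> R) (M : nat) :
  (forall m, (M < m)%nat -> u m = 0) -> Series u = sum_n u M.
Proof. intros Hz. now apply is_series_unique, is_series_finite_support. Qed.

Lemma dilated_sum_finite (f : R -> R) (L x : R) (M : nat) :
  0 < x -> (forall v, L <= v -> f v = 0) -> L <= (INR M + 1) * x ->
  dilated_sum f x = sum_n (fun m => f (INR (S m) * x)) M.
Proof.
intros hx Hz hM. apply Series_finite_support. intros m hm. apply Hz.
apply le_INR in hm. rewrite !S_INR in *. nra.
Qed.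

(** A bound on a high derivative is integrated down by repeated use, each time gaining a power of
    [t]. The mean value theorem loses the factor [1 / (n + 1)], which is harmless here. *)
Lemma power_bound_of_derivative (g g' : R -> R) (C : R) (n : nat) :
  (forall t, 0 <= t -> is_derive g t (g' t)) -> g 0 = 0 -> 0 <= C ->
  (forall t, 0 <= t -> Rabs (g' t) <= C * t ^ n) ->
  forall t, 0 <= t -> Rabs (g t) <= C * t ^ S n.
Proof.
intros D g0 hC B t ht.
destruct (MVT_gen g 0 t g') as [c [hc e]].
- intros x. rewrite Rmin_left by lra. intros hx. apply D. lra.
- intros x. rewrite Rmin_left by lra. intros hx. apply continuity_pt_filterlim.
  apply (ex_derive_continuous (V := R_NormedModule)). exists (g' x). apply D. lra.
- rewrite Rmin_left, Rmax_right in hc by lra.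
  rewrite g0, !Rminus_0_r in e. rewrite e, Rabs_mult, (Rabs_pos_eq t) by lra.
  simpl. rewrite (Rmult_comm t), <- Rmult_assoc. apply Rmult_le_compat_r; [lra|].
  apply Rle_trans with (C * c ^ n); [apply B; lra|].
  apply Rmult_le_compat_l; [lra|]. apply pow_incr. lra.
Qed.

Lemma sum_n_S (u : nat -> R) (n : nat) : sum_n u (S n) = sum_n u n + u (S n) :> R.
Proof. exact (sum_Sn u n). Qed.

Section EulerMaclaurin.

Variables (f F f1 f2 f3 f4 : R -> R) (M4 : R).
Hypothesis DF : forall x, is_derive F x (f x).
Hypothesis D1 : forall x, is_derive f x (f1 x).
Hypothesis D2 : forall x, is_derive f1 x (f2 x).
Hypothesis D3 : forall x, is_derive f2 x (f3 x).
Hypothesis D4 : forall x, is_derive f3 x (f4 x).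
Hypothesis hM4 : 0 <= M4.
Hypothesis B4 : forall x, 0 <= x -> Rabs (f4 x) <= M4.

(** This is the error of the corrected trapezoidal rule on one cell. As a function of [t] it
    vanishes at [0] together with its first two derivatives, and its third derivative is
    [- t^2 / 12 * f4 (a + t)]. *)
Lemma euler_maclaurin_cell (a t : R) : 0 <= a -> 0 <= t ->
  Rabs (t / 2 * (f a + f (a + t)) - (F (a + t) - F a)
        - t ^ 2 / 12 * (f1 (a + t) - f1 a)) <= M4 * t ^ 5.
Proof.
intros ha ht.
apply (power_bound_of_derivative
  (fun t => t / 2 * (f a + f (a + t)) - (F (a + t) - F a)
        - t ^ 2 / 12 * (f1 (a + t) - f1 a))
  (fun t => (f a + f (a + t)) / 2 + t / 2 * f1 (a + t) - f (a + t)
     - t / 6 * (f1 (a + t) - f1 a) - t ^ 2 / 12 * f2 (a + t))); trivial.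
{ intros s hs. auto_derive.
  - repeat split; eexists; eauto.
  - rewrite (is_derive_unique _ _ _ (DF _)), (is_derive_unique _ _ _ (D1 _)),
      (is_derive_unique _ _ _ (D2 _)). field. }
{ rewrite Rplus_0_r. field. }
apply (power_bound_of_derivative
  _ (fun t => t / 6 * f2 (a + t) - (f1 (a + t) - f1 a) / 6
              - t ^ 2 / 12 * f3 (a + t))); trivial.
{ intros s hs. auto_derive.
  - repeat split; eexists; eauto.
  - rewrite (is_derive_unique _ _ _ (D1 _)), (is_derive_unique _ _ _ (D2 _)),
      (is_derive_unique _ _ _ (D3 _)). field. }
{ rewrite Rplus_0_r. field. }
apply (power_bound_of_derivative _ (fun t => - (t ^ 2 / 12) * f4 (a + t))); trivial.
{ intros s hs. auto_derive.
  - repeat split; eexists; eauto.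
  - rewrite (is_derive_unique _ _ _ (D2 _)), (is_derive_unique _ _ _ (D3 _)),
      (is_derive_unique _ _ _ (D4 _)). field. }
{ rewrite Rplus_0_r. field. }
intros s hs. rewrite Rabs_mult, Rabs_Ropp, Rabs_pos_eq by nra.
specialize (B4 (a + s) ltac:(lra)). pose proof (Rabs_pos (f4 (a + s))). nra.
Qed.

Lemma euler_maclaurin_sum (x : R) (M : nat) : 0 <= x ->
  Rabs (x * (f 0 / 2 + sum_n (fun m => f (INR (S m) * x)) M
             - f (INR (S M) * x) / 2)
        - (F (INR (S M) * x) - F 0)
        - x ^ 2 / 12 * (f1 (INR (S M) * x) - f1 0))
  <= INR (S M) * (M4 * x ^ 5).
Proof.
intros hx. induction M as [|M IH].
- rewrite sum_O. simpl INR. rewrite !Rmult_1_l.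
  pose proof (euler_maclaurin_cell 0 x (Rle_refl 0) hx) as H.
  rewrite Rplus_0_l in H. refine (Rle_trans _ _ _ _ H). right. f_equal. field.
- rewrite sum_n_S.
  assert (ha : 0 <= INR (S M) * x) by (apply Rmult_le_pos; [apply pos_INR|lra]).
  pose proof (euler_maclaurin_cell _ x ha hx) as H.
  rewrite (S_INR (S M)).
  replace ((INR (S M) + 1) * x) with (INR (S M) * x + x) by ring.
  set (a := INR (S M) * x) in *.
  rewrite (Rmult_plus_distr_r (INR (S M)) 1), Rmult_1_l.
  refine (Rle_trans _ _ _ _ (Rplus_le_compat _ _ _ _ IH H)).
  refine (Rle_trans _ _ _ _ (Rabs_triang _ _)). right. f_equal.
  set (s := sum_n _ _). field.
Qed.

End EulerMaclaurin.

Lemma derivative_zero_beyond (f f' : R -> R) (L : R) :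
  (forall x, is_derive f x (f' x)) -> (forall x, L <= x -> f x = 0) ->
  (forall x, continuous f' x) ->
  forall x, L <= x -> f' x = 0.
Proof.
intros D Hz Hc.
assert (Hlt : forall x, L < x -> f' x = 0).
{ intros x hx. rewrite <- (is_derive_unique _ _ _ (D x)).
  apply is_derive_unique. apply is_derive_ext_loc with (fun _ => 0).
  - generalize (open_gt L x hx). apply filter_imp. intros t ht. rewrite Hz; lra.
  - apply (is_derive_const (V := R_NormedModule)). }
intros x [hx|hx]; [now apply Hlt|]. subst x.
destruct (Req_dec (f' L) 0) as [e|ne]; [exact e|exfalso].
assert (he : 0 < Rabs (f' L)) by now apply Rabs_pos_lt.
specialize (Hc L (ball (f' L) (mkposreal _ he)) (locally_ball _ _)).
destruct Hc as [d Hd]. specialize (Hd (L + d / 2)).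
assert (b : ball L d (L + d / 2)).
{ change (Rabs (L + d / 2 - L) < d). pose proof (cond_pos d).
  rewrite Rabs_pos_eq; lra. }
specialize (Hd b). change (Rabs (f' (L + d / 2) - f' L) < Rabs (f' L)) in Hd.
rewrite Hlt in Hd by (pose proof (cond_pos d); lra).
rewrite Rminus_0_l, Rabs_Ropp in Hd. lra.
Qed.

Lemma euler_maclaurin (f f1 : R -> R) (L : R) : 0 < L ->
  smooth f -> (forall x, is_derive f x (f1 x)) -> (forall x, L <= x -> f x = 0) ->
  exists C, 0 <= C /\ forall x, 0 < x <= 1 ->
    Rabs (x * dilated_sum f x + x * f 0 / 2 - RInt f 0 L + x ^ 2 / 12 * f1 0)
    <= C * x ^ 4.
Proof.
intros hL Sf D1 Hz.
destruct (smooth_derivative f Sf) as [g [G1 Sg]].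
assert (e : forall x, f1 x = g x).
{ intros x. rewrite <- (is_derive_unique _ _ _ (D1 x)). now apply is_derive_unique. }
assert (Hz1 : forall x, L <= x -> f1 x = 0).
{ intros x hx. rewrite e. apply (derivative_zero_beyond f g L); trivial.
  intros; now apply smooth_continuous. }
assert (S1 : smooth f1) by (apply smooth_ext with g; [now intros|exact Sg]).
clear g G1 Sg e.
destruct (smooth_derivative f1 S1) as [f2 [D2 S2]].
destruct (smooth_derivative f2 S2) as [f3 [D3 S3]].
destruct (smooth_derivative f3 S3) as [f4 [D4 S4]].
assert (Hz4 : forall x, L <= x -> f4 x = 0).
{ assert (Hz2 : forall x, L <= x -> f2 x = 0)
    by (apply (derivative_zero_beyond f1); trivial; intros; now apply smooth_continuous).
  assert (Hz3 : forall x, L <= x -> f3 x = 0)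
    by (apply (derivative_zero_beyond f2); trivial; intros; now apply smooth_continuous).
  apply (derivative_zero_beyond f3); trivial. intros; now apply smooth_continuous. }
destruct (bounded_of_continuous_vanishing f4 L) as [M4 [hM4 B4]]; trivial.
{ intros; now apply smooth_continuous. }
destruct (smooth_antiderivative f 0 Sf) as [_ DF].
(* At most [L / x + 1] cells, each with error [M4 * x ^ 5], and [x <= 1]. *)
exists ((L + 1) * M4). split; [nra|]. intros x hx.
destruct (nfloor_ex (L / x)) as [M [hM1 hM2]]; [apply Rdiv_le_0_compat; lra|].
assert (hM : L <= (INR M + 1) * x).
{ apply Rmult_lt_compat_r with (r := x) in hM2; [|lra].
  unfold Rdiv in hM2. rewrite Rmult_assoc, Rinv_l in hM2; lra. }
assert (hM' : INR M * x <= L).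
{ apply Rmult_le_compat_r with (r := x) in hM1; [|lra].
  unfold Rdiv in hM1. rewrite Rmult_assoc, Rinv_l in hM1; lra. }
rewrite (dilated_sum_finite f L x M) by (trivial; lra).
pose proof (euler_maclaurin_sum f (RInt f 0) f1 f2 f3 f4 M4 DF D1 D2 D3 D4 hM4 B4
  x M ltac:(lra)) as H.
rewrite S_INR in H. rewrite (Hz ((INR M + 1) * x)), (Hz1 ((INR M + 1) * x)) in H by easy.
assert (eI : RInt f 0 ((INR M + 1) * x) = RInt f 0 L).
{ rewrite <- (RInt_Chasles f 0 L ((INR M + 1) * x)).
  - rewrite (RInt_ext f (fun _ => 0) L).
    + rewrite RInt_const. unfold plus, scal; simpl; unfold mult; simpl. ring.
    + intros t. rewrite Rmin_left by easy. intros ht. apply Hz. lra.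
  - apply (ex_RInt_continuous (V := R_CompleteNormedModule)).
    intros; now apply smooth_continuous.
  - apply (ex_RInt_continuous (V := R_CompleteNormedModule)).
    intros; now apply smooth_continuous. }
rewrite eI, RInt_point in H.
apply Rle_trans with ((INR M + 1) * (M4 * x ^ 5)).
- refine (Rle_trans _ _ _ _ H). right. f_equal. unfold zero; simpl. field.
- replace ((INR M + 1) * (M4 * x ^ 5)) with ((INR M * x + x) * (M4 * x ^ 4)) by ring.
  rewrite Rmult_assoc. apply Rmult_le_compat_r; [|lra].
  apply Rmult_le_pos; [easy|apply pow_le; lra].
Qed.

(** Combines a bound near [0] with decay at infinity into one majorant, using
    [(1 + x)^2 <= 4 max(1, x^2)]. *)
Lemma inv_square_majorant (x g A : R) : 0 < x -> 0 <= A ->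
  (x <= 1 -> Rabs g <= A) -> (1 <= x -> Rabs g <= A / x ^ 2) ->
  Rabs g <= 4 * A / (1 + x) ^ 2.
Proof.
intros hx hA H1 H2. assert (p : 0 < (1 + x) ^ 2) by (apply pow_lt; lra).
destruct (Rle_dec x 1) as [h|h].
- apply Rle_trans with A; [auto|].
  apply Rmult_le_reg_r with ((1 + x) ^ 2); [easy|].
  unfold Rdiv. rewrite Rmult_assoc, Rinv_l, Rmult_1_r by lra.
  rewrite (Rmult_comm 4). apply Rmult_le_compat_l; [easy|]. nra.
- apply Rle_trans with (A / x ^ 2); [apply H2; lra|].
  rewrite (Rmult_comm 4). unfold Rdiv. rewrite (Rmult_assoc A 4).
  apply Rmult_le_compat_l; [easy|].
  apply Rmult_le_reg_r with ((1 + x) ^ 2); [easy|].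
  rewrite Rmult_assoc, Rinv_l, Rmult_1_r by lra.
  apply Rmult_le_reg_l with (x ^ 2); [nra|].
  rewrite <- Rmult_assoc, Rinv_r by nra. nra.
Qed.

(** The inequality [x / (1 + (a + 1) x)^2 <= 1 / (1 + a x) - 1 / (1 + (a + 1) x)] makes the sum
    telescope, so the bound is uniform in [x] as well as in [M]. *)
Lemma scaled_sum_bound (g : nat -> R) (C x : R) : 0 < x -> 0 <= C ->
  (forall a, Rabs (g a) <= C / (1 + INR (S a) * x) ^ 2) ->
  forall M, Rabs (x * sum_n g M) <= C * (1 - / (1 + INR (S M) * x)).
Proof.
intros hx hC H.
assert (step : forall a, Rabs (x * g a)
    <= C * (/ (1 + INR a * x) - / (1 + INR (S a) * x))).
{ intros a. rewrite Rabs_mult, (Rabs_pos_eq x) by lra.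
  apply Rle_trans with (x * (C / (1 + INR (S a) * x) ^ 2));
    [apply Rmult_le_compat_l; [lra|auto]|].
  pose proof (pos_INR a). assert (0 <= INR a * x) by nra. rewrite S_INR.
  replace (x * (C / (1 + (INR a + 1) * x) ^ 2))
    with (C * (x * / (1 + (INR a + 1) * x) * / (1 + (INR a + 1) * x)))
    by (field; nra).
  replace (/ (1 + INR a * x) - / (1 + (INR a + 1) * x))
    with (x * / (1 + (INR a + 1) * x) * / (1 + INR a * x)) by (field; nra).
  apply Rmult_le_compat_l; [easy|]. apply Rmult_le_compat_l.
  - apply Rmult_le_pos; [lra|]. left. apply Rinv_0_lt_compat. nra.
  - apply Rinv_le_contravar; nra. }
induction M as [|M IH].
- rewrite sum_O. refine (Rle_trans _ _ _ (step O) _).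
  simpl (INR 0). rewrite Rmult_0_l, Rplus_0_r, Rinv_1. lra.
- rewrite sum_n_S, Rmult_plus_distr_l.
  refine (Rle_trans _ _ _ (Rabs_triang _ _) _).
  specialize (step (S M)). lra.
Qed.

(** Here [F] is minus a primitive of [f], and the nodes [x, 2 x, ...] are the left ends of their
    cells, so the integral starts at [x]. A cell at [s] errs by at most [C x^2 / (1 + s)^2], and
    these errors telescope as in [scaled_sum_bound]. *)
Lemma riemann_sum_error (f f' F : R -> R) (C : R) : 0 <= C ->
  (forall t, 0 < t -> is_derive F t (- f t)) ->
  (forall t, 0 < t -> is_derive f t (f' t)) ->
  (forall t, 0 < t -> Rabs (f' t) <= C / (1 + t) ^ 2) ->
  forall x M, 0 < x ->
  Rabs (x * sum_n (fun a => f (INR (S a) * x)) M - (F x - F (INR (S M) * x + x)))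
  <= C * x.
Proof.
intros hC DF Df B x M hx.
assert (cell : forall s, 0 < s -> Rabs (F s - F (s + x) - x * f s)
                          <= C / (1 + s) ^ 2 * x ^ 2).
{ intros s hs.
  assert (hp : 0 < (1 + s) ^ 2) by (apply pow_lt; lra).
  assert (hC' : 0 <= C / (1 + s) ^ 2) by (apply Rdiv_le_0_compat; lra).
  apply (power_bound_of_derivative (fun t => F s - F (s + t) - t * f s)
           (fun t => f (s + t) - f s)); trivial; [| | |lra].
  - intros t ht. auto_derive; [eexists; apply DF; lra|].
    rewrite (Derive_of_is_derive F _ _ (DF (s + t) ltac:(lra))). ring.
  - rewrite Rplus_0_r. ring.
  - apply (power_bound_of_derivative _ (fun t => f' (s + t))); trivial.
    + intros t ht. auto_derive; [eexists; apply Df; lra|].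
      rewrite (Derive_of_is_derive f _ _ (Df (s + t) ltac:(lra))). ring.
    + rewrite Rplus_0_r. ring.
    + intros t ht. rewrite pow_O, Rmult_1_r.
      refine (Rle_trans _ _ _ (B (s + t) ltac:(lra)) _).
      unfold Rdiv. apply Rmult_le_compat_l; [easy|].
      apply Rinv_le_contravar; [easy|]. apply pow_incr. lra. }
set (g := fun a => (x * f (INR (S a) * x)
           - (F (INR (S a) * x) - F (INR (S a) * x + x))) / x ^ 2).
assert (e : x * sum_n (fun a => f (INR (S a) * x)) M - (F x - F (INR (S M) * x + x))
          = x * (x * sum_n g M)).
{ induction M as [|M IH].
  - rewrite !sum_O. unfold g. simpl INR. rewrite Rmult_1_l. field. lra.
  - rewrite !sum_n_S.
    replace (x * (x * (sum_n g M + g (S M))))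
      with (x * (x * sum_n g M) + x * (x * g (S M))) by ring.
    rewrite <- IH. unfold g.
    rewrite (S_INR (S M)), Rmult_plus_distr_r, Rmult_1_l. field. lra. }
rewrite e, Rabs_mult, (Rabs_pos_eq x), (Rmult_comm C) by lra.
apply Rmult_le_compat_l; [lra|].
apply Rle_trans with (C * (1 - / (1 + INR (S M) * x))).
- apply scaled_sum_bound; trivial. intros a.
  assert (hs : 0 < INR (S a) * x) by (apply Rmult_lt_0_compat; [apply lt_0_INR; lia|lra]).
  specialize (cell _ hs). unfold g, Rdiv at 1.
  rewrite Rabs_mult, (Rabs_pos_eq (/ x ^ 2))
    by (left; apply Rinv_0_lt_compat, pow_lt; lra).
  apply Rmult_le_reg_r with (x ^ 2); [apply pow_lt; lra|].
  rewrite Rmult_assoc, Rinv_l, Rmult_1_r by (apply pow_nonzero; lra).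
  rewrite Rabs_minus_sym. exact cell.
- assert (0 < / (1 + INR (S M) * x)).
  { apply Rinv_0_lt_compat. pose proof (pos_INR (S M)). nra. }
  nra.
Qed.

(** The operator [x d/dx] commutes with dilations, so it can be applied to the summand. *)
Lemma is_derive_dilated_sum (g g' : R -> R) (L x : R) : 0 < L -> 0 < x ->
  (forall v, is_derive g v (g' v)) ->
  (forall v, L <= v -> g v = 0) -> (forall v, L <= v -> g' v = 0) ->
  is_derive (dilated_sum g) x (dilated_sum (fun v => v * g' v) x / x).
Proof.
intros hL hx D Hz Hz'.
(* One cutoff serves every [t > x / 2], so near [x] the series is a fixed finite sum. *)
destruct (nfloor_ex (L / (x / 2))) as [M [_ hM]]; [apply Rdiv_le_0_compat; lra|].
assert (hM' : L <= (INR M + 1) * (x / 2)).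
{ apply Rmult_lt_compat_r with (r := x / 2) in hM; [|lra].
  unfold Rdiv in hM. rewrite (Rmult_assoc L), Rinv_l in hM; lra. }
pose proof (pos_INR M).
apply is_derive_ext_loc with (fun t => sum_n (fun m => g (INR (S m) * t)) M).
- assert (hx2 : x / 2 < x) by lra. generalize (open_gt (x / 2) x hx2).
  apply filter_imp. intros t ht. symmetry. apply (dilated_sum_finite g L); trivial; nra.
- rewrite (dilated_sum_finite _ L x M); [|lra| |nra].
  2: { intros v hv. rewrite Hz' by easy. ring. }
  unfold Rdiv. rewrite Rmult_comm. rewrite <- (sum_n_mult_l (K := R_Ring)).
  apply (is_derive_sum_n (V := R_NormedModule) (fun m t => g (INR (S m) * t))).
  intros k _. generalize (INR (S k)); intros q. auto_derive; [eexists; apply D|].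
  rewrite (is_derive_unique _ _ _ (D _)). unfold mult; simpl. field. lra.
Qed.

Lemma dilated_sum_plus (f g : R -> R) (L x : R) : 0 < x ->
  (forall v, L <= v -> f v = 0) -> (forall v, L <= v -> g v = 0) ->
  dilated_sum (fun v => f v + g v) x = dilated_sum f x + dilated_sum g x.
Proof.
intros hx Hf Hg. apply Series_plus;
  destruct (nfloor_ex (Rabs L / x)) as [M [_ hM]];
  try (apply Rdiv_le_0_compat; [apply Rabs_pos|lra]);
  (eexists; apply (is_series_finite_support _ M); intros m hm);
  [apply Hf|apply Hg];
  (apply Rmult_lt_compat_r with (r := x) in hM; [|lra];
   unfold Rdiv in hM; rewrite Rmult_assoc, Rinv_l in hM by lra;
   apply lt_INR in hm; rewrite S_INR; pose proof (Rle_abs L); nra).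
Qed.

Lemma dilated_sum_bounded (f : R -> R) (L : R) : 0 < L ->
  (forall v, continuous f v) -> (forall v, L <= v -> f v = 0) ->
  exists K, 0 <= K /\ forall x, 1 <= x -> Rabs (dilated_sum f x) <= K.
Proof.
intros hL Hc Hz. destruct (bounded_of_continuous_vanishing f L Hc Hz) as [A [hA HA]].
destruct (nfloor_ex L) as [M [_ hM]]; [lra|]. pose proof (pos_INR M).
exists (INR (S M) * A). split; [apply Rmult_le_pos; [apply pos_INR|easy]|].
intros x hx. rewrite (dilated_sum_finite f L x M) by (trivial; nra).
clear hM H. induction M as [|M IH].
- rewrite sum_O. simpl INR. rewrite !Rmult_1_l. apply HA. lra.
- rewrite sum_n_S. refine (Rle_trans _ _ _ (Rabs_triang _ _) _).
  rewrite (S_INR (S M)) at 2. rewrite Rmult_plus_distr_r, Rmult_1_l.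
  apply Rplus_le_compat; [exact IH|]. apply HA. apply Rmult_le_pos; [apply pos_INR|lra].
Qed.

(** * The double sum over [a] and [m] *)

Section DoubleSum.

Variables (H h1 : R -> R) (L : R).
Hypothesis hL : 0 < L.
Hypothesis SH : smooth H.
Hypothesis Sh1 : smooth h1.
Hypothesis DH : forall v, is_derive H v (v * h1 v).
Hypothesis Hz : forall v, L <= v -> H v = 0.

Let c : R := RInt H 0 L.
Let kappa : R := RInt h1 0 L.
(** Here [b1] is the integral of [h1] over [[v, L]], and [B' = b1] since the terms [v * h1 v]
    cancel. [B] is made so that the derivative of [dilated_sum B x / x] is
    [- dilated_sum H x / x ^ 2]. *)
Let b1 v := kappa - RInt h1 0 v.
Let B v := H v + v * b1 v.
(** [E1] is the derivative of [E], [f'] that of [f], and [F' = - f]; the terms of [F] with [c] and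
    [H 0] are primitives of those in [- E x / x ^ 2]. *)
Let E x := dilated_sum H x - c / x + H 0 / 2.
Let E1 x := dilated_sum (fun v => v * (v * h1 v)) x / x + c / x ^ 2.
Let f x := E x / x ^ 2.
Let f' x := E1 x / x ^ 2 - 2 * E x / x ^ 3.
Let F x := dilated_sum B x / x - c / (2 * x ^ 2) + H 0 / (2 * x).

Local Lemma h1_zero (v : R) : L <= v -> h1 v = 0.
Proof.
intros hv.
assert (e : v * h1 v = 0).
{ apply (derivative_zero_beyond H (fun v => v * h1 v) L); trivial.
  intros x. apply smooth_continuous. apply smooth_on_mult; [apply smooth_on_id|exact Sh1]. }
apply Rmult_integral in e. destruct e; lra.
Qed.

Local Lemma Db1 (v : R) : is_derive b1 v (- h1 v).
Proof.
destruct (smooth_antiderivative h1 0 Sh1) as [_ D].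
unfold b1. revert D. generalize (RInt h1 0). intros g D.
auto_derive; [eexists; apply D|].
rewrite (Derive_of_is_derive _ _ _ (D v)). ring.
Qed.

Local Lemma Sb1 : smooth b1.
Proof.
intros [|n]; [exact I|]. exists (fun v => (-1) * h1 v). split.
- intros v _. replace ((-1) * h1 v) with (- h1 v) by ring. apply Db1.
- apply derivable_upto_mult; [apply derivable_upto_const|apply Sh1].
Qed.

Local Lemma RInt_beyond (g : R -> R) (v : R) : (forall x, continuous g x) ->
  (forall x, L <= x -> g x = 0) -> L <= v -> RInt g 0 v = RInt g 0 L.
Proof.
intros Hc Hg hv. rewrite <- (RInt_Chasles g 0 L v).
- rewrite (RInt_ext g (fun _ => 0) L).
  + rewrite RInt_const. unfold plus, scal; simpl; unfold mult; simpl. ring.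
  + intros t. rewrite Rmin_left by easy. intros ht. apply Hg. lra.
- apply (ex_RInt_continuous (V := R_CompleteNormedModule)). auto.
- apply (ex_RInt_continuous (V := R_CompleteNormedModule)). auto.
Qed.

Local Lemma b1_zero (v : R) : L <= v -> b1 v = 0.
Proof.
intros hv. unfold b1. rewrite RInt_beyond; trivial.
- unfold kappa. ring.
- intros; now apply smooth_continuous.
- exact h1_zero.
Qed.

Local Lemma B_zero (v : R) : L <= v -> B v = 0.
Proof. intros hv. unfold B. rewrite Hz, b1_zero by easy. ring. Qed.

Local Lemma DB (v : R) : is_derive B v (b1 v).
Proof.
unfold B. auto_derive.
- split; [eexists; apply DH|]. split; [eexists; apply Db1|exact I].
- rewrite (Derive_of_is_derive _ _ _ (DH v)), (Derive_of_is_derive _ _ _ (Db1 v)). ring.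
Qed.

Local Lemma SB : smooth B.
Proof.
apply smooth_on_plus; [exact SH|]. apply smooth_on_mult; [apply smooth_on_id|exact Sb1].
Qed.

(** The function [v * B v] has derivative [2 B - H] and vanishes at [0] and at [L]. *)
Local Lemma RInt_B : RInt B 0 L = c / 2.
Proof.
assert (e : RInt (fun v => 2 * B v + -1 * H v) 0 L = 0 :> R).
{ rewrite (RInt_of_derivative (fun v => v * B v)).
  - rewrite B_zero by lra. ring.
  - intros v. auto_derive; [eexists; apply DB|].
    rewrite (Derive_of_is_derive _ _ _ (DB v)). unfold B. ring.
  - intros v. apply smooth_continuous. apply smooth_on_plus; apply smooth_on_mult;
      try apply smooth_on_const; [exact SB|exact SH]. }
rewrite RInt_linear in e; [fold c in e; lra| |];
  intros; apply smooth_continuous; [exact SB|exact SH].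
Qed.

Local Lemma Sv1 : smooth (fun v => v * (v * h1 v)).
Proof.
apply smooth_on_mult; [apply smooth_on_id|].
apply smooth_on_mult; [apply smooth_on_id|exact Sh1].
Qed.

Local Lemma v1_zero (v : R) : L <= v -> v * (v * h1 v) = 0.
Proof. intros hv. rewrite h1_zero by easy. ring. Qed.

(** Integration by parts through [(v H)']. The value makes the [c / x ^ 2] of [E1] cancel the main
    term of its dilated sum. *)
Local Lemma RInt_v1 : RInt (fun v => v * (v * h1 v)) 0 L = - c.
Proof.
assert (e : RInt (fun v => 1 * (v * (v * h1 v)) + 1 * H v) 0 L = 0 :> R).
{ rewrite (RInt_of_derivative (fun v => v * H v)).
  - rewrite Hz by lra. ring.
  - intros v. auto_derive; [eexists; apply DH|].
    rewrite (Derive_of_is_derive _ _ _ (DH v)). ring.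
  - intros v. apply smooth_continuous. apply smooth_on_plus; apply smooth_on_mult;
      try apply smooth_on_const; [exact Sv1|exact SH]. }
rewrite (RInt_linear (fun v => v * (v * h1 v))) in e; [fold c in e; lra| |];
  intros; apply smooth_continuous; [exact Sv1|exact SH].
Qed.

Local Lemma DF (x : R) : 0 < x -> is_derive F x (- f x).
Proof.
intros hx. unfold F.
pose proof (is_derive_dilated_sum B b1 L x hL hx DB B_zero b1_zero) as D.
auto_derive.
- split; [eexists; apply D|]. repeat split; nra.
- rewrite (Derive_of_is_derive _ _ _ D). unfold f, E.
  assert (e : dilated_sum B x = dilated_sum H x + dilated_sum (fun v => v * b1 v) x).
  { apply dilated_sum_plus with L; trivial. intros v hv. rewrite b1_zero by easy. ring. }
  rewrite e. field. lra.
Qed.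

Local Lemma Df (x : R) : 0 < x -> is_derive f x (f' x).
Proof.
intros hx. unfold f, E.
assert (D : is_derive (dilated_sum H) x (dilated_sum (fun v => v * (v * h1 v)) x / x)).
{ apply is_derive_dilated_sum with L; trivial. intros v hv.
  rewrite h1_zero by easy. ring. }
auto_derive.
- split; [eexists; apply D|]. repeat split; nra.
- rewrite (Derive_of_is_derive _ _ _ D). unfold f', E1, E. field. lra.
Qed.

(** Euler-Maclaurin is applied to [H] and to [v H'(v)]. Both have zero derivative at [0], by the
    form [v * h1 v] of [H'], so [E = O(x^3)] and [E1 = O(x^2)] near [0]. From [1] on, [E] and [E1]
    are only bounded, and the powers of [x] in [f] and [f'] supply the decay. *)
Local Lemma f_bounds : exists C, 0 <= C /\ forall x, 0 < x ->
  Rabs (f x) <= C / (1 + x) ^ 2 /\ Rabs (f' x) <= C / (1 + x) ^ 2.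
Proof.
destruct (euler_maclaurin H (fun v => v * h1 v) L hL SH DH Hz) as [C1 [hC1 B1]].
assert (Dv1 : exists g : R -> R, (forall v, is_derive (fun v => v * (v * h1 v)) v (g v))
                        /\ g 0 = 0).
{ destruct (smooth_derivative _ Sh1) as [h2 [D2 _]].
  exists (fun v => 2 * v * h1 v + v * v * h2 v). split; [|ring].
  intros v. auto_derive; [repeat split; eexists; apply D2|].
  rewrite (Derive_of_is_derive _ _ _ (D2 v)). ring. }
destruct Dv1 as [g [Dg g0]].
destruct (euler_maclaurin _ g L hL Sv1 Dg v1_zero) as [C2 [hC2 B2]].
destruct (dilated_sum_bounded H L hL) as [K1 [hK1 BK1]]; trivial.
{ intros; now apply smooth_continuous. }
destruct (dilated_sum_bounded (fun v => v * (v * h1 v)) L hL) as [K2 [hK2 BK2]].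
{ intros; apply smooth_continuous, Sv1. }
{ exact v1_zero. }
assert (SE : forall x, 0 < x <= 1 -> Rabs (E x) <= C1 * x ^ 3).
{ intros x hx. specialize (B1 x hx). fold c in B1.
  apply Rmult_le_reg_l with x; [lra|].
  rewrite <- (Rabs_pos_eq x) at 1 by lra. rewrite <- Rabs_mult.
  replace (x * (C1 * x ^ 3)) with (C1 * x ^ 4) by ring.
  refine (Rle_trans _ _ _ _ B1). right. f_equal. unfold E. field. lra. }
assert (SE1 : forall x, 0 < x <= 1 -> Rabs (E1 x) <= C2 * x ^ 2).
{ intros x hx. specialize (B2 x hx). rewrite RInt_v1, g0 in B2.
  apply Rmult_le_reg_l with (x ^ 2); [apply pow_lt; lra|].
  rewrite <- (Rabs_pos_eq (x ^ 2)) at 1 by (apply pow_le; lra). rewrite <- Rabs_mult.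
  replace (x ^ 2 * (C2 * x ^ 2)) with (C2 * x ^ 4) by ring.
  refine (Rle_trans _ _ _ _ B2). right. f_equal. unfold E1. field. lra. }
set (K := K1 + Rabs c + Rabs (H 0)). set (K' := K2 + Rabs c).
assert (hK : 0 <= K) by (unfold K; pose proof (Rabs_pos c);
                         pose proof (Rabs_pos (H 0)); lra).
assert (hK' : 0 <= K') by (unfold K'; pose proof (Rabs_pos c); lra).
assert (inv1 : forall x, 1 <= x -> 0 < / x <= 1).
{ intros x hx. split; [apply Rinv_0_lt_compat; lra|].
  rewrite <- Rinv_1. apply Rinv_le_contravar; lra. }
assert (BE : forall x, 1 <= x -> Rabs (E x) <= K).
{ intros x hx. unfold E, K. specialize (BK1 x hx). specialize (inv1 x hx).
  apply Rle_trans with (Rabs (dilated_sum H x) + Rabs (c / x) + Rabs (H 0 / 2)).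
  - refine (Rle_trans _ _ _ (Rabs_triang _ _) _). apply Rplus_le_compat_r.
    refine (Rle_trans _ _ _ (Rabs_triang _ _) _). rewrite Rabs_Ropp. lra.
  - unfold Rdiv. rewrite !Rabs_mult, (Rabs_pos_eq (/ x)), (Rabs_pos_eq (/ 2)) by lra.
    pose proof (Rabs_pos c). pose proof (Rabs_pos (H 0)). nra. }
assert (BE1 : forall x, 1 <= x -> Rabs (E1 x) <= K').
{ intros x hx. unfold E1, K'. specialize (BK2 x hx). specialize (inv1 x hx).
  refine (Rle_trans _ _ _ (Rabs_triang _ _) _). unfold Rdiv.
  rewrite !Rabs_mult, (Rabs_pos_eq (/ x)), <- pow_inv,
    (Rabs_pos_eq ((/ x) ^ 2)) by (try apply pow_le; lra).
  assert ((/ x) ^ 2 <= 1) by nra. pose proof (Rabs_pos c).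
  pose proof (Rabs_pos (dilated_sum (fun v => v * (v * h1 v)) x)). nra. }
clear B1 B2 BK1 BK2.
set (A := C1 * 2 + C2 + K * 2 + K').
assert (hA : 0 <= A) by (unfold A; lra).
exists (4 * A). split; [lra|]. intros x hx.
assert (Af : Rabs (f x) = Rabs (E x) * / x ^ 2).
{ unfold f, Rdiv. rewrite Rabs_mult, (Rabs_pos_eq (/ x ^ 2)); trivial.
  left. apply Rinv_0_lt_compat, pow_lt; lra. }
assert (Af' : Rabs (f' x) <= Rabs (E1 x) * / x ^ 2 + 2 * Rabs (E x) * / x ^ 3).
{ unfold f', Rdiv. refine (Rle_trans _ _ _ (Rabs_triang _ _) _).
  rewrite Rabs_Ropp, !Rabs_mult, (Rabs_pos_eq (/ x ^ 2)), (Rabs_pos_eq (/ x ^ 3)),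
    (Rabs_pos_eq 2); try lra; left; apply Rinv_0_lt_compat, pow_lt; lra. }
pose proof (Rabs_pos (E x)). pose proof (Rabs_pos (E1 x)).
assert (p2 : 0 < / x ^ 2) by (apply Rinv_0_lt_compat, pow_lt; lra).
assert (p3 : 0 < / x ^ 3) by (apply Rinv_0_lt_compat, pow_lt; lra).
assert (S2 : x <= 1 -> Rabs (E x) * / x ^ 2 <= C1).
{ intros h. apply Rle_trans with (C1 * x ^ 3 * / x ^ 2).
  - apply Rmult_le_compat_r; [lra|]. apply SE; lra.
  - replace (C1 * x ^ 3 * / x ^ 2) with (C1 * x) by (field; lra). nra. }
split; apply inv_square_majorant; trivial.
- intros h. rewrite Af. specialize (S2 h). unfold A. lra.
- intros h. rewrite Af. apply Rmult_le_compat_r; [lra|].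
  specialize (BE x h). unfold A. lra.
- intros h. refine (Rle_trans _ _ _ Af' _).
  assert (Rabs (E1 x) * / x ^ 2 <= C2).
  { apply Rle_trans with (C2 * x ^ 2 * / x ^ 2).
    - apply Rmult_le_compat_r; [lra|]. apply SE1; lra.
    - right. field. lra. }
  assert (Rabs (E x) * / x ^ 3 <= C1).
  { apply Rle_trans with (C1 * x ^ 3 * / x ^ 3).
    - apply Rmult_le_compat_r; [lra|]. apply SE; lra.
    - right. field. lra. }
  unfold A. lra.
- intros h. refine (Rle_trans _ _ _ Af' _).
  specialize (BE x h). specialize (BE1 x h). specialize (inv1 x h).
  replace (/ x ^ 3) with (/ x * / x ^ 2) by (field; lra).
  unfold Rdiv. unfold A.
  assert (2 * Rabs (E x) * (/ x * / x ^ 2) <= 2 * K * / x ^ 2).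
  { rewrite <- Rmult_assoc. apply Rmult_le_compat_r; [lra|]. nra. }
  assert (Rabs (E1 x) * / x ^ 2 <= K' * / x ^ 2) by (apply Rmult_le_compat_r; lra).
  nra.
Qed.

(** The integral [c / 2] of [B] and the value [B 0 = H 0] cancel the two rational terms of [F]. The
    next Euler-Maclaurin term, with [B'(0) = b1 0 = kappa], is the origin of [- kappa / 12]. *)
Local Lemma F_small : exists C, 0 <= C /\ forall x, 0 < x <= 1 ->
  Rabs (F x + kappa / 12) <= C * x.
Proof.
destruct (euler_maclaurin B b1 L hL SB DB B_zero) as [C [hC HC]].
exists C. split; [exact hC|]. intros x hx. specialize (HC x hx).
rewrite RInt_B in HC.
assert (eB : B 0 = H 0) by (unfold B; ring).
assert (eb : b1 0 = kappa).
{ unfold b1. rewrite RInt_point. unfold zero; simpl. ring. }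
rewrite eB, eb in HC.
apply Rmult_le_reg_l with (x ^ 2); [apply pow_lt; lra|].
rewrite <- (Rabs_pos_eq (x ^ 2)) at 1 by (apply pow_le; lra). rewrite <- Rabs_mult.
apply Rle_trans with (C * x ^ 4).
- refine (Rle_trans _ _ _ _ HC). right. f_equal. unfold F. field. lra.
- replace (x ^ 2 * (C * x)) with (C * x ^ 3 * 1) by ring.
  replace (C * x ^ 4) with (C * x ^ 3 * x) by ring.
  apply Rmult_le_compat_l; [|lra]. apply Rmult_le_pos; [easy|apply pow_le; lra].
Qed.

Local Lemma F_infinity (x : R) : 0 < x ->
  is_lim_seq (fun M => F (INR (S M) * x + x)) 0.
Proof.
intros hx. destruct (nfloor_ex (L / x)) as [N [_ hN]]; [apply Rdiv_le_0_compat; lra|].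
assert (hN' : L <= (INR N + 1) * x).
{ apply Rmult_lt_compat_r with (r := x) in hN; [|lra].
  unfold Rdiv in hN. rewrite Rmult_assoc, Rinv_l in hN; lra. }
apply (is_lim_seq_ext_loc (fun M =>
  - c / (2 * x ^ 2) * (/ INR (S (S M)) * / INR (S (S M))) + H 0 / (2 * x) * / INR (S (S M)))).
- exists N. intros M hM. apply le_INR in hM.
  replace (INR (S M) * x + x) with (INR (S (S M)) * x) by (rewrite !S_INR; ring).
  unfold F. rewrite (dilated_sum_finite B L _ 0).
  + rewrite sum_O, B_zero.
    * field. split; [lra|]. apply not_0_INR. lia.
    * rewrite !S_INR. simpl (INR 0). nra.
  + apply Rmult_lt_0_compat; [apply lt_0_INR; lia|lra].
  + exact B_zero.
  + rewrite !S_INR. simpl (INR 0). nra.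
- assert (z : is_lim_seq (fun M => / INR (S (S M))) 0).
  { apply (is_lim_seq_incr_1 (fun M => / INR (S M))).
    apply (is_lim_seq_incr_1 (fun M => / INR M)).
    replace (Finite 0) with (Rbar_inv p_infty) by reflexivity.
    apply is_lim_seq_inv; [apply is_lim_seq_INR|easy]. }
  replace (Finite 0) with (Finite (- c / (2 * x ^ 2) * (0 * 0) + H 0 / (2 * x) * 0))
    by (f_equal; ring).
  apply is_lim_seq_plus'.
  + apply is_lim_seq_mult'; [apply is_lim_seq_const|]. now apply is_lim_seq_mult'.
  + apply is_lim_seq_mult'; [apply is_lim_seq_const|exact z].
Qed.

(** The errors [E] add up to [x * eta x] with [eta] a Riemann sum of mesh [x] for the integral of
    [f], which is [F(0+) - F(oo) = - kappa / 12]. The bound for all [x > 0] is needed because the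
    dilation operators evaluate [eta] at multiples of [x] that need not be small. *)
Lemma double_sum_expansion : exists eta : R -> R, exists C, 0 <= C /\
  (forall x, 0 < x -> Rabs (eta x) <= C) /\
  (forall x, 0 < x <= 1 -> Rabs (eta x + kappa / 12) <= C * x) /\
  (forall x, 0 < x ->
     Series (fun a => dilated_sum H (INR (S a) * x) / INR (S a) ^ 2)
     = zeta 3 * c / x - zeta 2 * H 0 / 2 + x * eta x).
Proof.
destruct f_bounds as [C1 [hC1 Bf]]. destruct F_small as [C2 [hC2 BF]].
assert (posS : forall (a : nat) x, 0 < x -> 0 < INR (S a) * x).
{ intros a x hx. apply Rmult_lt_0_compat; [apply lt_0_INR; lia|lra]. }
assert (sf : forall x, 0 < x -> ex_series (fun a => f (INR (S a) * x))).
{ intros x hx. apply (ex_series_le (V := R_CompleteNormedModule)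
    _ (fun a => C1 / x ^ 2 * / INR (S a) ^ 2)).
  - intros a. change (norm ?t) with (Rabs t).
    destruct (Bf _ (posS a x hx)) as [b _].
    refine (Rle_trans _ _ _ b _). specialize (posS a x hx).
    replace (C1 / x ^ 2 * / INR (S a) ^ 2) with (C1 / (INR (S a) * x) ^ 2).
    + unfold Rdiv. apply Rmult_le_compat_l; [easy|].
      apply Rinv_le_contravar; [apply pow_lt; lra|]. apply pow_incr. lra.
    + field. split; [|lra]. apply not_0_INR. lia.
  - apply (ex_series_scal_l (V := R_NormedModule)). now apply ex_series_inv_pow. }
set (eta := fun x => x * Series (fun a => f (INR (S a) * x))).
assert (leta : forall x, 0 < x ->
   is_lim_seq (fun M => x * sum_n (fun a => f (INR (S a) * x)) M) (eta x)).
{ intros x hx. apply (is_lim_seq_scal_l _ x (Finite (Series _))).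
  exact (Series_correct _ (sf x hx)). }
exists eta, (C1 + C2). split; [lra|]. split; [|split].
- intros x hx.
  assert (h : Rbar_le (Finite (Rabs (eta x))) (Finite C1)).
  { apply (is_lim_seq_le (fun M => Rabs (x * sum_n (fun a => f (INR (S a) * x)) M))
             (fun _ => C1)).
    - intros M. apply Rle_trans with (C1 * (1 - / (1 + INR (S M) * x))).
      + apply scaled_sum_bound; trivial. intros a. apply Bf. now apply posS.
      + assert (0 < / (1 + INR (S M) * x)).
        { apply Rinv_0_lt_compat. specialize (posS M x hx). lra. }
        nra.
    - apply (is_lim_seq_abs _ (Finite (eta x))). now apply leta.
    - apply is_lim_seq_const. }
  simpl in h. lra.
- intros x hx.
  assert (h : Rbar_le (Finite (Rabs (eta x - (F x - 0)))) (Finite (C1 * x))).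
  { apply (is_lim_seq_le (fun M => Rabs (x * sum_n (fun a => f (INR (S a) * x)) M
              - (F x - F (INR (S M) * x + x)))) (fun _ => C1 * x)).
    - intros M. apply riemann_sum_error with f'; trivial; try lra.
      + exact DF.
      + exact Df.
      + intros t ht. now apply Bf.
    - apply (is_lim_seq_abs _ (Finite (eta x - (F x - 0)))).
      apply is_lim_seq_minus'; [apply leta; lra|].
      apply is_lim_seq_minus'; [apply is_lim_seq_const|]. apply F_infinity. lra.
    - apply is_lim_seq_const. }
  simpl in h. specialize (BF x hx).
  replace (eta x + kappa / 12) with ((eta x - (F x - 0)) + (F x + kappa / 12)) by ring.
  refine (Rle_trans _ _ _ (Rabs_triang _ _) _). lra.
- intros x hx. apply is_series_unique.
  replace (zeta 3 * c / x - zeta 2 * H 0 / 2 + x * eta x)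
    with ((c / x * zeta 3 + - (H 0 / 2) * zeta 2)
          + x ^ 2 * Series (fun a => f (INR (S a) * x)))
    by (unfold eta; field; lra).
  apply (is_series_ext (fun a => (c / x * / INR (S a) ^ 3 + - (H 0 / 2) * / INR (S a) ^ 2)
           + x ^ 2 * f (INR (S a) * x))).
  + intros a. unfold f, E. match goal with |- ?u = ?v => change (@eq R u v) end. field.
    split; [apply not_0_INR; lia|lra].
  + apply (is_series_plus (V := R_NormedModule)); [apply (is_series_plus (V := R_NormedModule))|];
      apply (is_series_scal (V := R_NormedModule)); apply Series_correct.
    * now apply ex_series_inv_pow; lia.
    * now apply ex_series_inv_pow.
    * now apply sf.
Qed.

End DoubleSum.

(** * Weights supported on primes *)

Lemma ex_series_inv_squares0 : ex_series (fun n => / INR n ^ 2).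
Proof.
apply (ex_series_incr_1 (V := R_NormedModule)). now apply ex_series_inv_pow.
Qed.

Lemma inv_square_nonneg (n : nat) : 0 <= / INR n ^ 2.
Proof.
destruct n as [|n]; [simpl; rewrite Rmult_0_l, Rinv_0; lra|].
left. apply Rinv_0_lt_compat, pow_lt, lt_0_INR. lia.
Qed.

Lemma sum_n_nonneg_le (u : nat -> R) (M N : nat) : (forall n, 0 <= u n) ->
  (M <= N)%nat -> sum_n u M <= sum_n u N.
Proof.
intros hu hMN. induction hMN as [|N _ IH]; [lra|].
rewrite sum_n_S. specialize (hu (S N)). lra.
Qed.

Lemma sum_n_nonneg_le_Series (u : nat -> R) (M : nat) : (forall n, 0 <= u n) ->
  ex_series u -> sum_n u M <= Series u.
Proof.
intros hu hs.
assert (h : Rbar_le (Finite (sum_n u M)) (Finite (Series u))).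
{ apply (is_lim_seq_le_loc (fun _ => sum_n u M) (sum_n u)).
  - exists M. intros n hn. now apply sum_n_nonneg_le.
  - apply is_lim_seq_const.
  - exact (Series_correct _ hs). }
exact h.
Qed.

Lemma Series_nonneg (u : nat -> R) : (forall n, 0 <= u n) -> ex_series u -> 0 <= Series u.
Proof.
intros hu hs. refine (Rle_trans _ _ _ _ (sum_n_nonneg_le_Series u 0 hu hs)).
rewrite sum_O. apply hu.
Qed.

(** A cutoff [N] independent of [r] allows induction over primes for all [r] at once: admitting one
    more prime acts on a whole series by a dilation. *)
Definition prime_weight (c : R -> R) (N r : nat) : R :=
  prod_f_R0 (fun n =>
    if prime_dec (Z.of_nat n) then
      if Zdivide_dec (Z.of_nat n) (Z.of_nat r) then 1 + c (INR n) else 1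
    else 1) N.

Lemma prime_nat_ge_2 (n : nat) : prime (Z.of_nat n) -> (2 <= n)%nat.
Proof. intros h. apply prime_ge_2 in h. lia. Qed.

Lemma prime_weight_bounded (c : R -> R) (N : nat) :
  exists K, 0 <= K /\ forall r, Rabs (prime_weight c N r) <= K.
Proof.
unfold prime_weight. induction N as [|N [K [hK IH]]].
- exists 1. split; [lra|]. intros r. simpl.
  destruct (prime_dec 0) as [h|h]; [|rewrite Rabs_R1; lra].
  apply prime_ge_2 in h. lia.
- exists (K * (1 + Rabs (c (INR (S N))))). pose proof (Rabs_pos (c (INR (S N)))).
  split; [nra|]. intros r. cbn [prod_f_R0]. rewrite Rabs_mult.
  apply Rmult_le_compat; try apply Rabs_pos; [apply IH|].
  destruct (prime_dec (Z.of_nat (S N))); [destruct (Zdivide_dec _ _)|];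
    try (rewrite Rabs_R1; lra).
  refine (Rle_trans _ _ _ (Rabs_triang _ _) _). rewrite Rabs_R1. lra.
Qed.

Lemma prime_weight_S_prime (c : R -> R) (N r : nat) : prime (Z.of_nat (S N)) ->
  prime_weight c (S N) r = prime_weight c N r
    + c (INR (S N)) * (if Zdivide_dec (Z.of_nat (S N)) (Z.of_nat r)
                       then prime_weight c N r else 0).
Proof.
intros h. unfold prime_weight at 1. cbn [prod_f_R0].
change (prod_f_R0 _ N) with (prime_weight c N r).
destruct (prime_dec (Z.of_nat (S N))); [|easy].
destruct (Zdivide_dec _ _); ring.
Qed.

Lemma prime_weight_S_not_prime (c : R -> R) (N r : nat) : ~ prime (Z.of_nat (S N)) ->
  prime_weight c (S N) r = prime_weight c N r.
Proof.
intros h. unfold prime_weight at 1. cbn [prod_f_R0].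
change (prod_f_R0 _ N) with (prime_weight c N r).
destruct (prime_dec (Z.of_nat (S N))); [easy|]. ring.
Qed.

Lemma prime_weight_ext (c : R -> R) (N r s : nat) :
  (forall n, (n <= N)%nat -> prime (Z.of_nat n) ->
     ((Z.of_nat n | Z.of_nat r) <-> (Z.of_nat n | Z.of_nat s))%Z) ->
  prime_weight c N r = prime_weight c N s.
Proof.
unfold prime_weight. induction N as [|N IH]; intros H.
- simpl. destruct (prime_dec 0) as [h|h]; [|reflexivity].
  apply prime_ge_2 in h. lia.
- cbn [prod_f_R0]. rewrite IH by (intros; apply H; [lia|easy]). f_equal.
  destruct (prime_dec (Z.of_nat (S N))) as [h|h]; [|reflexivity].
  specialize (H (S N) (le_n _) h).
  destruct (Zdivide_dec _ (Z.of_nat r)), (Zdivide_dec _ (Z.of_nat s)); tauto.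
Qed.

Lemma prime_weight_mult_prime (c : R -> R) (N p r : nat) : (N < p)%nat ->
  prime (Z.of_nat p) -> prime_weight c N (p * r) = prime_weight c N r.
Proof.
intros hN hp. apply prime_weight_ext. intros n hn pn. rewrite Nat2Z.inj_mul. split.
- intros h. destruct (prime_mult _ pn _ _ h) as [h'|h']; [|exact h'].
  apply (prime_div_prime _ _ pn hp) in h'. lia.
- intros h. now apply Z.divide_mul_r.
Qed.

Lemma prime_weight_stable (c : R -> R) (N r : nat) : (1 <= r)%nat -> (r <= N)%nat ->
  prime_weight c N r = prime_weight c r r.
Proof.
intros hr hN. induction hN as [|N hN IH]; [reflexivity|]. rewrite <- IH.
destruct (prime_dec (Z.of_nat (S N))) as [h|h];
  [|now apply prime_weight_S_not_prime].
rewrite prime_weight_S_prime by easy.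
destruct (Zdivide_dec _ _) as [d|d]; [|ring].
apply Z.divide_pos_le in d; lia.
Qed.

Lemma prime_weight_1 (c : R -> R) (N : nat) : prime_weight c N 1 = 1.
Proof.
induction N as [|N IH].
- unfold prime_weight; simpl. destruct (prime_dec 0) as [h|h]; [|reflexivity].
  apply prime_ge_2 in h. lia.
- destruct (prime_dec (Z.of_nat (S N))) as [h|h];
    [|now rewrite prime_weight_S_not_prime].
  rewrite prime_weight_S_prime by easy. rewrite IH.
  destruct (Zdivide_dec _ _) as [d|d]; [|ring].
  apply prime_nat_ge_2 in h. apply Z.divide_pos_le in d; lia.
Qed.

Lemma exists_prime_divisor (r : nat) : (2 <= r)%nat ->
  exists p, (p <= r)%nat /\ prime (Z.of_nat p) /\ (Z.of_nat p | Z.of_nat r)%Z.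
Proof.
induction r as [r IH] using (well_founded_induction lt_wf). intros hr.
destruct (prime_dec (Z.of_nat r)) as [h|h].
- exists r. split; [lia|]. split; [easy|]. apply Z.divide_refl.
- destruct (not_prime_divide (Z.of_nat r)) as [d [hd hdr]]; [lia|easy|].
  destruct (IH (Z.to_nat d)) as [p [hp1 [hp2 hp3]]]; [lia|lia|].
  exists p. split; [lia|]. split; [easy|].
  rewrite Z2Nat.id in hp3 by lia. now apply Z.divide_trans with d.
Qed.

(** Each factor [1 + c(p)] is [0], so this is the indicator of the [r] without a prime factor up to
    [N]; among [1 <= r <= N] only [r = 1] is left. *)
Definition sieve_weight : nat -> nat -> R := prime_weight (fun _ => -1).

Lemma sieve_weight_0 (N r : nat) : (2 <= r)%nat -> (r <= N)%nat -> sieve_weight N r = 0.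
Proof.
intros hr hN. unfold sieve_weight. rewrite prime_weight_stable by lia. clear hN N.
destruct (exists_prime_divisor r hr) as [p [hp1 [hp2 hp3]]].
enough (A : forall N, (p <= N)%nat -> prime_weight (fun _ => -1) N r = 0) by now apply A.
intros N hN. clear hp1. unfold prime_weight. induction hN as [|N _ IH].
- destruct p as [|p]; [apply prime_ge_2 in hp2; lia|]. cbn [prod_f_R0].
  destruct (prime_dec _); [|easy]. destruct (Zdivide_dec _ _); [|easy]. ring.
- cbn [prod_f_R0]. rewrite IH. ring.
Qed.

Lemma sieve_weight_bound (N r : nat) : 0 <= sieve_weight N r <= 1.
Proof.
unfold sieve_weight, prime_weight. induction N as [|N IH].
- simpl. destruct (prime_dec 0) as [h|h]; [|lra]. apply prime_ge_2 in h. lia.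
- cbn [prod_f_R0]. destruct (prime_dec (Z.of_nat (S N)));
    [destruct (Zdivide_dec (Z.of_nat (S N)) _)|]; lra.
Qed.

(** A [sum_n] up to [j] has [j + 1] terms, so the case without multiples needs its own branch. *)
Lemma sum_n_multiples (p : nat) (G : nat -> R) : (1 <= p)%nat -> forall K,
  sum_n (fun r => if Zdivide_dec (Z.of_nat p) (Z.of_nat (S r)) then G (S r) else 0) K
  = match (S K / p)%nat with
    | O => 0
    | S j => sum_n (fun r => G (p * S r)%nat) j
    end :> R.
Proof.
intros hp.
assert (D : forall n, (exists q, S n = p * S q /\ S n / p = S q /\ n / p = q)%nat
                 /\ (Z.of_nat p | Z.of_nat (S n))%Z
               \/ (S n / p = n / p)%nat /\ ~ (Z.of_nat p | Z.of_nat (S n))%Z).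
{ intros n. pose proof (Nat.div_mod_eq (S n) p). pose proof (Nat.mod_upper_bound (S n) p).
  destruct (Nat.eq_dec (S n mod p) 0) as [e|e].
  - left. split.
    + exists (n / p)%nat. assert (q : (S n / p = S (n / p))%nat).
      { destruct (S n / p)%nat as [|q] eqn:E; [lia|]. f_equal.
        apply (Nat.div_unique n p q (p - 1)); nia. }
      rewrite q in H. lia.
    + exists (Z.of_nat (S n / p)). nia.
  - right. split.
    + apply (Nat.div_unique n p _ (S n mod p - 1)); lia.
    + intros [z hz]. apply e.
      assert (S n = Z.to_nat z * p)%nat by nia.
      rewrite H1. apply Nat.Div0.mod_mul. }
induction K as [|K IH].
- rewrite sum_O. destruct (D 0%nat) as [[[q [e1 [e2 e3]]] d]|[e1 d]].
  + destruct (Zdivide_dec _ _); [|easy]. rewrite e2, e1.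
    rewrite Nat.Div0.div_0_l in e3. subst q. cbv beta iota. now rewrite sum_O.
  + destruct (Zdivide_dec _ _); [easy|]. rewrite e1, Nat.Div0.div_0_l. reflexivity.
- rewrite sum_n_S, IH. destruct (D (S K)) as [[[q [e1 [e2 e3]]] d]|[e1 d]].
  + destruct (Zdivide_dec _ _); [|easy]. rewrite e2, e3, e1. destruct q as [|q].
    * cbv beta iota. rewrite sum_O. ring.
    * cbv beta iota. now rewrite sum_n_S.
  + destruct (Zdivide_dec _ _); [easy|]. rewrite e1. ring.
Qed.

Lemma ex_series_bounded_mult (w u : nat -> R) (K : R) :
  (forall n, Rabs (w n) <= K) -> ex_series (fun n => Rabs (u n)) ->
  ex_series (fun n => w n * u n).
Proof.
intros hw hu. apply (ex_series_le (V := R_CompleteNormedModule) _ (fun n => K * Rabs (u n))).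
- intros n. change (norm (w n * u n)) with (Rabs (w n * u n)). rewrite Rabs_mult.
  apply Rmult_le_compat_r; [apply Rabs_pos|apply hw].
- now apply (ex_series_scal_l (V := R_NormedModule)).
Qed.

Lemma Series_multiples (p : nat) (G : nat -> R) : (1 <= p)%nat ->
  ex_series (fun r => Rabs (G (S r))) ->
  Series (fun r => if Zdivide_dec (Z.of_nat p) (Z.of_nat (S r)) then G (S r) else 0)
  = Series (fun r => G (p * S r)%nat).
Proof.
intros hp hG.
set (u := fun r => if Zdivide_dec (Z.of_nat p) (Z.of_nat (S r)) then G (S r) else 0).
assert (hu : ex_series u).
{ apply ex_series_ext with (fun r =>
    (if Zdivide_dec (Z.of_nat p) (Z.of_nat (S r)) then 1 else 0) * G (S r)).
  - intros r. unfold u. destruct (Zdivide_dec _ _); [apply Rmult_1_l|apply Rmult_0_l].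
  - apply (ex_series_bounded_mult _ _ 1); [|easy]. intros r.
    destruct (Zdivide_dec _ _); [rewrite Rabs_R1|rewrite Rabs_R0]; lra. }
symmetry. apply is_series_unique. apply is_series_of_lim.
(* The index [p * S M - 1] belongs to the multiple [p * S M], so these partial sums contain exactly
   [M + 1] multiples of [p]. *)
apply is_lim_seq_ext with (fun M => sum_n u (p * S M - 1)).
- intros M. unfold u. rewrite sum_n_multiples by easy.
  replace (S (p * S M - 1)) with (S M * p)%nat by nia.
  rewrite Nat.div_mul by lia. reflexivity.
- apply (is_lim_seq_subseq (sum_n u) _ (fun M => (p * S M - 1)%nat)).
  + apply eventually_subseq. intros n. nia.
  + exact (Series_correct _ hu).
Qed.

(** * Dilation operators and prime products *)

(** The operator [prod_(p <= N) (1 + t1(p) T_p + t2(p) T_p^2)]; the quadratic term is there to hold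
    a product of two factors linear in [T_p]. *)
Fixpoint dilation_op (t1 t2 : R -> R) (N : nat) (f : R -> R) (x : R) : R :=
  match N with
  | O => f x
  | S M =>
    if prime_dec (Z.of_nat (S M)) then
      let p := INR (S M) in
      dilation_op t1 t2 M f x + t1 p * dilation_op t1 t2 M f (p * x)
      + t2 p * dilation_op t1 t2 M f (p * (p * x))
    else dilation_op t1 t2 M f x
  end.

Lemma prime_INR_ge_2 (N : nat) : prime (Z.of_nat N) -> 2 <= INR N.
Proof. intros h. apply prime_nat_ge_2 in h. apply le_INR in h. exact h. Qed.

(** All dilations are by factors at least [1], so only values to the right of [x0] enter. An
    identity whose cutoff [N] is adequate at [x0] can thus be used under the operator. *)
Lemma dilation_op_ext (t1 t2 : R -> R) (N : nat) (f g : R -> R) (x0 : R) : 0 < x0 ->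
  (forall x, x0 <= x -> f x = g x) ->
  forall x, x0 <= x -> dilation_op t1 t2 N f x = dilation_op t1 t2 N g x.
Proof.
intros h0 e. induction N as [|N IH]; intros x hx; [now apply e|].
cbn [dilation_op]. destruct (prime_dec (Z.of_nat (S N))) as [h|h]; [|now apply IH].
apply prime_INR_ge_2 in h. cbv zeta.
assert (h1 : x0 <= INR (S N) * x) by nra.
assert (h2 : x0 <= INR (S N) * (INR (S N) * x)) by nra.
now rewrite !IH.
Qed.

Lemma dilation_op_linear (t1 t2 : R -> R) (N : nat) (f g : R -> R) (a b x : R) :
  dilation_op t1 t2 N (fun y => a * f y + b * g y) x
  = a * dilation_op t1 t2 N f x + b * dilation_op t1 t2 N g x.
Proof.
revert x. induction N as [|N IH]; intros x; [reflexivity|].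
cbn [dilation_op]. destruct (prime_dec (Z.of_nat (S N))) as [_|_]; [|apply IH].
cbv zeta. rewrite !IH. ring.
Qed.

Lemma dilation_op_dilate (t1 t2 : R -> R) (N : nat) (f : R -> R) (a x : R) :
  dilation_op t1 t2 N (fun y => f (a * y)) x = dilation_op t1 t2 N f (a * x).
Proof.
revert x. induction N as [|N IH]; intros x; [reflexivity|].
cbn [dilation_op]. destruct (prime_dec (Z.of_nat (S N))) as [_|_]; [|apply IH].
cbv zeta. rewrite !IH. set (p := INR (S N)).
replace (a * (p * (p * x))) with (p * (p * (a * x))) by ring.
replace (a * (p * x)) with (p * (a * x)) by ring. reflexivity.
Qed.

(** Dilations commute with all these operators, so two products over primes can be multiplied out
    prime by prime. *)
Lemma dilation_op_comp (a b : R -> R) (N : nat) (f : R -> R) (x : R) :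
  dilation_op a (fun _ => 0) N (dilation_op b (fun _ => 0) N f) x
  = dilation_op (fun p => a p + b p) (fun p => a p * b p) N f x.
Proof.
revert x. induction N as [|N IH]; intros x; [reflexivity|].
cbn [dilation_op]. destruct (prime_dec (Z.of_nat (S N))) as [_|_]; [|apply IH].
cbv zeta. set (p := INR (S N)).
set (g := dilation_op b (fun _ => 0) N f) in *.
assert (e : forall y, dilation_op a (fun _ => 0) N
     (fun x0 => g x0 + b p * g (p * x0) + 0 * g (p * (p * x0))) y
   = dilation_op a (fun _ => 0) N g y + b p * dilation_op a (fun _ => 0) N g (p * y)).
{ intros y. rewrite <- (dilation_op_dilate a _ N g p y).
  rewrite <- (Rmult_1_l (dilation_op a (fun _ => 0) N g y)).
  rewrite <- dilation_op_linear. destruct N; [simpl; ring|].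
  assert (E : forall u v : R -> R, (forall z, u z = v z) -> forall M z,
     dilation_op a (fun _ => 0) M u z = dilation_op a (fun _ => 0) M v z).
  { intros u v huv M. induction M as [|M IHM]; intros z; [apply huv|].
    cbn [dilation_op]. now rewrite !IHM. }
  apply E. intros z. ring. }
rewrite !e, !IH. ring.
Qed.

Lemma prime_product_upto_0 (f : R -> R) : prime_product_upto 0 f = 1.
Proof.
unfold prime_product_upto; simpl. destruct (prime_dec 0) as [h|h]; [|reflexivity].
apply prime_ge_2 in h. lia.
Qed.

Lemma prime_product_upto_S (f : R -> R) (N : nat) :
  prime_product_upto (S N) f = prime_product_upto N f
    * (if prime_dec (Z.of_nat (S N)) then f (INR (S N)) else 1).
Proof. reflexivity. Qed.

Lemma prime_product_upto_ext (f g : R -> R) (N : nat) :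
  (forall p, 2 <= p -> f p = g p) -> prime_product_upto N f = prime_product_upto N g.
Proof.
intros e. induction N as [|N IH]; [now rewrite !prime_product_upto_0|].
rewrite !prime_product_upto_S, IH. f_equal.
destruct (prime_dec (Z.of_nat (S N))) as [h|h]; [|reflexivity].
apply e. now apply prime_INR_ge_2.
Qed.

Lemma prime_product_upto_mult (f g : R -> R) (N : nat) :
  prime_product_upto N f * prime_product_upto N g
  = prime_product_upto N (fun p => f p * g p).
Proof.
induction N as [|N IH]; [rewrite !prime_product_upto_0; ring|].
rewrite !prime_product_upto_S, <- IH.
destruct (prime_dec (Z.of_nat (S N))); ring.
Qed.

Lemma prime_product_upto_bound (f : R -> R) (A : R) (N : nat) : 0 <= A ->
  (forall p, 2 <= p -> Rabs (f p - 1) <= A * / p ^ 2) ->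
  Rabs (prime_product_upto N f) <= exp (A * sum_n (fun n => / INR n ^ 2) N).
Proof.
intros hA H. induction N as [|N IH].
- rewrite prime_product_upto_0, Rabs_R1, <- exp_0.
  (* The term at [n = 0] is [0] by the convention [/ 0 = 0]. *)
  rewrite sum_O. simpl. rewrite Rmult_0_l, Rinv_0, Rmult_0_r. lra.
- rewrite prime_product_upto_S, sum_n_S, Rmult_plus_distr_l, exp_plus, Rabs_mult.
  pose proof (inv_square_nonneg (S N)) as hi.
  apply Rmult_le_compat; try apply Rabs_pos; [exact IH|].
  apply Rle_trans with (1 + A * / INR (S N) ^ 2); [|apply exp_ineq1_le].
  destruct (prime_dec (Z.of_nat (S N))) as [h|h].
  + specialize (H _ (prime_INR_ge_2 _ h)).
    replace (f (INR (S N))) with (1 + (f (INR (S N)) - 1)) by ring.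
    refine (Rle_trans _ _ _ (Rabs_triang _ _) _). rewrite Rabs_R1. lra.
  + rewrite Rabs_R1. nra.
Qed.

Lemma prime_product_upto_bounded (f : R -> R) (A : R) : 0 <= A ->
  (forall p, 2 <= p -> Rabs (f p - 1) <= A * / p ^ 2) ->
  exists K, 0 < K /\ forall N, Rabs (prime_product_upto N f) <= K.
Proof.
intros hA H. exists (exp (A * Series (fun n => / INR n ^ 2))).
split; [apply exp_pos|]. intros N.
refine (Rle_trans _ _ _ (prime_product_upto_bound f A N hA H) _).
assert (h : A * sum_n (fun n => / INR n ^ 2) N <= A * Series (fun n => / INR n ^ 2)).
{ apply Rmult_le_compat_l; [easy|]. apply sum_n_nonneg_le_Series.
  - apply inv_square_nonneg.
  - apply ex_series_inv_squares0. }
destruct h as [h|h]; [left; now apply exp_increasing|rewrite h; lra].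
Qed.

(** As [prime_product] is the real part of a [Lim_seq], a finite limit has to be established first.
    The increments are at most [K A / n^2], with [K] a bound for the partial products, so they sum
    absolutely. *)
Lemma is_lim_prime_product (f : R -> R) (A : R) : 0 <= A ->
  (forall p, 2 <= p -> Rabs (f p - 1) <= A * / p ^ 2) ->
  is_lim_seq (fun N => prime_product_upto N f) (prime_product f).
Proof.
intros hA H. apply Lim_seq_correct'.
destruct (prime_product_upto_bounded f A hA H) as [K [hK BK]].
set (P := fun N => prime_product_upto N f) in *.
assert (s : ex_series (fun n => P (S n) - P n)).
{ apply (ex_series_le (V := R_CompleteNormedModule) _ (fun n => K * A * / INR (S n) ^ 2)).
  - intros n. change (norm (P (S n) - P n)) with (Rabs (P (S n) - P n)).
    unfold P. rewrite prime_product_upto_S.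
    pose proof (inv_square_nonneg (S n)) as hi.
    assert (hKA : 0 <= K * A) by nra.
    destruct (prime_dec (Z.of_nat (S n))) as [h|h].
    + specialize (H _ (prime_INR_ge_2 _ h)).
      replace (prime_product_upto n f * f (INR (S n)) - prime_product_upto n f)
        with (prime_product_upto n f * (f (INR (S n)) - 1)) by ring.
      rewrite Rabs_mult, Rmult_assoc.
      apply Rmult_le_compat; try apply Rabs_pos; [apply BK|exact H].
    + rewrite Rmult_1_r, Rminus_diag_eq, Rabs_R0 by easy. nra.
  - apply (ex_series_scal_l (V := R_NormedModule)). now apply ex_series_inv_pow. }
destruct s as [l hl]. exists (P 0%nat + l).
apply is_lim_seq_incr_1.
apply is_lim_seq_ext with (fun N => P 0%nat + sum_n (fun n => P (S n) - P n) N).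
- induction n as [|n IH]; [rewrite sum_O; ring|]. rewrite sum_n_S.
  rewrite <- Rplus_assoc, IH. ring.
- apply is_lim_seq_plus'; [apply is_lim_seq_const|exact hl].
Qed.

Lemma dilation_op_const (t1 t2 : R -> R) (N : nat) (k x : R) :
  dilation_op t1 t2 N (fun _ => k) x
  = k * prime_product_upto N (fun p => 1 + t1 p + t2 p).
Proof.
revert x. induction N as [|N IH]; intros x.
- rewrite prime_product_upto_0. simpl. ring.
- rewrite prime_product_upto_S. cbn [dilation_op].
  destruct (prime_dec (Z.of_nat (S N))); cbv zeta; rewrite !IH; ring.
Qed.

(** A multiplicative function [m] is an eigenfunction of every dilation, so pulling it out only
    rescales the coefficients. The cases [1 / x], [1] and [x] give the three local factors, and the
    last one reduces functions of size [O(x)] to bounded ones. *)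
Lemma dilation_op_homogeneous (t1 t2 m q f : R -> R) (N : nat) (x : R) : 0 < x ->
  (forall p y, 2 <= p -> 0 < y -> m (p * y) = q p * m y) ->
  dilation_op t1 t2 N (fun y => m y * f y) x
  = m x * dilation_op (fun p => q p * t1 p) (fun p => q p ^ 2 * t2 p) N f x.
Proof.
intros hx hm. revert x hx. induction N as [|N IH]; intros x hx; [reflexivity|].
cbn [dilation_op]. destruct (prime_dec (Z.of_nat (S N))) as [h|h]; [|now apply IH].
apply prime_INR_ge_2 in h. cbv zeta. set (p := INR (S N)) in *.
assert (0 < p * x) by nra. assert (0 < p * (p * x)) by nra.
rewrite !IH by easy. rewrite !hm by easy. ring.
Qed.

(** * Bounds for dilation operators uniform in the number of primes *)

Section DilationBounds.

Variables (t1 t2 : R -> R) (A : R).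
Hypothesis hA : 0 <= A.
Hypothesis ht : forall p, 2 <= p -> Rabs (t1 p) + Rabs (t2 p) <= A * / p ^ 2.

Lemma dilation_op_bound (f : R -> R) (M : R) (N : nat) : 0 <= M ->
  (forall x, 0 < x -> Rabs (f x) <= M) ->
  forall x, 0 < x -> Rabs (dilation_op t1 t2 N f x)
    <= M * prime_product_upto N (fun p => 1 + (Rabs (t1 p) + Rabs (t2 p))).
Proof.
intros hM hf. induction N as [|N IH]; intros x hx.
- rewrite prime_product_upto_0, Rmult_1_r. now apply hf.
- rewrite prime_product_upto_S. cbn [dilation_op].
  destruct (prime_dec (Z.of_nat (S N))) as [h|h]; [|rewrite Rmult_1_r; now apply IH].
  apply prime_INR_ge_2 in h. cbv zeta. set (p := INR (S N)) in *.
  assert (h1 : 0 < p * x) by nra. assert (h2 : 0 < p * (p * x)) by nra.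
  pose proof (IH x hx) as I0. apply IH in h1. apply IH in h2.
  refine (Rle_trans _ _ _ (Rabs_triang _ _) _).
  refine (Rle_trans _ _ _ (Rplus_le_compat_r _ _ _ (Rabs_triang _ _)) _).
  rewrite !Rabs_mult. pose proof (Rabs_pos (t1 p)). pose proof (Rabs_pos (t2 p)).
  set (Q := prime_product_upto N _) in *.
  apply Rmult_le_compat_l with (r := Rabs (t1 p)) in h1; [|easy].
  apply Rmult_le_compat_l with (r := Rabs (t2 p)) in h2; [|easy]. lra.
Qed.

Lemma dilation_op_uniform_bound : exists K, 0 < K /\
  forall (f : R -> R) (M : R), 0 <= M -> (forall x, 0 < x -> Rabs (f x) <= M) ->
  forall N x, 0 < x -> Rabs (dilation_op t1 t2 N f x) <= M * K.
Proof.
destruct (prime_product_upto_bounded (fun p => 1 + (Rabs (t1 p) + Rabs (t2 p))) A hA)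
  as [K [hK BK]].
{ intros p hp. replace (1 + (Rabs (t1 p) + Rabs (t2 p)) - 1)
    with (Rabs (t1 p) + Rabs (t2 p)) by ring.
  rewrite Rabs_pos_eq; [now apply ht|].
  pose proof (Rabs_pos (t1 p)). pose proof (Rabs_pos (t2 p)). lra. }
exists K. split; [exact hK|]. intros f M hM hf N x hx.
refine (Rle_trans _ _ _ (dilation_op_bound f M N hM hf x hx) _).
apply Rmult_le_compat_l; [easy|].
refine (Rle_trans _ _ _ (Rle_abs _) _). apply BK.
Qed.

Lemma dilation_op_vanish_at_0 (f : R -> R) (N : nat) :
  (forall e, 0 < e -> exists d, 0 < d /\ forall x, 0 < x < d -> Rabs (f x) <= e) ->
  forall e, 0 < e -> exists d, 0 < d /\
    forall x, 0 < x < d -> Rabs (dilation_op t1 t2 N f x) <= e.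
Proof.
intros hf. induction N as [|N IH]; [exact hf|].
intros e he. cbn [dilation_op].
destruct (prime_dec (Z.of_nat (S N))) as [h|h]; [|now apply IH].
apply prime_INR_ge_2 in h. cbv zeta. set (p := INR (S N)) in *.
pose proof (Rabs_pos (t1 p)). pose proof (Rabs_pos (t2 p)).
set (T := 1 + Rabs (t1 p) + Rabs (t2 p)).
destruct (IH (e / T)) as [d [hd Hd]]; [apply Rdiv_lt_0_compat; unfold T; lra|].
exists (d / (p * p)). split; [apply Rdiv_lt_0_compat; nra|].
intros x [hx hxd].
assert (hx2 : p * (p * x) < d).
{ apply Rmult_lt_compat_r with (r := p * p) in hxd; [|nra].
  unfold Rdiv in hxd. rewrite Rmult_assoc, Rinv_l in hxd by nra. lra. }
assert (q1 : 2 * x <= p * x) by (apply Rmult_le_compat_r; lra).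
assert (q2 : 2 * (p * x) <= p * (p * x)) by (apply Rmult_le_compat_r; lra).
assert (h0 : Rabs (dilation_op t1 t2 N f x) <= e / T) by (apply Hd; lra).
assert (h1 : Rabs (dilation_op t1 t2 N f (p * x)) <= e / T) by (apply Hd; lra).
assert (h2 : Rabs (dilation_op t1 t2 N f (p * (p * x))) <= e / T) by (apply Hd; lra).
refine (Rle_trans _ _ _ (Rabs_triang _ _) _).
refine (Rle_trans _ _ _ (Rplus_le_compat_r _ _ _ (Rabs_triang _ _)) _).
rewrite !Rabs_mult.
apply Rmult_le_compat_l with (r := Rabs (t1 p)) in h1; [|easy].
apply Rmult_le_compat_l with (r := Rabs (t2 p)) in h2; [|easy].
apply Rle_trans with (T * (e / T)); [unfold T in *; lra|].
right. field. unfold T. lra.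
Qed.

(** At fixed [N0] only finitely many dilations occur, so small [x] makes every argument small. The
    primes beyond [N0] change the value by at most [M K A] times a tail of the series of [1 / n^2],
    uniformly in [x]. The same [d] thus serves all [N >= N0], which allows [N] to go to infinity at
    fixed [x]. *)
Lemma dilation_op_vanish_uniform (f : R -> R) (M : R) : 0 <= M ->
  (forall x, 0 < x -> Rabs (f x) <= M) ->
  (forall e, 0 < e -> exists d, 0 < d /\ forall x, 0 < x < d -> Rabs (f x) <= e) ->
  forall e, 0 < e -> exists d N0, 0 < d /\
    forall N x, (N0 <= N)%nat -> 0 < x < d -> Rabs (dilation_op t1 t2 N f x) <= e.
Proof.
intros hM hf hv e he.
destruct dilation_op_uniform_bound as [K [hK BK]].
set (s := sum_n (fun n => / INR n ^ 2)).
assert (tail : forall N0 N x, (N0 <= N)%nat -> 0 < x ->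
  Rabs (dilation_op t1 t2 N f x - dilation_op t1 t2 N0 f x)
  <= M * K * A * (s N - s N0)).
{ intros N0 N x hN hx. induction hN as [|N hN IH].
  - rewrite !Rminus_diag_eq, Rabs_R0 by easy. lra.
  - unfold s. rewrite sum_n_S. fold s. cbn [dilation_op].
    pose proof (inv_square_nonneg (S N)) as hi.
    assert (hMK : 0 <= M * K) by nra.
    assert (hMKA : 0 <= M * K * A) by nra.
    destruct (prime_dec (Z.of_nat (S N))) as [h|h]; [|nra].
    apply prime_INR_ge_2 in h. specialize (ht _ h). cbv zeta.
    set (p := INR (S N)) in *.
    set (D0 := dilation_op t1 t2 N f x) in *.
    assert (b1 := BK f M hM hf N (p * x) ltac:(nra)).
    assert (b2 := BK f M hM hf N (p * (p * x))
      ltac:(apply Rmult_lt_0_compat; [lra|nra])).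
    set (D1 := dilation_op t1 t2 N f (p * x)) in *.
    set (D2 := dilation_op t1 t2 N f (p * (p * x))) in *.
    replace (D0 + t1 p * D1 + t2 p * D2 - dilation_op t1 t2 N0 f x)
      with ((D0 - dilation_op t1 t2 N0 f x) + (t1 p * D1 + t2 p * D2)) by ring.
    refine (Rle_trans _ _ _ (Rabs_triang _ _) _).
    replace (M * K * A * (s N + / p ^ 2 - s N0))
      with (M * K * A * (s N - s N0) + M * K * (A * / p ^ 2)) by ring.
    apply Rplus_le_compat; [exact IH|].
    refine (Rle_trans _ _ _ (Rabs_triang _ _) _). rewrite !Rabs_mult.
    pose proof (Rabs_pos (t1 p)). pose proof (Rabs_pos (t2 p)).
    apply Rmult_le_compat_l with (r := Rabs (t1 p)) in b1; [|easy].
    apply Rmult_le_compat_l with (r := Rabs (t2 p)) in b2; [|easy].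
    apply Rmult_le_compat_l with (r := M * K) in ht; [|easy]. lra. }
set (Q := M * K * A). assert (hQ : 0 <= Q) by (unfold Q; apply Rmult_le_pos; nra).
destruct (Series_correct _ ex_series_inv_squares0
  (ball (Series (fun n => / INR n ^ 2))
        (mkposreal (e / 2 / (Q + 1)) ltac:(apply Rdiv_lt_0_compat; lra)))
  (locally_ball _ _)) as [N0 HN0].
specialize (HN0 N0 (le_n _)). change (Rabs (s N0 - Series (fun n => / INR n ^ 2))
  < e / 2 / (Q + 1)) in HN0.
destruct (dilation_op_vanish_at_0 f N0 hv (e / 2)) as [d [hd Hd]]; [lra|].
exists d, N0. split; [exact hd|]. intros N x hN hx.
replace (dilation_op t1 t2 N f x) with
  ((dilation_op t1 t2 N f x - dilation_op t1 t2 N0 f x) + dilation_op t1 t2 N0 f x) by ring.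
refine (Rle_trans _ _ _ (Rabs_triang _ _) _).
specialize (Hd x hx). specialize (tail N0 N x hN (proj1 hx)). fold Q in tail.
assert (hs : s N <= Series (fun n => / INR n ^ 2)).
{ apply sum_n_nonneg_le_Series; [apply inv_square_nonneg|apply ex_series_inv_squares0]. }
apply Rabs_def2 in HN0.
assert (Q * (s N - s N0) <= Q * (e / 2 / (Q + 1))) by (apply Rmult_le_compat_l; lra).
assert (Q * (e / 2 / (Q + 1)) <= e / 2).
{ apply Rle_trans with ((Q + 1) * (e / 2 / (Q + 1))).
  - apply Rmult_le_compat_r; [|lra]. apply Rdiv_le_0_compat; lra.
  - right. field. lra. }
lra.
Qed.

End DilationBounds.

(** * Euler products and local factors *)

(** The part of the sum brought in by a new prime [p] runs over its multiples [p r], where the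
    weight for the smaller primes is that of [r] and [F x (p r)] is a dilation of [F]. The factor
    [e p] covers summands such as [f (r x)], [f (r x) / r^2] and [/ r^s] at once. *)
Lemma Series_prime_weight (c e : R -> R) (F : R -> nat -> R) :
  (forall x, 0 < x -> ex_series (fun r => Rabs (F x (S r)))) ->
  (forall (p r : nat) x, (2 <= p)%nat -> (1 <= r)%nat -> 0 < x ->
     F x (p * r)%nat = e (INR p) * F (INR p * x) r) ->
  forall N x, 0 < x ->
  Series (fun r => prime_weight c N (S r) * F x (S r))
  = dilation_op (fun p => c p * e p) (fun _ => 0) N (fun y => Series (fun r => F y (S r))) x.
Proof.
intros hs hF. induction N as [|N IH]; intros x hx.
- simpl. apply Series_ext. intros r. unfold prime_weight; simpl.
  destruct (prime_dec 0) as [h|h]; [|ring]. apply prime_ge_2 in h. lia.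
- cbn [dilation_op]. destruct (prime_dec (Z.of_nat (S N))) as [h|h].
  2: { rewrite <- IH by easy. apply Series_ext. intros r.
       now rewrite prime_weight_S_not_prime. }
  pose proof (prime_INR_ge_2 _ h) as h2. cbv zeta.
  rewrite <- !IH by (repeat apply Rmult_lt_0_compat; lra).
  destruct (prime_weight_bounded c N) as [K [hK BK]].
  rewrite (Series_ext _ (fun r => prime_weight c N (S r) * F x (S r)
    + c (INR (S N)) * (if Zdivide_dec (Z.of_nat (S N)) (Z.of_nat (S r))
                      then prime_weight c N (S r) * F x (S r) else 0))).
  2: { intros r. rewrite prime_weight_S_prime by easy. destruct (Zdivide_dec _ _); ring. }
  assert (s1 : ex_series (fun r => prime_weight c N (S r) * F x (S r))).
  { apply (ex_series_bounded_mult (fun r => prime_weight c N (S r)) _ K); auto. }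
  rewrite Series_plus; [|exact s1|].
  + rewrite Series_scal_l.
    rewrite (Series_multiples (S N) (fun r => prime_weight c N r * F x r)); [|lia|].
    * rewrite (Series_ext (fun r => prime_weight c N (S N * S r) * F x (S N * S r)%nat)
         (fun r => e (INR (S N))
         * (prime_weight c N (S r) * F (INR (S N) * x) (S r)))).
      -- rewrite Series_scal_l. ring.
      -- intros r. rewrite prime_weight_mult_prime by (trivial; lia).
         rewrite hF; [ring|now apply prime_nat_ge_2|lia|easy].
    * apply ex_series_ext with (fun r => Rabs (prime_weight c N (S r)) * Rabs (F x (S r))).
      -- intros r. symmetry. apply Rabs_mult.
      -- apply (ex_series_bounded_mult (fun r => Rabs (prime_weight c N (S r))) _ K).
         ++ intros r. rewrite Rabs_Rabsolu. apply BK.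
         ++ apply ex_series_ext with (fun r => Rabs (F x (S r))); [|auto].
            intros r. symmetry. apply Rabs_Rabsolu.
  + apply (ex_series_scal_l (V := R_NormedModule)).
    apply ex_series_ext with (fun r =>
      (if Zdivide_dec (Z.of_nat (S N)) (Z.of_nat (S r))
       then prime_weight c N (S r) else 0) * F x (S r)).
    * intros r. destruct (Zdivide_dec _ _); [reflexivity|apply Rmult_0_l].
    * apply (ex_series_bounded_mult (fun r =>
        if Zdivide_dec (Z.of_nat (S N)) (Z.of_nat (S r))
        then prime_weight c N (S r) else 0) _ K); [|auto].
      intros r. destruct (Zdivide_dec _ _); [apply BK|rewrite Rabs_R0; easy].
Qed.

Lemma INR_S_pow_pos (r s : nat) : 0 < / INR (S r) ^ s.
Proof. apply Rinv_0_lt_compat, pow_lt, lt_0_INR. lia. Qed.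

Lemma zeta_ge_1 (s : nat) : (2 <= s)%nat -> 1 <= zeta s.
Proof.
intros hs. replace 1 with (sum_n (fun n => / INR (S n) ^ s) 0).
- apply sum_n_nonneg_le_Series; [|now apply ex_series_inv_pow].
  intros n. left. apply INR_S_pow_pos.
- rewrite sum_O. simpl INR. rewrite pow1. apply Rinv_1.
Qed.

Lemma zeta_sieve (s N : nat) : (2 <= s)%nat ->
  Series (fun r => sieve_weight N (S r) * / INR (S r) ^ s)
  = zeta s * prime_product_upto N (fun p => 1 - / p ^ s).
Proof.
intros hs. unfold sieve_weight.
rewrite (Series_prime_weight (fun _ => -1) (fun p => / p ^ s)
  (fun _ r => / INR r ^ s)) with (x := 1).
- rewrite (dilation_op_const _ _ N (zeta s)). f_equal.
  apply prime_product_upto_ext. intros p _. ring.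
- intros x _. apply ex_series_ext with (fun r => / INR (S r) ^ s).
  + intros r. symmetry. apply Rabs_pos_eq. left. apply INR_S_pow_pos.
  + now apply ex_series_inv_pow.
- intros p r x hp hr _. rewrite mult_INR, Rpow_mult_distr, Rinv_mult. reflexivity.
- lra.
Qed.

(** The sieve of Eratosthenes: once the multiples of all primes up to [N] are removed, only [r = 1]
    and some [r > N] survive, so the sieved series lies between [1] and [1] plus a tail of the zeta
    series. *)
Lemma euler_product (s : nat) : (2 <= s)%nat ->
  is_lim_seq (fun N => prime_product_upto N (fun p => 1 - / p ^ s)) (/ zeta s).
Proof.
intros hs. pose proof (zeta_ge_1 s hs) as hz.
set (u := fun r => / INR (S r) ^ s).
assert (su : ex_series u) by now apply ex_series_inv_pow.
assert (l : is_lim_seq (fun N => Series (fun r => sieve_weight N (S r) * u r)) 1).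
{ apply is_lim_seq_incr_1.
  apply is_lim_seq_le_le with (fun _ => 1)
    (fun N => 1 + (Series u - sum_n u N)).
  - intros N.
    assert (sw : forall M, ex_series (fun r => sieve_weight M (S r) * u r)).
    { intros M. apply (ex_series_bounded_mult (fun r => sieve_weight M (S r)) _ 1).
      - intros r. pose proof (sieve_weight_bound M (S r)). rewrite Rabs_pos_eq; lra.
      - apply ex_series_ext with u; [|easy]. intros r. symmetry. apply Rabs_pos_eq.
        left. apply INR_S_pow_pos. }
    assert (head : sum_n (fun r => sieve_weight (S N) (S r) * u r) N = 1 :> R).
    { assert (A : forall M, (M <= N)%nat ->
        sum_n (fun r => sieve_weight (S N) (S r) * u r) M = 1 :> R).
      { induction M as [|M IH]; intros hM.
        - rewrite sum_O. unfold sieve_weight, u. rewrite prime_weight_1.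
          simpl INR. rewrite pow1, Rinv_1. ring.
        - rewrite sum_n_S, IH, sieve_weight_0 by lia. ring. }
      now apply A. }
    rewrite (Series_incr_n _ (S N)) by (try apply sw; lia).
    rewrite <- sum_n_Reals. simpl pred. rewrite head.
    assert (tl : Series u - sum_n u N = Series (fun k => u (S N + k)%nat)).
    { rewrite (Series_incr_n u (S N)) by (trivial; lia).
      rewrite <- sum_n_Reals. simpl pred. ring. }
    rewrite tl.
    assert (st : ex_series (fun k => u (S N + k)%nat))
      by now apply (ex_series_incr_n (V := R_NormedModule)).
    assert (b : forall k, 0 <= sieve_weight (S N) (S (S N + k)) * u (S N + k)%nat
                        <= u (S N + k)%nat).
    { intros k. pose proof (sieve_weight_bound (S N) (S (S N + k))).
      assert (0 < u (S N + k)%nat) by apply INR_S_pow_pos. nra. }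
    split.
    + enough (0 <= Series (fun k => sieve_weight (S N) (S (S N + k)) * u (S N + k)%nat))
        by lra.
      apply Series_nonneg.
      * intros k. apply b.
      * apply (ex_series_incr_n (V := R_NormedModule)
          (fun r => sieve_weight (S N) (S r) * u r)). apply sw.
    + apply Rplus_le_compat_l. now apply Series_le.
  - apply is_lim_seq_const.
  - replace (Finite 1) with (Finite (1 + (Series u - Series u))) by (f_equal; ring).
    apply is_lim_seq_plus'; [apply is_lim_seq_const|].
    apply is_lim_seq_minus'; [apply is_lim_seq_const|].
    exact (Series_correct _ su). }
apply is_lim_seq_ext with
  (fun N => / zeta s * Series (fun r => sieve_weight N (S r) * u r)).
- intros N. unfold u. rewrite zeta_sieve by easy. field. lra.
- replace (Finite (/ zeta s)) with (Finite (/ zeta s * 1)) by (f_equal; ring).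
  apply (is_lim_seq_scal_l _ (/ zeta s) (Finite 1)). exact l.
Qed.

Definition nu_step (p : R) : R := p ^ 2 / (p ^ 4 - 2 * p ^ 2 - p + 1).
Definition alpha_factor (p : R) : R :=
  (1 - p - 2 * p ^ 2 + p ^ 4) / (p ^ 4 - 2 * p ^ 2 + p).
Definition beta_factor (p : R) : R := (-1 + p ^ 2 + p ^ 3) / (p * (-1 + p + p ^ 2)).
Definition gamma_factor (p : R) : R := p * (1 + p) / (-1 + p + p ^ 2).

Lemma nu_prime_weight (N r : nat) : (1 <= r <= N)%nat ->
  prime_weight nu_step N r = nu r.
Proof. intros hr. now rewrite prime_weight_stable by lia. Qed.

Lemma local_denominators (p : R) : 2 <= p ->
  p ^ 4 / 4 <= p ^ 4 - 2 * p ^ 2 - p + 1 /\ 0 < p ^ 4 - 2 * p ^ 2 + p /\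
  p ^ 2 <= -1 + p + p ^ 2.
Proof. intros hp. repeat split; [|nra|nra]. 
assert (4 <= p ^ 2) by nra. replace (p ^ 4) with (p ^ 2 * p ^ 2) by ring. nra. Qed.

Lemma Rdiv_le_of_le_mult (a b c : R) : 0 < b -> a <= c * b -> a / b <= c.
Proof.
intros hb h. apply Rmult_le_reg_r with b; [easy|].
unfold Rdiv. rewrite Rmult_assoc, Rinv_l, Rmult_1_r by lra. exact h.
Qed.

Lemma Rdiv_le_inv_square (a b A p : R) : 0 < b -> 0 < p -> a * p ^ 2 <= A * b ->
  a / b <= A * / p ^ 2.
Proof.
intros hb hp h. assert (0 < p ^ 2) by (apply pow_lt; lra).
apply Rdiv_le_of_le_mult; [easy|].
apply Rmult_le_reg_r with (p ^ 2); [easy|].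
replace (A * / p ^ 2 * b * p ^ 2) with (A * b) by (field; lra). exact h.
Qed.

Lemma alpha_factor_bound (p : R) : 2 <= p -> Rabs (alpha_factor p - 1) <= 4 * / p ^ 2.
Proof.
intros hp. destruct (local_denominators p hp) as [h1 [h2 h3]].
replace (alpha_factor p - 1) with (- ((2 * p - 1) / (p ^ 4 - 2 * p ^ 2 + p)))
  by (unfold alpha_factor; field; lra).
rewrite Rabs_Ropp, Rabs_pos_eq by (apply Rdiv_le_0_compat; lra).
apply Rdiv_le_inv_square; try lra. nra.
Qed.

Lemma beta_factor_bound (p : R) : 2 <= p -> Rabs (beta_factor p - 1) <= 4 * / p ^ 2.
Proof.
intros hp. destruct (local_denominators p hp) as [h1 [h2 h3]].
assert (0 < p * (-1 + p + p ^ 2)) by nra.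
replace (beta_factor p - 1) with ((p - 1) / (p * (-1 + p + p ^ 2)))
  by (unfold beta_factor; field; nra).
rewrite Rabs_pos_eq by (apply Rdiv_le_0_compat; lra).
apply Rdiv_le_inv_square; try lra. nra.
Qed.

Lemma gamma_factor_bound (p : R) : 2 <= p -> Rabs (gamma_factor p - 1) <= 4 * / p ^ 2.
Proof.
intros hp. destruct (local_denominators p hp) as [h1 [h2 h3]].
assert (0 < p * (-1 + p + p ^ 2)) by nra.
replace (gamma_factor p - 1) with (1 / (-1 + p + p ^ 2))
  by (unfold gamma_factor; field; nra).
rewrite Rabs_pos_eq by (apply Rdiv_le_0_compat; nra).
apply Rdiv_le_inv_square; nra.
Qed.

(* The coefficients of the dilations by [p] and [p^2] in
   [(1 + g(p) T_p) (1 - p^-2 T_p)], where [nu = prod (1 + g(p))]. *)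
Definition coef1 (p : R) : R := nu_step p * 1 + (-1) * / p ^ 2.
Definition coef2 (p : R) : R := nu_step p * 1 * ((-1) * / p ^ 2).

(** [nu_step p] is [p^-2] up to [O(p^-4)], so the leading terms of [coef1] cancel. The weights [p]
    and [p^2] come from acting on functions of the form [x * f], and [10 = 6 + 4] adds the bounds
    for the two terms. *)
Lemma coef_bound (p : R) : 2 <= p ->
  Rabs (p * coef1 p) + Rabs (p ^ 2 * coef2 p) <= 10 * / p ^ 2.
Proof.
intros hp. destruct (local_denominators p hp) as [h1 _].
assert (hp4 : 16 <= p ^ 4) 
  by (assert (4 <= p ^ 2) by nra; replace (p ^ 4) with (p ^ 2 * p ^ 2) by ring; nra).
assert (e1 : p * coef1 p
  = (2 * p ^ 2 + p - 1) / (p * (p ^ 4 - 2 * p ^ 2 - p + 1)))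
  by (unfold coef1, nu_step; field; lra).
assert (e2 : p ^ 2 * coef2 p = - (p ^ 2 / (p ^ 4 - 2 * p ^ 2 - p + 1)))
  by (unfold coef2, nu_step; field; lra).
set (d := p ^ 4 - 2 * p ^ 2 - p + 1) in *.
rewrite e1, e2, Rabs_Ropp, !Rabs_pos_eq.
- assert (a1 : (2 * p ^ 2 + p - 1) / (p * d) <= 6 * / p ^ 2).
  { apply Rdiv_le_inv_square; [nra|lra|].
    apply Rle_trans with (6 * (p * (p ^ 4 / 4))); [|nra].
    replace (6 * (p * (p ^ 4 / 4))) with (3 / 2 * p ^ 3 * p ^ 2) by field.
    apply Rmult_le_compat_r; nra. }
  assert (a2 : p ^ 2 / d <= 4 * / p ^ 2).
  { apply Rdiv_le_inv_square; [lra|lra|].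
    replace (p ^ 2 * p ^ 2) with (p ^ 4) by ring. lra. }
  lra.
- apply Rdiv_le_0_compat; nra.
- apply Rdiv_le_0_compat; nra.
Qed.

(** The sum in parentheses factors as [(1 + p g(p)) (1 - 1/p)] with [g = nu_step], and
    [alpha_factor p * (1 + p g(p)) = 1 + 1/p]. The product over [p] is the source of
    [1 / zeta(2)]. *)
Lemma local_identity_linear (p : R) : 2 <= p ->
  alpha_factor p * (1 + p * coef1 p + p ^ 2 * coef2 p) = 1 - / p ^ 2.
Proof.
intros hp. destruct (local_denominators p hp) as [h1 [h2 h3]].
unfold alpha_factor, coef1, coef2, nu_step. field. repeat split; nra.
Qed.

(** On constants [T_p] is the identity, and [alpha_factor p * (1 + g(p)) = beta_factor p]; the
    product of the factors [1 - p^-2] cancels the [zeta(2)] of the double sum. *)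
Lemma local_identity_const (p : R) : 2 <= p ->
  alpha_factor p * (1 + 1 * coef1 p + 1 ^ 2 * coef2 p)
  = beta_factor p * (1 - / p ^ 2).
Proof.
intros hp. destruct (local_denominators p hp) as [h1 [h2 h3]].
unfold alpha_factor, beta_factor, coef1, coef2, nu_step. field. repeat split; nra.
Qed.

(** On [1 / x] the second factor of the operator acts as [1 - p^-3], whose product cancels
    [zeta(3)]; the first one satisfies [alpha_factor p * (1 + g(p) / p) = gamma_factor p * (1 -
    p^-2)]. *)
Lemma local_identity_inverse (p : R) : 2 <= p ->
  alpha_factor p * (1 + / p * coef1 p + (/ p) ^ 2 * coef2 p)
  = gamma_factor p * ((1 - / p ^ 2) * (1 - / p ^ 3)).
Proof.
intros hp. destruct (local_denominators p hp) as [h1 [h2 h3]].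
unfold alpha_factor, gamma_factor, coef1, coef2, nu_step. field. repeat split; nra.
Qed.

Lemma exists_index_beyond (L x : R) : 0 < x -> exists M : nat, L <= INR M * x.
Proof.
intros hx. destruct (nfloor_ex (Rabs L / x)) as [M [_ hM]].
{ apply Rdiv_le_0_compat; [apply Rabs_pos|easy]. }
exists (S M). rewrite S_INR. apply Rmult_lt_compat_r with (r := x) in hM; [|easy].
unfold Rdiv in hM. rewrite Rmult_assoc, Rinv_l, Rmult_1_r in hM by lra.
pose proof (Rle_abs L). lra.
Qed.

Lemma index_mult_le (L x : R) (M r : nat) : 0 < x -> L <= INR M * x -> (M <= r)%nat ->
  L <= INR r * x.
Proof. intros hx hM hr. apply le_INR in hr. nra. Qed.

(** * The sum over [r] weighted by [nu] *)

Section NuSum.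

Variables (H h1 : R -> R) (L : R).
Hypothesis hL : 0 < L.
Hypothesis SH : smooth H.
Hypothesis Sh1 : smooth h1.
Hypothesis DH : forall v, is_derive H v (v * h1 v).
Hypothesis Hz : forall v, L <= v -> H v = 0.

Let c : R := RInt H 0 L.
Let kappa : R := RInt h1 0 L.
Let D x := Series (fun a => dilated_sum H (INR (S a) * x) / INR (S a) ^ 2).

Local Lemma dilated_sum_zero (x : R) : L <= x -> dilated_sum H x = 0.
Proof.
intros hx. rewrite (dilated_sum_finite H L x 0); trivial.
- rewrite sum_O. apply Hz. simpl. lra.
- lra.
- simpl. lra.
Qed.

(** Since [H] vanishes from [L] on, only [r <= N] matter, and there [nu] equals the weight with
    cutoff [N]. In the same range the sieve factors applied to [D] keep exactly the term [a = 1],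
    which is [dilated_sum H], so the formula has no error. *)
Local Lemma nu_sum_dilation (x : R) (N : nat) : 0 < x -> L <= INR N * x ->
  Series (fun r => nu (S r) * H (INR (S r) * x)) = dilation_op coef1 coef2 N D x.
Proof.
intros hx hN.
assert (ex : forall u : nat -> R, forall M, (forall m, (M <= m)%nat -> u m = 0) ->
  ex_series (fun r => Rabs (u r))).
{ intros u M hu. eexists. apply (is_series_finite_support _ M).
  intros m hm. rewrite hu by lia. apply Rabs_R0. }
rewrite (Series_ext _ (fun r => prime_weight nu_step N (S r) * H (INR (S r) * x))).
2: { intros r. destruct (Nat.le_gt_cases (S r) N) as [h|h].
     - now rewrite nu_prime_weight by lia.
     - rewrite Hz; [ring|]. apply (index_mult_le L x N); trivial; lia. }
rewrite (Series_prime_weight nu_step (fun _ => 1) (fun y r => H (INR r * y)))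
  with (x := x); trivial.
- change (fun y => Series (fun r => H (INR (S r) * y))) with (dilated_sum H).
  rewrite (dilation_op_ext _ _ N (dilated_sum H)
    (dilation_op (fun p => -1 * / p ^ 2) (fun _ => 0) N D) x hx).
  + apply dilation_op_comp.
  + intros y hy. symmetry. unfold D.
    rewrite <- (Series_prime_weight (fun _ => -1) (fun p => / p ^ 2)
      (fun y r => dilated_sum H (INR r * y) / INR r ^ 2)); [| | |lra].
    * fold sieve_weight. rewrite (Series_finite_support _ 0).
      -- rewrite sum_O. unfold sieve_weight. rewrite prime_weight_1. simpl INR.
         rewrite !Rmult_1_l, pow1. apply Rdiv_1_r.
      -- intros m hm. destruct (Nat.le_gt_cases (S m) N) as [h|h].
         ++ rewrite sieve_weight_0 by lia. ring.
         ++ rewrite dilated_sum_zero; [unfold Rdiv; ring|].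
            apply (index_mult_le L y N); [lra| |lia]. pose proof (pos_INR N). nra.
    * intros z hz. destruct (exists_index_beyond L z hz) as [M hM].
      apply (ex _ M). intros m hm. rewrite dilated_sum_zero; [apply Rmult_0_l|].
      apply (index_mult_le L z M); trivial; lia.
    * intros p r z hp hr hz. rewrite mult_INR.
      replace (INR p * INR r * z) with (INR r * (INR p * z)) by ring. field.
      split; apply not_0_INR; lia.
  + lra.
- intros z hz. destruct (exists_index_beyond L z hz) as [M hM].
  apply (ex _ M). intros m hm. apply Hz. apply (index_mult_le L z M); trivial; lia.
- intros p r z hp hr hz. rewrite mult_INR, Rmult_1_l. f_equal. ring.
Qed.

(** For every large [N] the identity [key] is exact. Its last term is small uniformly in [N], the
    other terms converge, and [N] goes to infinity with [x] fixed. *)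
Lemma nu_sum_expansion : forall e, 0 < e -> exists d, 0 < d /\ forall x, 0 < x < d ->
  Rabs (prime_product alpha_factor * Series (fun r => nu (S r) * H (INR (S r) * x))
        - (prime_product gamma_factor * c / (zeta 2 * x)
           - prime_product beta_factor * H 0 / 2
           - kappa / (12 * zeta 2) * x)) <= e * x.
Proof.
intros e he.
destruct (double_sum_expansion H h1 L hL SH Sh1 DH Hz) as [eta [C [hC [B1 [B2 ED]]]]].
fold c in ED. fold kappa in B2.
(* [eps] is bounded on all of [(0, oo)] and tends to [0] at [0], as [dilation_op_vanish_uniform]
   requires. *)
set (eps := fun x => eta x + kappa / 12) in *.
destruct (prime_product_upto_bounded alpha_factor 4) as [K [hK BK]];
  [lra|exact alpha_factor_bound|].
(* These are the coefficients after the function [x] has been pulled out; [e / K] makes room for the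
   partial products of [alpha_factor]. *)
destruct (dilation_op_vanish_uniform (fun p => p * coef1 p) (fun p => p ^ 2 * coef2 p)
  10 ltac:(lra) coef_bound eps (C + Rabs (kappa / 12))) with (e := e / K)
  as [d [N0 [hd Hd]]].
{ pose proof (Rabs_pos (kappa / 12)). lra. }
{ intros x hx. refine (Rle_trans _ _ _ (Rabs_triang _ _) _).
  apply Rplus_le_compat_r. now apply B1. }
{ intros e' he'. exists (Rmin 1 (e' / (C + 1))). split.
  - apply Rmin_pos; [lra|]. apply Rdiv_lt_0_compat; lra.
  - intros x [hx hx']. pose proof (Rmin_l 1 (e' / (C + 1))).
    pose proof (Rmin_r 1 (e' / (C + 1))).
    refine (Rle_trans _ _ _ (B2 x ltac:(lra)) _).
    apply Rle_trans with ((C + 1) * x); [nra|].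
    apply Rle_trans with ((C + 1) * (e' / (C + 1))).
    + apply Rmult_le_compat_l; lra.
    + right. field. lra. }
{ now apply Rdiv_lt_0_compat. }
exists d. split; [exact hd|]. intros x hx.
set (W := Series (fun r => nu (S r) * H (INR (S r) * x))).
destruct (exists_index_beyond L x (proj1 hx)) as [N1 hN1].
set (z2 := fun p : R => 1 - / p ^ 2). set (z3 := fun p : R => 1 - / p ^ 3).
set (PP := prime_product_upto).
assert (key : forall N, (N0 <= N)%nat -> (N1 <= N)%nat ->
  PP N alpha_factor * W
  = PP N gamma_factor * (PP N z2 * PP N z3) * (zeta 3 * c / x)
    - PP N beta_factor * PP N z2 * (zeta 2 * H 0 / 2)
    - kappa / 12 * x * PP N z2
    + x * (PP N alpha_factor
           * dilation_op (fun p => p * coef1 p) (fun p => p ^ 2 * coef2 p) N eps x)).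
{ intros N hN0 hN. unfold W. rewrite (nu_sum_dilation x N (proj1 hx)).
  2: { apply (index_mult_le L x N1); trivial; lra. }
  (* [D] is split into parts carrying the homogeneous functions [/ y], [1] and [y], the last one
     times [eps y - kappa / 12]; the factors [1] fit [dilation_op_linear]. *)
  rewrite (dilation_op_ext _ _ N D (fun y => 1 * (/ y * (zeta 3 * c))
     + 1 * (1 * (1 * (- (zeta 2 * H 0 / 2))) + 1 * (y * (1 * eps y + 1 * (- (kappa / 12))))))
    x (proj1 hx)); [|intros y hy; unfold D, eps; rewrite ED by lra; field; lra|lra].
  rewrite !dilation_op_linear.
  rewrite (dilation_op_homogeneous _ _ Rinv Rinv (fun _ => zeta 3 * c)).
  2: lra. 2: { intros p y hp hy. apply Rinv_mult. }
  rewrite (dilation_op_homogeneous _ _ (fun _ => 1) (fun _ => 1)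
             (fun _ => - (zeta 2 * H 0 / 2))).
  2: lra. 2: { intros p y hp hy. ring. }
  rewrite (dilation_op_homogeneous _ _ (fun y => y) (fun p => p)
             (fun y => 1 * eps y + 1 * - (kappa / 12))).
  2: lra. 2: { intros p y hp hy. ring. }
  rewrite dilation_op_linear, !dilation_op_const.
  rewrite Rmult_plus_distr_l. rewrite !Rmult_1_l.
  set (Q1 := prime_product_upto N (fun p => 1 + / p * coef1 p + (/ p) ^ 2 * coef2 p)).
  set (Q2 := prime_product_upto N (fun p => 1 + 1 * coef1 p + 1 ^ 2 * coef2 p)).
  set (Q3 := prime_product_upto N (fun p => 1 + p * coef1 p + p ^ 2 * coef2 p)).
  assert (e1 : PP N alpha_factor * Q1 = PP N gamma_factor * (PP N z2 * PP N z3)).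
  { unfold PP, Q1. rewrite !prime_product_upto_mult. apply prime_product_upto_ext.
    exact local_identity_inverse. }
  assert (e2 : PP N alpha_factor * Q2 = PP N beta_factor * PP N z2).
  { unfold PP, Q2. rewrite !prime_product_upto_mult. apply prime_product_upto_ext.
    exact local_identity_const. }
  assert (e3 : PP N alpha_factor * Q3 = PP N z2).
  { unfold PP, Q3. rewrite !prime_product_upto_mult. apply prime_product_upto_ext.
    exact local_identity_linear. }
  rewrite <- e1, <- e2, <- e3. field. lra. }
pose proof (zeta_ge_1 2 ltac:(lia)). pose proof (zeta_ge_1 3 ltac:(lia)).
assert (lim : is_lim_seq (fun N => Rabs (PP N alpha_factor * W
   - (PP N gamma_factor * (PP N z2 * PP N z3) * (zeta 3 * c / x)
    - PP N beta_factor * PP N z2 * (zeta 2 * H 0 / 2)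
    - kappa / 12 * x * PP N z2)))
  (Rabs (prime_product alpha_factor * W
   - (prime_product gamma_factor * (/ zeta 2 * / zeta 3) * (zeta 3 * c / x)
    - prime_product beta_factor * / zeta 2 * (zeta 2 * H 0 / 2)
    - kappa / 12 * x * / zeta 2)))).
{ assert (la := is_lim_prime_product _ 4 ltac:(lra) alpha_factor_bound).
  assert (lb := is_lim_prime_product _ 4 ltac:(lra) beta_factor_bound).
  assert (lg := is_lim_prime_product _ 4 ltac:(lra) gamma_factor_bound).
  assert (l2 := euler_product 2 ltac:(lia)). assert (l3 := euler_product 3 ltac:(lia)).
  apply (is_lim_seq_abs _ (Finite _)).
  apply is_lim_seq_minus'.
  - apply is_lim_seq_mult'; [exact la|apply is_lim_seq_const].
  - apply is_lim_seq_minus'; [apply is_lim_seq_minus'|].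
    + apply is_lim_seq_mult'; [|apply is_lim_seq_const].
      apply is_lim_seq_mult'; [exact lg|]. now apply is_lim_seq_mult'.
    + apply is_lim_seq_mult'; [|apply is_lim_seq_const]. now apply is_lim_seq_mult'.
    + apply is_lim_seq_mult'; [apply is_lim_seq_const|exact l2]. }
assert (h : Rbar_le (Finite (Rabs (prime_product alpha_factor * W
   - (prime_product gamma_factor * (/ zeta 2 * / zeta 3) * (zeta 3 * c / x)
    - prime_product beta_factor * / zeta 2 * (zeta 2 * H 0 / 2)
    - kappa / 12 * x * / zeta 2)))) (Finite (e * x))).
{ eapply is_lim_seq_le_loc; [|exact lim|apply is_lim_seq_const].
  exists (Nat.max N0 N1). intros N hN. rewrite key by lia.
  match goal with |- Rabs (?u + ?v - ?w) <= _ =>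
    replace (u + v - w) with v by ring end.
  rewrite !Rabs_mult, (Rabs_pos_eq x) by lra. rewrite Rmult_comm.
  apply Rmult_le_compat_r; [lra|].
  apply Rle_trans with (K * (e / K)).
  - apply Rmult_le_compat; try apply Rabs_pos; [apply BK|]. apply Hd; [lia|easy].
  - right. field. lra. }
simpl in h. refine (Rle_trans _ _ _ _ h). right. f_equal. field. lra.
Qed.

End NuSum.

(** * Parametric integrals *)

Lemma continuity_2d_continuous_snd (f : R -> R -> R) (x t : R) :
  continuity_2d_pt f x t -> continuous (f x) t.
Proof.
intros H. apply continuity_pt_filterlim. intros e he.
destruct (H (mkposreal e he)) as [d Hd]. exists d. split; [apply cond_pos|].
intros s [_ hs]. apply Hd; [rewrite Rminus_diag_eq, Rabs_R0 by easy; apply cond_pos|].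
exact hs.
Qed.

Lemma continuity_2d_continuous_fst (f : R -> R -> R) (x t : R) :
  continuity_2d_pt f x t -> continuous (fun y => f y t) x.
Proof.
intros H. apply continuity_pt_filterlim. intros e he.
destruct (H (mkposreal e he)) as [d Hd]. exists d. split; [apply cond_pos|].
intros s [_ hs]. apply Hd; [exact hs|].
rewrite Rminus_diag_eq, Rabs_R0 by easy; apply cond_pos.
Qed.

Lemma continuous_RInt_param (f : R -> R -> R) (a b x : R) :
  (forall x t, continuity_2d_pt f x t) -> continuous (fun y => RInt (f y) a b) x.
Proof.
intros Hf.
assert (ex : forall u v y, ex_RInt (f y) u v).
{ intros u v y. apply (ex_RInt_continuous (V := R_CompleteNormedModule)).
  intros t _. apply continuity_2d_continuous_snd, Hf. }
assert (H : forall a b, a <= b -> continuous (fun y => RInt (f y) a b) x).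
{ clear a b. intros a b hab. apply continuity_pt_filterlim. intros e he.
  assert (he' : 0 < e / (2 * (b - a + 1))) by (apply Rdiv_lt_0_compat; lra).
  destruct (uniform_continuity_2d_1d' f a b x (fun t _ => Hf x t) (mkposreal _ he'))
    as [d Hd].
  simpl in Hd. exists d. split; [apply cond_pos|]. intros y [_ hy].
  change (Rabs (y - x) < d) in hy.
  change (Rabs (minus (RInt (f y) a b) (RInt (f x) a b)) < e).
  rewrite <- (RInt_minus (V := R_CompleteNormedModule)) by apply ex.
  apply Rle_lt_trans with ((b - a) * (e / (2 * (b - a + 1)))).
  - apply abs_RInt_le_const; [exact hab| |].
    + apply (ex_RInt_minus (V := R_NormedModule)); apply ex.
    + intros t ht. left. apply (Hd t x t y); trivial.
      * pose proof (cond_pos d). lra.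
      * apply Rabs_def2 in hy. lra.
      * rewrite Rminus_diag_eq, Rabs_R0 by easy. apply cond_pos.
  - apply Rle_lt_trans with ((b - a + 1) * (e / (2 * (b - a + 1)))).
    + apply Rmult_le_compat_r; lra.
    + replace ((b - a + 1) * (e / (2 * (b - a + 1)))) with (e / 2) by (field; lra). lra. }
destruct (Rle_dec a b) as [h|h]; [now apply H|].
apply (continuous_ext (fun y => opp (RInt (f y) b a))).
- intros y. apply opp_RInt_swap, ex.
- apply (continuous_opp (V := R_NormedModule)). apply H. lra.
Qed.

Lemma continuity_2d_pt_swap (f : R -> R -> R) (x t : R) :
  continuity_2d_pt f x t -> continuity_2d_pt (fun u v => f v u) t x.
Proof. intros H e. destruct (H e) as [d Hd]. exists d. intros u v hu hv. now apply Hd. Qed.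

(** Fubini by differentiation: both sides vanish at [X = 0] and have the derivative
    [RInt (f X) a b], on the right by differentiating under the integral. *)
Lemma RInt_exchange (f : R -> R -> R) (a b X : R) :
  (forall x t, continuity_2d_pt f x t) ->
  RInt (fun x => RInt (f x) a b) 0 X = RInt (fun t => RInt (fun x => f x t) 0 X) a b.
Proof.
intros Hf.
assert (D : forall t y, is_derive (fun X => RInt (fun x => f x t) 0 X) y (f y t)).
{ intros t y. apply (is_derive_RInt (V := R_NormedModule) (fun x => f x t)
    (fun X => RInt (fun x => f x t) 0 X) 0 y).
  - apply filter_forall. intros z. apply (RInt_correct (V := R_CompleteNormedModule)).
    apply (ex_RInt_continuous (V := R_CompleteNormedModule)). intros u _.
    now apply (continuity_2d_continuous_fst f u t), Hf.
  - now apply (continuity_2d_continuous_fst f y t), Hf. }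
set (G := fun X => RInt (fun t => RInt (fun x => f x t) 0 X) a b).
assert (DG : forall y, is_derive G y (RInt (f y) a b)).
{ intros y. rewrite (RInt_ext (f y)
    (fun t => Derive (fun X => RInt (fun x => f x t) 0 X) y)).
  - apply (is_derive_RInt_param (fun X t => RInt (fun x => f x t) 0 X) a b y).
    + apply filter_forall. intros z t _. eexists. apply D.
    + intros t ht. apply continuity_2d_pt_ext with f; [|apply Hf].
      intros u v. symmetry. apply is_derive_unique, D.
    + apply filter_forall. intros z.
      apply (ex_RInt_continuous (V := R_CompleteNormedModule)). intros t _.
      apply (continuous_RInt_param (fun t x => f x t)).
      intros u v. now apply continuity_2d_pt_swap.
  - intros t _. symmetry. apply is_derive_unique, D. }
rewrite (RInt_of_derivative G (fun y => RInt (f y) a b)); [|exact DG|].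
- assert (G0 : G 0 = 0).
  { unfold G. rewrite (RInt_ext _ (fun _ => 0)).
    - rewrite RInt_const. apply Rmult_0_r.
    - intros t _. exact (RInt_point (V := R_CompleteNormedModule) 0 (fun x => f x t)). }
  rewrite G0. apply Rminus_0_r.
- intros y. now apply continuous_RInt_param.
Qed.

Lemma RInt_support (f : R -> R) (a b a' b' : R) : a' <= a -> a <= b -> b <= b' ->
  (forall t, continuous f t) ->
  (forall t, a' < t < a -> f t = 0) -> (forall t, b < t < b' -> f t = 0) ->
  RInt f a' b' = RInt f a b.
Proof.
intros h1 h2 h3 Hc Ha Hb.
assert (ex : forall u v, ex_RInt f u v).
{ intros u v. apply (ex_RInt_continuous (V := R_CompleteNormedModule)). auto. }
assert (z : forall u v, u <= v -> (forall t, u < t < v -> f t = 0) -> RInt f u v = 0).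
{ intros u v huv H. rewrite (RInt_ext f (fun _ => 0)).
  - rewrite RInt_const. apply Rmult_0_r.
  - intros t. rewrite Rmin_left, Rmax_right by easy. intros ht. apply H. lra. }
rewrite <- (RInt_Chasles f a' a b'), <- (RInt_Chasles f a b b') by apply ex.
rewrite (z a' a), (z b b') by easy. unfold plus; simpl.
rewrite Rplus_0_l, Rplus_0_r. reflexivity.
Qed.

(** * Chebyshev polynomials and their primitives *)

(** This is [U_(2 n)] as a polynomial in [s = x^2]; the recursion eliminates the odd indices through
    [U_(m+4) = (4 x^2 - 2) U_(m+2) - U_m]. Working with [x^2] keeps the kernel even. *)
Fixpoint chebyshevV (n : nat) (s : R) : R :=
  match n with
  | O => 1
  | S m => match m with
           | O => 4 * s - 1
           | S l => (4 * s - 2) * chebyshevV m s - chebyshevV l s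
           end
  end.

Lemma chebyshevU_even (n : nat) (x : R) : chebyshevU (2 * n) x = chebyshevV n (x ^ 2).
Proof.
assert (rec : forall m, chebyshevU (S (S (S (S m)))) x
  = (4 * x ^ 2 - 2) * chebyshevU (S (S m)) x - chebyshevU m x).
{ intros m.
  change (chebyshevU (S (S (S (S m)))) x) with
    (2 * x * (2 * x * chebyshevU (S (S m)) x - chebyshevU (S m) x)
     - chebyshevU (S (S m)) x).
  assert (e : chebyshevU (S (S m)) x = 2 * x * chebyshevU (S m) x - chebyshevU m x)
    by reflexivity.
  rewrite e. ring. }
enough (H : chebyshevU (2 * n) x = chebyshevV n (x ^ 2)
  /\ chebyshevU (2 * S n) x = chebyshevV (S n) (x ^ 2)) by apply H.
induction n as [|n [IH1 IH2]].
- split; [reflexivity|]. simpl. ring.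
- split; [exact IH2|].
  replace (2 * S (S n))%nat with (S (S (S (S (2 * n))))) by lia.
  replace (2 * S n)%nat with (S (S (2 * n))) in IH2 by lia.
  rewrite rec, IH1, IH2. reflexivity.
Qed.

Lemma chebyshevV_ind (P : nat -> Prop) :
  P 0%nat -> P 1%nat -> (forall n, P n -> P (S n) -> P (S (S n))) -> forall n, P n.
Proof.
intros h0 h1 hS n. enough (H : P n /\ P (S n)) by apply H.
induction n as [|n [IH1 IH2]]; auto.
Qed.

Lemma chebyshevV_0 (n : nat) : chebyshevV n 0 = (-1) ^ n.
Proof.
revert n. apply chebyshevV_ind; [reflexivity|simpl; ring|]. intros n h1 h2.
change (chebyshevV (S (S n)) 0) with
  ((4 * 0 - 2) * chebyshevV (S n) 0 - chebyshevV n 0). rewrite h1, h2. simpl. ring.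
Qed.

Lemma continuous_chebyshevV (n : nat) (s : R) : continuous (chebyshevV n) s.
Proof.
assert (H : ex_derive (chebyshevV n) s).
{ revert n. apply chebyshevV_ind.
  - simpl. auto_derive. exact I.
  - simpl. auto_derive. exact I.
  - intros n h1 h2.
    change (ex_derive (fun s => (4 * s - 2) * chebyshevV (S n) s - chebyshevV n s) s).
    apply (ex_derive_minus (V := R_NormedModule)
      (fun s => (4 * s - 2) * chebyshevV (S n) s) (chebyshevV n)); [|exact h1].
    apply (ex_derive_mult (fun s => 4 * s - 2) (chebyshevV (S n))); [|exact h2].
    auto_derive. exact I. }
now apply continuous_of_ex_derive.
Qed.

(* [cap n (cos t) = sin ((2 n + 1) t)] on [0, PI / 2], extended by zero beyond [1]
   since [sqrt] vanishes on negative numbers. *)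
Definition cap (n : nat) (w : R) : R := sqrt (1 - w ^ 2) * chebyshevV n (w ^ 2).

(* A primitive of [cos ((2 n + 1) t) / cos t]. *)
Fixpoint cos_ratio_primitive (n : nat) (t : R) : R :=
  match n with
  | O => t
  | S m => sin (2 * INR (S m) * t) / INR (S m) - cos_ratio_primitive m t
  end.

Lemma is_derive_cos_ratio_primitive (n : nat) (t : R) : exists d,
  is_derive (cos_ratio_primitive n) t d /\ cos t * d = cos ((2 * INR n + 1) * t).
Proof.
induction n as [|n [d [D e]]].
- exists 1. split; [apply is_derive_Reals, derivable_pt_lim_id|].
  simpl. rewrite Rmult_0_r, Rplus_0_l, !Rmult_1_l, Rmult_1_r. reflexivity.
- exists (2 * cos (2 * INR (S n) * t) - d).
  assert (hn : INR (S n) <> 0) by (apply not_0_INR; lia). split.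
  + cbn [cos_ratio_primitive]. revert hn. generalize (INR (S n)). intros q hq.
    auto_derive; [now exists d|].
    rewrite (Derive_of_is_derive _ _ _ D). field. exact hq.
  + rewrite Rmult_minus_distr_l, e, S_INR.
    set (s := 2 * (INR n + 1) * t).
    replace ((2 * INR n + 1) * t) with (s - t) by (unfold s; ring).
    replace ((2 * (INR n + 1) + 1) * t) with (s + t) by (unfold s; ring).
    rewrite cos_minus, cos_plus. ring.
Qed.

Lemma cos_ratio_primitive_0 (n : nat) : cos_ratio_primitive n 0 = 0.
Proof.
induction n as [|n IH]; [reflexivity|].
cbn [cos_ratio_primitive]. rewrite IH, Rmult_0_r, sin_0. unfold Rdiv. ring.
Qed.

Lemma sin_INR_PI (n : nat) : sin (INR n * PI) = 0.
Proof.
apply sin_eq_0_1. exists (Z.of_nat n). now rewrite <- INR_IZR_INZ.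
Qed.

(** Every sine term vanishes at [PI / 2], which leaves the base case with alternating sign. The
    value enters [kappa] and produces the final [1 / 2]. *)
Lemma cos_ratio_primitive_PI2 (n : nat) :
  cos_ratio_primitive n (PI / 2) = (-1) ^ n * (PI / 2).
Proof.
induction n as [|n IH]; [simpl; ring|].
cbn [cos_ratio_primitive]. rewrite IH.
replace (2 * INR (S n) * (PI / 2)) with (INR (S n) * PI) by field.
rewrite sin_INR_PI. simpl pow. unfold Rdiv. ring.
Qed.

(** At [1] the function [acos] is continuous but not differentiable, so near and beyond [1] it is
    written through [atan], where [sqrt] of a negative number counts as [0]. *)
Lemma continuous_acos_abs (w : R) : continuous (fun w => acos (Rabs w)) w.
Proof.
apply (continuous_comp Rabs acos); [apply continuous_Rabs|].
pose proof (Rabs_pos w) as h. destruct (Rlt_dec (Rabs w) 1) as [h1|h1].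
- apply continuity_pt_filterlim. apply derivable_continuous_pt.
  apply derivable_pt_acos. lra.
- assert (h0 : 0 < Rabs w) by lra.
  apply (continuous_ext_loc _ (fun x => atan (sqrt (1 - x²) / x))).
  + generalize (open_gt 0 (Rabs w) h0). apply filter_imp. intros t ht.
    symmetry. now apply acos_atan.
  + apply (continuous_comp (fun x => sqrt (1 - x²) / x) atan).
    * apply (continuous_mult (K := R_AbsRing) (fun x => sqrt (1 - x²)) Rinv).
      -- apply continuous_sqrt_comp. apply continuous_of_ex_derive. unfold Rsqr.
         auto_derive. exact I.
      -- apply continuous_of_ex_derive. auto_derive. lra.
    * apply continuous_of_ex_derive. eexists. apply is_derive_Reals, derivable_pt_lim_atan.
Qed.

(** On [[0, 1]] this is the integral of [cap'(v) / v] over [[w, 1]], computed with [v = cos t].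
    [Rabs] and the vanishing of [acos] beyond [1] make it continuous on the whole line. *)
Definition cap_slope (n : nat) (w : R) : R :=
  - (2 * INR n + 1) * cos_ratio_primitive n (acos (Rabs w)).

Lemma continuous_cap_slope (n : nat) (w : R) : continuous (cap_slope n) w.
Proof.
apply (continuous_mult (K := R_AbsRing) (fun _ => - (2 * INR n + 1))
  (fun w => cos_ratio_primitive n (acos (Rabs w)))); [apply continuous_const|].
apply (continuous_comp (fun w => acos (Rabs w)) (cos_ratio_primitive n));
  [apply continuous_acos_abs|].
destruct (is_derive_cos_ratio_primitive n (acos (Rabs w))) as [d [D _]].
apply continuous_of_ex_derive. now exists d.
Qed.

Lemma continuous_cap (n : nat) (w : R) : continuous (cap n) w.
Proof.
apply (continuous_mult (K := R_AbsRing) (fun w => sqrt (1 - w ^ 2))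
  (fun w => chebyshevV n (w ^ 2))).
- apply continuous_sqrt_comp. apply continuous_of_ex_derive. auto_derive. exact I.
- apply (continuous_comp (fun w => w ^ 2) (chebyshevV n)).
  + apply continuous_of_ex_derive. auto_derive. exact I.
  + apply continuous_chebyshevV.
Qed.

Lemma cap_beyond (n : nat) (w : R) : 1 <= w -> cap n w = 0.
Proof. intros hw. unfold cap. rewrite sqrt_neg_0 by nra. ring. Qed.

Lemma cap_slope_beyond (n : nat) (w : R) : 1 <= w -> cap_slope n w = 0.
Proof.
intros hw. unfold cap_slope. rewrite Rabs_pos_eq by lra.
replace (acos w) with 0; [rewrite cos_ratio_primitive_0; ring|].
rewrite acos_atan, sqrt_neg_0 by (unfold Rsqr; nra).
unfold Rdiv. rewrite Rmult_0_l, atan_0. reflexivity.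
Qed.

Lemma cap_slope_0 (n : nat) :
  cap_slope n 0 = - ((2 * INR n + 1) * (-1) ^ n * (PI / 2)).
Proof.
unfold cap_slope. rewrite Rabs_R0, acos_0, cos_ratio_primitive_PI2. ring.
Qed.

Lemma cap_0 (n : nat) : cap n 0 = (-1) ^ n.
Proof.
unfold cap. replace (0 ^ 2) with 0 by ring.
rewrite Rminus_0_r, sqrt_1, chebyshevV_0. ring.
Qed.

Lemma cap_sin (n : nat) (w : R) : 0 <= w < 1 ->
  cap n w = sin ((2 * INR n + 1) * acos w).
Proof.
intros hw. assert (hs : sin (acos w) = sqrt (1 - w ^ 2)).
{ rewrite sin_acos by lra. f_equal. unfold Rsqr. ring. }
assert (hs0 : 0 < sqrt (1 - w ^ 2)) by (apply sqrt_lt_R0; nra).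
unfold cap. rewrite <- chebyshevU_even.
replace w with (cos (acos w)) at 2 by (apply cos_acos; lra).
rewrite chebyshevU_cos by lra. rewrite mult_INR. change (INR 2) with 2. rewrite hs. field. lra.
Qed.

Lemma is_derive_acos (w : R) : -1 < w < 1 -> is_derive acos w (- / sqrt (1 - w ^ 2)).
Proof.
intros hw. apply is_derive_Reals.
pose proof (derive_pt_acos w hw) as e.
replace (- / sqrt (1 - w ^ 2)) with (-1 / sqrt (1 - w²)).
- rewrite <- e. exact (proj2_sig (derivable_pt_acos w hw)).
- replace (w²) with (w ^ 2) by (unfold Rsqr; ring). field.
  apply Rgt_not_eq, sqrt_lt_R0. nra.
Qed.

Lemma constant_on_unit (f : R -> R) :
  (forall w, 0 <= w <= 1 -> continuous f w) -> (forall w, 0 < w < 1 -> is_derive f w 0) ->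
  forall w, 0 <= w <= 1 -> f w = f 0.
Proof.
intros Hc Hd w hw. destruct (MVT_gen f 0 w (fun _ => 0)) as [x [_ e]].
- rewrite Rmin_left, Rmax_right by lra. intros x hx. apply Hd. lra.
- rewrite Rmin_left, Rmax_right by lra. intros x hx.
  apply continuity_pt_filterlim, Hc. lra.
- lra.
Qed.

Lemma is_derive_RInt_cont (f : R -> R) (a x : R) : (forall t, continuous f t) ->
  is_derive (RInt f a) x (f x).
Proof.
intros H. apply (is_derive_RInt (V := R_NormedModule) f (RInt f a) a x); [|apply H].
apply filter_forall. intros t. apply (RInt_correct (V := R_CompleteNormedModule)).
apply (ex_RInt_continuous (V := R_CompleteNormedModule)). auto.
Qed.

(** Differentiated, it reads [cap' = - w * cap_slope']. In integrated form the singular derivative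
    of [cap] at [1] disappears and the relation survives averaging over [t]. It is checked by
    derivatives on [(0, 1)] and continuity; beyond [1] both [cap] and [cap_slope] vanish. *)
Lemma cap_slope_relation (n : nat) (w : R) : 0 <= w ->
  cap n w = cap n 0 - w * cap_slope n w + RInt (cap_slope n) 0 w.
Proof.
intros hw.
assert (DI := fun x => is_derive_RInt_cont (cap_slope n) 0 x (continuous_cap_slope n)).
assert (H : forall w, 0 <= w <= 1 ->
  cap n w + w * cap_slope n w - RInt (cap_slope n) 0 w = cap n 0).
{ intros v hv.
  rewrite (constant_on_unit (fun w => cap n w + w * cap_slope n w - RInt (cap_slope n) 0 w)).
  - rewrite RInt_point. unfold zero; simpl. ring.
  - intros x _.
    apply (continuous_minus (V := R_NormedModule) (fun w => cap n w + w * cap_slope n w)).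
    + apply (continuous_plus (V := R_NormedModule) (cap n)); [apply continuous_cap|].
      apply (continuous_mult (K := R_AbsRing) (fun w => w)); [apply continuous_id|].
      apply continuous_cap_slope.
    + apply continuous_of_ex_derive. eexists. apply DI.
  - intros x hx.
    assert (hs : 0 < sqrt (1 - x ^ 2)) by (apply sqrt_lt_R0; nra).
    apply (is_derive_ext_loc (fun w => sin ((2 * INR n + 1) * acos w)
      + w * (- (2 * INR n + 1) * cos_ratio_primitive n (acos w)) - RInt (cap_slope n) 0 w)).
    + generalize (open_and _ _ (open_gt 0) (open_lt 1) x (conj (proj1 hx) (proj2 hx))).
      apply filter_imp. intros t [ht1 ht2].
      rewrite (cap_sin n t) by lra. unfold cap_slope at 2.
      rewrite (Rabs_pos_eq t) by lra. reflexivity.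
    + destruct (is_derive_cos_ratio_primitive n (acos x)) as [d [D e]].
      rewrite cos_acos in e by lra.
      assert (Da := is_derive_acos x ltac:(lra)). specialize (DI x).
      revert DI. generalize (RInt (cap_slope n) 0). intros g DI.
      auto_derive.
      * repeat split; eexists; [exact Da|exact D|exact Da|exact DI].
      * rewrite (Derive_of_is_derive _ _ _ Da), (Derive_of_is_derive _ _ _ D),
          (Derive_of_is_derive _ _ _ DI).
        rewrite <- e. unfold cap_slope. rewrite (Rabs_pos_eq x) by lra. field. lra.
  - exact hv. }
destruct (Rle_dec w 1) as [h|h]; [specialize (H w ltac:(lra)); lra|].
rewrite cap_beyond, cap_slope_beyond by lra.
rewrite (RInt_support (cap_slope n) 0 1 0 w); try lra.
- specialize (H 1 ltac:(lra)). rewrite cap_beyond, cap_slope_beyond in H by lra. lra.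
- apply continuous_cap_slope.
- intros t ht. lra.
- intros t ht. apply cap_slope_beyond. lra.
Qed.

(** * The smoothed kernel *)

(** This is the substitution [w = cos t], done by checking that [RInt (cap n) 0 w - X (acos w)] has
    zero derivative inside [(0, 1)] and is continuous up to [1], where [acos] has no derivative. *)
Lemma cap_integral_primitive (n : nat) (X : R -> R) :
  (forall t : R, is_derive X t (- (sin t * sin ((2 * INR n + 1) * t)))) ->
  RInt (cap n) 0 1 = X 0 - X (PI / 2) :> R.
Proof.
intros DX.
assert (DI := fun x => is_derive_RInt_cont (cap n) 0 x (continuous_cap n)).
assert (H := constant_on_unit (fun w => RInt (cap n) 0 w - X (acos (Rabs w)))).
assert (e : RInt (cap n) 0 1 - X (acos (Rabs 1)) = RInt (cap n) 0 0 - X (acos (Rabs 0))).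
{ apply H; [| |lra].
  - intros w _. apply (continuous_minus (V := R_NormedModule) (RInt (cap n) 0)).
    + apply continuous_of_ex_derive. eexists. apply DI.
    + apply (continuous_comp (fun w => acos (Rabs w)) X); [apply continuous_acos_abs|].
      apply continuous_of_ex_derive. eexists. apply DX.
  - intros x hx.
    assert (hs : 0 < sqrt (1 - x ^ 2)) by (apply sqrt_lt_R0; nra).
    apply (is_derive_ext_loc (fun w => RInt (cap n) 0 w - X (acos w))).
    + generalize (open_gt 0 x (proj1 hx)). apply filter_imp. intros t ht.
      rewrite Rabs_pos_eq by lra. reflexivity.
    + assert (Da := is_derive_acos x ltac:(lra)). specialize (DI x).
      revert DI. generalize (RInt (cap n) 0). intros g DI. specialize (DX (acos x)).
      auto_derive.
      * repeat split; eexists; [exact DI|exact DX|exact Da].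
      * rewrite (Derive_of_is_derive _ _ _ Da), (Derive_of_is_derive _ _ _ DX),
          (Derive_of_is_derive _ _ _ DI), cap_sin by lra.
        rewrite sin_acos by lra. replace (x²) with (x ^ 2) by (unfold Rsqr; ring).
        field. lra. }
rewrite RInt_point, Rabs_R1, Rabs_R0, acos_0, acos_1 in e. unfold zero in e; simpl in e.
lra.
Qed.

(** In the variable [t] this is the pairing of [sin t] with [sin ((2 n + 1) t)] on [[0, PI / 2]].
    Their orthogonality for [n > 0] is why the [gamma] term occurs only in weight 2. *)
Lemma cap_integral (n : nat) :
  RInt (cap n) 0 1 = (if Nat.eqb n 0 then PI / 4 else 0) :> R.
Proof.
destruct n as [|n].
- rewrite (cap_integral_primitive 0 (fun t => - (t / 2 - sin (2 * t) / 4))).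
  + simpl. replace (2 * (PI / 2)) with PI by field.
    rewrite sin_PI, Rmult_0_r, sin_0. field.
  + intros t. auto_derive; [exact I|]. simpl.
    replace ((2 * 0 + 1) * t) with t by ring. rewrite cos_2a_sin. field.
- rewrite (cap_integral_primitive (S n) (fun t =>
    - (sin (2 * INR (S n) * t) / (4 * INR (S n))
       - sin (2 * (INR (S n) + 1) * t) / (4 * (INR (S n) + 1))))).
  + cbn [Nat.eqb]. rewrite !Rmult_0_r, sin_0.
    replace (2 * INR (S n) * (PI / 2)) with (INR (S n) * PI) by field.
    replace (2 * (INR (S n) + 1) * (PI / 2)) with (INR (S (S n)) * PI)
      by (rewrite (S_INR (S n)); field).
    rewrite !sin_INR_PI. unfold Rdiv. ring.
  + intros t. assert (hn : 0 < INR (S n)) by (apply lt_0_INR; lia).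
    revert hn. generalize (INR (S n)). intros q hq.
    auto_derive; [exact I|].
    set (s := (2 * q + 1) * t).
    replace (2 * q * t) with (s - t) by (unfold s; ring).
    replace (2 * (q + 1) * t) with (s + t) by (unfold s; ring).
    rewrite cos_minus, cos_plus. field. lra.
Qed.

Definition bump (lo hi : R) (phi : R -> R) : Prop :=
  smooth phi /\ (forall t, t <= lo -> phi t = 0) /\ (forall t, hi <= t -> phi t = 0).

Lemma bump_div (lo hi : R) (phi : R -> R) : 0 < lo ->
  bump lo hi phi -> bump lo hi (fun t => phi t / t).
Proof.
intros hlo [S [Z1 Z2]]. split; [|split].
- apply smooth_glue with lo; [easy| |].
  + intros x hx. rewrite Z1 by lra. unfold Rdiv. ring.
  + apply smooth_on_mult; [now apply smooth_restrict|]. exact derivable_upto_inv.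
- intros t ht. rewrite Z1 by easy. unfold Rdiv. ring.
- intros t ht. rewrite Z2 by easy. unfold Rdiv. ring.
Qed.

(** After the shift [t = x + s] the parameter sits in [phi] alone, so derivatives never touch the
    square root; for [x >= 0] the range [[0, hi]] covers the support. *)
Definition half_convolution (hi : R) (phi : R -> R) (x : R) : R :=
  RInt (fun s => phi (x + s) * sqrt s) 0 hi.

Lemma continuity_2d_shift (phi : R -> R) (x s : R) : (forall t, continuous phi t) ->
  continuity_2d_pt (fun u v => phi (u + v) * sqrt v) x s.
Proof.
intros Hc. apply continuity_2d_pt_mult.
- apply (continuity_1d_2d_pt_comp phi (fun u v => u + v)).
  + apply continuity_pt_filterlim, Hc.
  + apply continuity_2d_pt_plus; [apply continuity_2d_pt_id1|apply continuity_2d_pt_id2].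
- apply (continuity_1d_2d_pt_comp sqrt (fun _ v => v)).
  + apply continuity_pt_filterlim, continuous_sqrt.
  + apply continuity_2d_pt_id2.
Qed.

Lemma smooth_half_convolution (hi : R) (phi : R -> R) :
  smooth phi -> smooth (half_convolution hi phi).
Proof.
intros H n. revert phi H. induction n as [|n IH]; intros phi H; [exact I|].
destruct (smooth_derivative phi H) as [phi' [D H']].
exists (half_convolution hi phi'). split; [|now apply IH]. intros x _.
assert (E : forall u v, Derive (fun z => phi (z + v) * sqrt v) u = phi' (u + v) * sqrt v).
{ intros u v. apply is_derive_unique. auto_derive; [eexists; apply D|].
  rewrite (Derive_of_is_derive _ _ _ (D (u + v))). ring. }
unfold half_convolution.
rewrite (RInt_ext (fun s => phi' (x + s) * sqrt s)
  (fun s => Derive (fun z => phi (z + s) * sqrt s) x)).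
- apply (is_derive_RInt_param (fun x s => phi (x + s) * sqrt s) 0 hi x).
  + apply filter_forall. intros y t _. auto_derive. eexists. apply D.
  + intros t _. apply continuity_2d_pt_ext with (fun u v => phi' (u + v) * sqrt v).
    * intros u v. now rewrite E.
    * apply continuity_2d_shift. intros; now apply smooth_continuous.
  + apply filter_forall. intros y.
    apply (ex_RInt_continuous (V := R_CompleteNormedModule)). intros t _.
    apply (continuity_2d_continuous_snd (fun u v => phi (u + v) * sqrt v)).
    apply continuity_2d_shift. intros; now apply smooth_continuous.
- intros s _. now rewrite E.
Qed.

Lemma half_convolution_eq (lo hi : R) (phi : R -> R) (x : R) : 0 < lo -> lo <= hi ->
  bump lo hi phi -> 0 <= x ->
  is_RInt (fun t => phi t * sqrt (t - x)) lo hi (half_convolution hi phi x).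
Proof.
intros hlo hh [S [Z1 Z2]] hx.
set (f := fun t => phi t * sqrt (t - x)).
assert (Hc : forall t, continuous f t).
{ intros t. apply (continuous_mult (K := R_AbsRing) phi (fun t => sqrt (t - x))).
  - now apply smooth_continuous.
  - apply continuous_sqrt_comp. apply continuous_of_ex_derive. auto_derive. exact I. }
assert (ex : forall a b, ex_RInt f a b).
{ intros a b. apply (ex_RInt_continuous (V := R_CompleteNormedModule)). auto. }
assert (e : RInt f lo hi = half_convolution hi phi x).
{ rewrite <- (RInt_support f lo hi 0 (hi + x)); try lra; trivial.
  - rewrite (RInt_support f x (hi + x) 0 (hi + x)); try lra; trivial.
    + unfold half_convolution.
      pose proof (RInt_comp_lin f 1 x 0 hi (ex _ _)) as h.
      rewrite Rmult_0_r, Rplus_0_l, Rmult_1_l in h. rewrite <- h.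
      apply RInt_ext. intros s _. unfold f, scal; simpl; unfold mult; simpl.
      rewrite !Rmult_1_l. f_equal; f_equal; ring.
    + intros t ht. unfold f. rewrite sqrt_neg_0 by lra. ring.
    + intros t ht. lra.
  - intros t ht. unfold f. rewrite Z1 by lra. ring.
  - intros t ht. unfold f. rewrite Z2 by lra. ring. }
rewrite <- e. apply (RInt_correct (V := R_CompleteNormedModule)), ex.
Qed.

(* Expanding [V_n (x / t)] in powers of [x / t] reduces the integral to convolutions
   of [phi t / t^j] with the square root, whose derivatives fall on [phi]. *)
Lemma smooth_kernel (lo hi : R) : 0 < lo -> lo <= hi -> forall n phi, bump lo hi phi ->
  exists h, smooth h /\ forall x, 0 <= x ->
    is_RInt (fun t => phi t * (sqrt (t - x) * chebyshevV n (x / t))) lo hi (h x).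
Proof.
intros hlo hh. apply (chebyshevV_ind (fun n => forall phi, bump lo hi phi ->
  exists h, smooth h /\ forall x, 0 <= x ->
    is_RInt (fun t => phi t * (sqrt (t - x) * chebyshevV n (x / t))) lo hi (h x))).
- intros phi H. exists (half_convolution hi phi).
  split; [apply smooth_half_convolution, H|]. intros x hx.
  apply (is_RInt_ext (fun t => phi t * sqrt (t - x))).
  + intros t _. simpl. ring.
  + now apply half_convolution_eq.
- intros phi H. set (psi := fun t => phi t / t).
  assert (H' : bump lo hi psi) by now apply bump_div.
  exists (fun x => 4 * x * half_convolution hi psi x + (-1) * half_convolution hi phi x).
  split.
  + apply smooth_on_plus; apply smooth_on_mult; try apply smooth_on_const.
    * apply smooth_on_mult; [apply smooth_on_const|apply smooth_on_id].
    * apply smooth_half_convolution, H'.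
    * apply smooth_half_convolution, H.
  + intros x hx.
    apply (is_RInt_ext (fun t => 4 * x * (psi t * sqrt (t - x)) + (-1) * (phi t * sqrt (t - x)))).
    * intros t. rewrite Rmin_left by easy. intros ht. unfold psi. simpl.
      match goal with |- ?u = ?v => change (@eq R u v) end. field. lra.
    * apply (is_RInt_plus (V := R_NormedModule)); apply (is_RInt_scal (V := R_NormedModule));
        now apply half_convolution_eq.
- intros n IH1 IH2 phi H. set (psi := fun t => phi t / t).
  assert (H' : bump lo hi psi) by now apply bump_div.
  destruct (IH1 phi H) as [h0 [S0 I0]]. destruct (IH2 phi H) as [h1 [S1 I1]].
  destruct (IH2 psi H') as [h2 [S2 I2]].
  exists (fun x => 4 * x * h2 x + ((-2) * h1 x + (-1) * h0 x)). split.
  + apply smooth_on_plus; [|apply smooth_on_plus]; apply smooth_on_mult;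
      try apply smooth_on_const; trivial.
    apply smooth_on_mult; [apply smooth_on_const|apply smooth_on_id].
  + intros x hx.
    apply (is_RInt_ext (fun t => 4 * x * (psi t * (sqrt (t - x) * chebyshevV (S n) (x / t)))
      + ((-2) * (phi t * (sqrt (t - x) * chebyshevV (S n) (x / t)))
         + (-1) * (phi t * (sqrt (t - x) * chebyshevV n (x / t)))))).
    * intros t. rewrite Rmin_left by easy. intros ht. unfold psi.
      change (chebyshevV (S (S n)) (x / t)) with
        ((4 * (x / t) - 2) * chebyshevV (S n) (x / t) - chebyshevV n (x / t)).
      match goal with |- ?u = ?v => change (@eq R u v) end. field. lra.
    * apply (is_RInt_plus (V := R_NormedModule)); [|apply (is_RInt_plus (V := R_NormedModule))];
        apply (is_RInt_scal (V := R_NormedModule)); auto.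
Qed.

(** Where [x / sqrt t] is singular, [phi] vanishes identically. *)
Lemma continuity_2d_scaled (lo hi : R) (phi a g : R -> R) (x t : R) : 0 < lo ->
  bump lo hi phi -> (forall s, continuous a s) -> (forall s, continuous g s) ->
  continuity_2d_pt (fun x t => phi t * (a t * g (x / sqrt t))) x t.
Proof.
intros hlo [S [Z1 Z2]] Ha Hg. destruct (Rlt_dec t lo) as [h|h].
- apply continuity_2d_pt_ext_loc with (fun _ _ => 0); [|apply continuity_2d_pt_const].
  assert (hd : 0 < lo - t) by lra. exists (mkposreal _ hd). simpl.
  intros u v _ hv. apply Rabs_def2 in hv. rewrite Z1 by lra. ring.
- assert (hs : 0 < sqrt t) by (apply sqrt_lt_R0; lra).
  assert (C1 : forall k : R -> R, (forall s, continuous k s) ->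
            continuity_2d_pt (fun _ v => k v) x t).
  { intros k Hk. apply (continuity_1d_2d_pt_comp k (fun _ v => v)).
    - apply continuity_pt_filterlim, Hk.
    - apply continuity_2d_pt_id2. }
  apply continuity_2d_pt_mult; [apply C1; intros; now apply smooth_continuous|].
  apply continuity_2d_pt_mult; [now apply C1|].
  apply (continuity_1d_2d_pt_comp g (fun u v => u / sqrt v));
    [apply continuity_pt_filterlim, Hg|].
  apply (continuity_2d_pt_mult (fun u _ => u) (fun _ v => / sqrt v));
    [apply continuity_2d_pt_id1|].
  apply (continuity_2d_pt_inv (fun _ v => sqrt v)); [|lra].
  apply C1, continuous_sqrt.
Qed.

Lemma RInt_dilate (g : R -> R) (s X : R) : 0 < s -> (forall t, continuous g t) ->
  RInt (fun x => g (x / s)) 0 X = s * RInt g 0 (X / s) :> R.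
Proof.
intros hs Hg.
assert (ex : ex_RInt g (/ s * 0 + 0) (/ s * X + 0)).
{ apply (ex_RInt_continuous (V := R_CompleteNormedModule)). auto. }
pose proof (RInt_comp_lin g (/ s) 0 0 X ex) as e.
replace (/ s * 0 + 0) with 0 in e by ring.
replace (/ s * X + 0) with (X / s) in e by (field; lra).
rewrite <- e. rewrite RInt_scal.
- unfold scal; simpl; unfold mult; simpl. rewrite <- Rmult_assoc, Rinv_r, Rmult_1_l by lra.
  apply RInt_ext. intros x _. f_equal. field. lra.
- apply (ex_RInt_continuous (V := R_CompleteNormedModule)). intros z _.
  apply (continuous_comp (fun y => / s * y + 0) g); [|apply Hg].
  apply continuous_of_ex_derive. auto_derive. exact I.
Qed.

(* [v D(v)] equals the primitive [I] of [D], so [I / v] is constant. *)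
Lemma zero_of_averaging_identity (D : R -> R) (L : R) : 0 < L ->
  (forall v, continuous D v) -> (forall v, 0 <= v -> v * D v = RInt D 0 v) ->
  D L = 0 -> D 0 = 0.
Proof.
intros hL Hc Hi HL.
assert (DI := fun x => is_derive_RInt_cont D 0 x Hc).
assert (Hz : forall v, 0 < v < L -> D v = 0).
{ intros v hv.
  destruct (MVT_gen (fun x => RInt D 0 x / x) v L (fun _ => 0)) as [x [_ e]].
  - rewrite Rmin_left, Rmax_right by lra. intros x hx. specialize (DI x).
    assert (e := Hi x ltac:(lra)).
    revert DI e. generalize (RInt D 0). intros g DI e.
    auto_derive; [split; [now exists (D x)|]; split; [lra|exact I]|].
    rewrite (Derive_of_is_derive _ _ _ DI), <- e. field. lra.
  - rewrite Rmin_left, Rmax_right by lra. intros x hx. apply continuity_pt_of_ex_derive.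
    specialize (DI x). revert DI. generalize (RInt D 0). intros g DI.
    auto_derive. split; [now exists (D x)|]. split; [lra|exact I].
  - rewrite <- !Hi, HL in e by lra.
    replace (D v) with (v * D v / v) by (field; lra). lra. }
destruct (Req_dec (D 0) 0) as [e|ne]; [exact e|exfalso].
assert (he : 0 < Rabs (D 0)) by now apply Rabs_pos_lt.
destruct (Hc 0 (ball (D 0) (mkposreal _ he)) (locally_ball _ _)) as [d Hd].
pose proof (cond_pos d) as hd. set (s := Rmin (d / 2) (L / 2)).
assert (hs : 0 < s) by (apply Rmin_pos; lra).
assert (hs1 : s <= d / 2) by apply Rmin_l. assert (hs2 : s <= L / 2) by apply Rmin_r.
assert (b : ball 0 d s).
{ change (Rabs (s - 0) < d). rewrite Rabs_pos_eq; lra. }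
specialize (Hd s b). change (Rabs (D s - D 0) < Rabs (D 0)) in Hd.
rewrite Hz in Hd by lra. rewrite Rminus_0_l, Rabs_Ropp in Hd. lra.
Qed.

(** * The smoothed profile [H] and its integrals *)

Section Profile.

Variables (lo hi : R) (n : nat) (phi : R -> R).
Hypothesis hlo : 0 < lo.
Hypothesis hh : lo <= hi.
Hypothesis Hphi : bump lo hi phi.

(** Chosen so that [L >= sqrt t] for [t < hi] without a case distinction on [hi]. *)
Let L := 1 + hi.

Local Lemma ratio_beyond (t x : R) : lo < t < hi -> L <= x -> 1 <= x / sqrt t.
Proof.
intros ht hx. assert (hs : 0 < sqrt t) by (apply sqrt_lt_R0; lra).
assert (e : sqrt t * sqrt t = t) by (apply sqrt_sqrt; lra).
apply Rmult_le_reg_r with (sqrt t); [easy|].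
unfold Rdiv. rewrite Rmult_assoc, Rinv_l by lra. unfold L in hx. nra.
Qed.

Local Lemma kernel_cap (t x : R) : 0 < t ->
  sqrt (t - x ^ 2) * chebyshevV n (x ^ 2 / t) = sqrt t * cap n (x / sqrt t).
Proof.
intros ht. assert (hs : 0 < sqrt t) by (apply sqrt_lt_R0; lra).
assert (e : (x / sqrt t) ^ 2 = x ^ 2 / t).
{ unfold Rdiv. rewrite Rpow_mult_distr, pow_inv, pow2_sqrt by lra. reflexivity. }
unfold cap. rewrite e, <- Rmult_assoc. f_equal.
rewrite <- sqrt_mult_alt by lra. f_equal. field. lra.
Qed.

Lemma kernel_profile : exists H h1, smooth H /\ smooth h1 /\
  (forall v, is_derive H v (v * h1 v)) /\ (forall v, L <= v -> H v = 0) /\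
  (forall x, is_RInt (fun t => phi t * (sqrt (t - x ^ 2) * chebyshevV n (x ^ 2 / t)))
               lo hi (H x)) /\
  RInt H 0 L = (if Nat.eqb n 0 then PI / 4 else 0) * RInt (fun t => phi t * t) lo hi /\
  RInt h1 0 L = - ((2 * INR n + 1) * (-1) ^ n * (PI / 2)) * RInt phi lo hi /\
  H 0 = (-1) ^ n * RInt (fun t => phi t * sqrt t) lo hi.
Proof.
destruct (smooth_kernel lo hi hlo hh n phi Hphi) as [h [Sh Ih]].
destruct (smooth_derivative h Sh) as [h' [Dh Sh']].
set (H := fun x => h (x ^ 2)). set (h1 := fun x => 2 * h' (x ^ 2)).
assert (Ssq : smooth (fun x : R => x ^ 2)).
{ apply smooth_ext with (fun x => x * x); [intros x; ring|].
  apply smooth_on_mult; apply smooth_on_id. }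
assert (SH : smooth H).
{ intros m. apply (derivable_upto_comp _ (fun _ => True) m h); [easy|apply Sh|apply Ssq]. }
assert (Sh1 : smooth h1).
{ apply smooth_on_mult; [apply smooth_on_const|]. intros m.
  apply (derivable_upto_comp _ (fun _ => True) m h'); [easy|apply Sh'|apply Ssq]. }
assert (DH : forall v, is_derive H v (v * h1 v)).
{ intros v. unfold H. auto_derive; [eexists; apply Dh|].
  rewrite (Derive_of_is_derive _ _ _ (Dh _)). unfold h1. simpl. ring. }
assert (IH : forall x, is_RInt (fun t => phi t
    * (sqrt (t - x ^ 2) * chebyshevV n (x ^ 2 / t))) lo hi (H x)).
{ intros x. apply Ih. apply pow2_ge_0. }
set (f1 := fun x t => phi t * (sqrt t * cap n (x / sqrt t))).
set (f2 := fun x t => phi t * (1 * cap_slope n (x / sqrt t))).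
assert (C1 : forall x t, continuity_2d_pt f1 x t).
{ intros x t. apply (continuity_2d_scaled lo hi); trivial;
    [apply continuous_sqrt|apply continuous_cap]. }
assert (C2 : forall x t, continuity_2d_pt f2 x t).
{ intros x t. apply (continuity_2d_scaled lo hi phi (fun _ => 1)); trivial.
  - intros s. apply continuous_const.
  - apply continuous_cap_slope. }
assert (EH : forall x, H x = RInt (f1 x) lo hi).
{ intros x. symmetry. apply is_RInt_unique.
  apply (is_RInt_ext (fun t => phi t * (sqrt (t - x ^ 2) * chebyshevV n (x ^ 2 / t))));
    [|apply IH].
  intros t. rewrite Rmin_left by easy. intros ht. unfold f1.
  rewrite kernel_cap by lra. reflexivity. }
assert (zero_int : forall f : R -> R, (forall t, lo < t < hi -> f t = 0) -> RInt f lo hi = 0).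
{ intros f Hf. rewrite (RInt_ext f (fun _ => 0)).
  - rewrite RInt_const. apply Rmult_0_r.
  - rewrite Rmin_left, Rmax_right by easy. exact Hf. }
assert (Hz : forall v, L <= v -> H v = 0).
{ intros v hv. rewrite EH. apply zero_int. intros t ht. unfold f1.
  rewrite cap_beyond; [ring|]. now apply ratio_beyond. }
assert (hL : 0 < L) by (unfold L; lra).
assert (exc : forall f : R -> R, (forall t, continuous f t) -> ex_RInt f lo hi).
{ intros f Hf. apply (ex_RInt_continuous (V := R_CompleteNormedModule)). auto. }
assert (Cphi : forall t, continuous phi t).
{ intros; apply smooth_continuous, Hphi. }
assert (scalR : forall (k : R) (f : R -> R), (forall t, continuous f t) ->
  RInt (fun t => k * f t) lo hi = k * RInt f lo hi :> R).
{ intros k f Hf. apply (RInt_scal (V := R_CompleteNormedModule)). now apply exc. }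
assert (Cmul : forall f g : R -> R, (forall t, continuous f t) ->
  (forall t, continuous g t) -> forall t, continuous (fun t => f t * g t) t).
{ intros f g Hf Hg t. now apply (continuous_mult (K := R_AbsRing) f g). }
exists H, h1. do 5 (split; [assumption|]). split; [|split].
- rewrite (RInt_ext H (fun x => RInt (f1 x) lo hi)) by (intros; apply EH).
  rewrite RInt_exchange by exact C1. rewrite <- cap_integral, <- scalR.
  + apply RInt_ext. intros t. rewrite Rmin_left, Rmax_right by easy. intros ht.
    assert (hs : 0 < sqrt t) by (apply sqrt_lt_R0; lra). unfold f1.
    rewrite (RInt_ext _ (fun x => (phi t * sqrt t) * cap n (x / sqrt t)))
      by (intros; apply eq_sym, Rmult_assoc).
    rewrite (RInt_scal (V := R_CompleteNormedModule)).
    * rewrite RInt_dilate by (try exact (continuous_cap n); easy).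
      rewrite (RInt_support (cap n) 0 1 0 (L / sqrt t)); try lra.
      -- unfold scal; simpl; unfold mult; simpl.
         match goal with |- ?u = ?v => change (@eq R u v) end.
         replace (phi t * sqrt t * (sqrt t * RInt (cap n) 0 1))
           with (phi t * (sqrt t * sqrt t) * RInt (cap n) 0 1) by ring.
         rewrite sqrt_sqrt by lra. ring.
      -- apply ratio_beyond; [easy|lra].
      -- apply continuous_cap.
      -- intros s hs'. lra.
      -- intros s hs'. apply cap_beyond. lra.
    * apply (ex_RInt_continuous (V := R_CompleteNormedModule)). intros z _.
      apply (continuous_comp (fun x => x / sqrt t) (cap n)); [|apply continuous_cap].
      apply continuous_of_ex_derive. auto_derive. exact I.
  + apply Cmul; [exact Cphi|]. intros t. apply continuous_id.
- set (Psi := fun v => RInt (f2 v) lo hi).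
  assert (CPsi : forall v, continuous Psi v).
  { intros v. now apply continuous_RInt_param. }
  destruct (smooth_antiderivative h1 0 Sh1) as [SI DI].
  set (kappa := RInt h1 0 L : R). set (b1 := fun v => kappa - RInt h1 0 v).
  assert (Cb1 : forall v, continuous b1 v).
  { intros v. apply (continuous_minus (V := R_NormedModule) (fun _ => kappa) (RInt h1 0)).
    - apply continuous_const.
    - apply smooth_continuous, SI. }
  assert (R1 : forall v, 0 <= v -> H v = H 0 - v * Psi v + RInt Psi 0 v).
  { intros v hv. unfold Psi at 2. rewrite RInt_exchange by exact C2.
    rewrite !EH.
    (* Pointwise in [t] this is [cap_slope_relation] at [v / sqrt t], multiplied by
       [phi t * sqrt t]. *)
    assert (e : RInt (f1 v) lo hi = RInt (fun t => f1 0 t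
      + ((- v) * f2 v t + RInt (fun x => f2 x t) 0 v)) lo hi).
    { apply RInt_ext. intros t. rewrite Rmin_left, Rmax_right by easy. intros ht.
      assert (hs : 0 < sqrt t) by (apply sqrt_lt_R0; lra). unfold f1, f2.
      rewrite (RInt_ext _ (fun x => phi t * cap_slope n (x / sqrt t)))
        by (intros; now rewrite Rmult_1_l).
      rewrite (RInt_scal (V := R_CompleteNormedModule)).
      - rewrite RInt_dilate by (try exact (continuous_cap_slope n); easy).
        assert (hq : 0 <= v / sqrt t) by (apply Rdiv_le_0_compat; lra).
        rewrite (cap_slope_relation n (v / sqrt t) hq).
        replace (0 / sqrt t) with 0 by (field; lra).
        unfold scal; simpl; unfold mult; simpl.
        match goal with |- ?u = ?v => change (@eq R u v) end. field. lra.
      - apply (ex_RInt_continuous (V := R_CompleteNormedModule)). intros z _.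
        apply (continuous_comp (fun x => x / sqrt t) (cap_slope n));
          [|apply continuous_cap_slope].
        apply continuous_of_ex_derive. auto_derive. exact I. }
    rewrite e.
    assert (c1 : forall t, continuous (f1 0) t)
      by (intros t; now apply continuity_2d_continuous_snd).
    assert (c2 : forall t, continuous (fun t => - v * f2 v t) t).
    { apply Cmul; [intros; apply continuous_const|].
      intros t; now apply continuity_2d_continuous_snd. }
    assert (c3 : forall t, continuous (fun t => RInt (fun x => f2 x t) 0 v) t).
    { intros t. apply (continuous_RInt_param (fun t x => f2 x t)).
      intros x s. now apply continuity_2d_pt_swap. }
    rewrite (RInt_plus (V := R_CompleteNormedModule)).
    - rewrite (RInt_plus (V := R_CompleteNormedModule)) by now apply exc.
      rewrite scalR by (intros t; now apply continuity_2d_continuous_snd).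
      unfold plus; simpl. fold (Psi v).
      match goal with |- ?u = ?v => change (@eq R u v) end. ring.
    - now apply exc.
    - apply exc. intros t. apply (continuous_plus (V := R_NormedModule)); auto. }
  assert (R2 : forall v, H v = H 0 - v * b1 v + RInt b1 0 v).
  { intros v.
    set (g := fun v => H v + v * b1 v - RInt b1 0 v).
    assert (e : 0 = g v - g 0).
    { rewrite <- (RInt_of_derivative g (fun _ => 0) 0 v).
      - rewrite RInt_const. symmetry. apply Rmult_0_r.
      - intros x. unfold g. assert (DB := is_derive_RInt_cont b1 0 x Cb1).
        assert (Db1 : is_derive b1 x (- h1 x)).
        { unfold b1. specialize (DI x). revert DI. generalize (RInt h1 0). intros k DI.
          auto_derive; [now exists (h1 x)|].
          rewrite (Derive_of_is_derive _ _ _ DI). ring. }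
        revert DB. generalize (RInt b1 0). intros k DB.
        auto_derive.
        + split; [exists (x * h1 x); apply DH|]. split; [now exists (- h1 x)|].
          split; [now exists (b1 x)|exact I].
        + rewrite (Derive_of_is_derive _ _ _ DB), (Derive_of_is_derive _ _ _ Db1),
            (Derive_of_is_derive _ _ _ (DH x)). ring.
      - intros x. apply continuous_const. }
    unfold g in e. rewrite (RInt_point 0 b1) in e. unfold zero in e; simpl in e. lra. }
  assert (z : Psi 0 - b1 0 = 0).
  { apply (zero_of_averaging_identity (fun v => Psi v - b1 v) L hL).
    - intros v. now apply (continuous_minus (V := R_NormedModule) Psi b1).
    - intros v hv. rewrite (RInt_minus (V := R_CompleteNormedModule) Psi b1);
        try (apply (ex_RInt_continuous (V := R_CompleteNormedModule)); auto).
      specialize (R1 v hv). specialize (R2 v).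
      unfold minus, plus, opp; simpl.
      match goal with |- ?u = ?v => change (@eq R u v) end. lra.
    - unfold b1. fold kappa. unfold Psi. rewrite zero_int; [ring|].
      intros t ht. unfold f2. rewrite cap_slope_beyond; [ring|].
      apply ratio_beyond; [easy|lra]. }
  assert (e0 : b1 0 = kappa).
  { unfold b1. rewrite (RInt_point 0 h1). unfold zero; simpl. ring. }
  assert (e1 : Psi 0 = - ((2 * INR n + 1) * (-1) ^ n * (PI / 2)) * RInt phi lo hi).
  { unfold Psi. rewrite <- cap_slope_0, <- scalR by exact Cphi. apply RInt_ext.
    intros t. rewrite Rmin_left, Rmax_right by easy. intros ht. unfold f2.
    assert (hs : 0 < sqrt t) by (apply sqrt_lt_R0; lra).
    replace (0 / sqrt t) with 0 by (field; lra).
    match goal with |- ?u = ?v => change (@eq R u v) end. ring. }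
  rewrite <- e1. lra.
- rewrite EH, <- cap_0, <- scalR.
  + apply RInt_ext. intros t. rewrite Rmin_left, Rmax_right by easy. intros ht. unfold f1.
    assert (hs : 0 < sqrt t) by (apply sqrt_lt_R0; lra).
    replace (0 / sqrt t) with 0 by (field; lra).
    match goal with |- ?u = ?v => change (@eq R u v) end. ring.
  + apply Cmul; [exact Cphi|apply continuous_sqrt].
Qed.

End Profile.

(** * The smoothed murmuration function *)

Lemma sum_n_m_from_1 (f : nat -> R) (Z M : nat) : (Z <= S M)%nat ->
  (forall r, (Z < r)%nat -> f r = 0) ->
  sum_n_m f 1 Z = sum_n (fun r => f (S r)) M :> R.
Proof.
intros hZ Hf. unfold sum_n. rewrite sum_n_m_S.
rewrite (sum_n_m_Chasles f 1 Z (S M)) by lia.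
rewrite (sum_n_m_ext_loc f (fun _ => zero) (S Z) (S M)).
- rewrite sum_n_m_const_zero. unfold plus, zero; simpl. symmetry. apply Rplus_0_r.
- intros r hr. apply Hf. lia.
Qed.

Lemma sum_n_scal_l (c : R) (f : nat -> R) (M : nat) :
  sum_n (fun r => c * f r) M = c * sum_n f M :> R.
Proof. exact (sum_n_mult_l (K := R_Ring) c f M). Qed.

Lemma Int_part_index (z : R) : 0 <= z ->
  INR (Z.to_nat (Int_part z)) <= z /\
  forall r, (Z.to_nat (Int_part z) < r)%nat -> z < INR r.
Proof.
intros hz. destruct (base_Int_part z) as [h1 h2].
assert (h0 : (0 <= Int_part z)%Z).
{ assert (h : IZR (-1) < IZR (Int_part z)) by lra. apply lt_IZR in h. lia. }
assert (e : INR (Z.to_nat (Int_part z)) = IZR (Int_part z)).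
{ rewrite INR_IZR_INZ, Z2Nat.id by easy. reflexivity. }
split; [lra|]. intros r hr. assert (h : INR (S (Z.to_nat (Int_part z))) <= INR r)
  by (apply le_INR; lia). rewrite S_INR in h. lra.
Qed.

(** The range of the sum in [murm] depends on [u]. As [sqrt] vanishes on negative numbers, it may be
    extended to any larger [M], which then serves all [u] at once and allows integration term by
    term. *)
Lemma murm_explicit (n M : nat) (y u : R) : 0 < y -> 0 < u ->
  2 * sqrt (y / u) <= INR (S M) ->
  murm (2 * n + 2) (y / u)
  = alpha * (-1) ^ n / (2 * INR n + 1) * (2 * sqrt y)
      * sum_n (fun r => nu (S r) * (sqrt (/ u - (INR (S r) * / (2 * sqrt y)) ^ 2)
           * chebyshevV n ((INR (S r) * / (2 * sqrt y)) ^ 2 / / u))) M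
    + beta / (2 * INR n + 1) * sqrt y * sqrt (/ u)
    - gamma * (if Nat.eqb n 0 then 1 else 0) * y * / u.
Proof.
intros hy hu hM. unfold murm.
assert (hyu : 0 < y / u) by (apply Rdiv_lt_0_compat; easy).
destruct (Rlt_dec 0 (y / u)) as [_|]; [|easy].
replace (2 * n + 2 - 2)%nat with (2 * n)%nat by lia.
replace ((2 * n + 2) / 2 - 1)%nat with n.
2: { replace (2 * n + 2)%nat with ((n + 1) * 2)%nat by lia. rewrite Nat.div_mul; lia. }
replace (INR (2 * n + 2) - 1) with (2 * INR n + 1)
  by (rewrite plus_INR, mult_INR; simpl (INR 2); ring).
replace (Nat.eqb (2 * n + 2) 2) with (Nat.eqb n 0) by (destruct n; simpl; [easy|];
  symmetry; apply Nat.eqb_neq; lia).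
assert (hsy : 0 < sqrt y) by now apply sqrt_lt_R0.
assert (hsyu : 0 < sqrt (y / u)) by now apply sqrt_lt_R0.
assert (hr0 : forall r, 0 <= INR r) by apply pos_INR.
destruct (Int_part_index (2 * sqrt (y / u))) as [h1 h2]; [lra|].
rewrite (sum_n_m_from_1 _ _ M).
- assert (es : sqrt (y / u) = sqrt y * sqrt (/ u)).
  { unfold Rdiv. apply sqrt_mult_alt. lra. }
  rewrite (sum_n_ext (fun r => nu (S r) * sqrt (4 * (y / u) - INR (S r) ^ 2)
      * chebyshevU (2 * n) (INR (S r) / (2 * sqrt (y / u))))
    (fun r => (2 * sqrt y) * (nu (S r) * (sqrt (/ u - (INR (S r) * / (2 * sqrt y)) ^ 2)
           * chebyshevV n ((INR (S r) * / (2 * sqrt y)) ^ 2 / / u))))).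
  + rewrite es, sum_n_scal_l. unfold Rdiv. ring.
  + intros r. rewrite chebyshevU_even.
    assert (e1 : (INR (S r) / (2 * sqrt (y / u))) ^ 2
               = (INR (S r) * / (2 * sqrt y)) ^ 2 / / u).
    { replace ((INR (S r) / (2 * sqrt (y / u))) ^ 2)
        with (INR (S r) ^ 2 / (4 * sqrt (y / u) ^ 2)) by (field; lra).
      replace ((INR (S r) * / (2 * sqrt y)) ^ 2)
        with (INR (S r) ^ 2 / (4 * sqrt y ^ 2)) by (field; lra).
      rewrite !pow2_sqrt by lra. field. lra. }
    assert (e2 : sqrt (4 * (y / u) - INR (S r) ^ 2)
        = 2 * sqrt y * sqrt (/ u - (INR (S r) * / (2 * sqrt y)) ^ 2)).
    { replace (2 * sqrt y) with (sqrt (4 * y)) at 1.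
      - rewrite <- sqrt_mult_alt by lra. f_equal.
        replace ((INR (S r) * / (2 * sqrt y)) ^ 2)
          with (INR (S r) ^ 2 / (4 * sqrt y ^ 2)) by (field; lra).
        rewrite pow2_sqrt by lra. field. lra.
      - rewrite sqrt_mult_alt by lra. f_equal.
        replace 4 with (2 ^ 2) by ring. apply sqrt_pow2. lra. }
    rewrite e1, e2. match goal with |- ?u = ?v => change (@eq R u v) end. ring.
- apply INR_le. lra.
- intros r hr. apply h2 in hr.
  rewrite (sqrt_neg_0 (4 * (y / u) - INR r ^ 2)); [ring|].
  assert (e : sqrt (y / u) * sqrt (y / u) = y / u) by (apply sqrt_sqrt; lra). nra.
Qed.

Lemma is_RInt_sum_n (f : nat -> R -> R) (l : nat -> R) (a b : R) (M : nat) :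
  (forall r, is_RInt (f r) a b (l r)) ->
  is_RInt (fun u => sum_n (fun r => f r u) M) a b (sum_n l M).
Proof.
intros H. induction M as [|M IH].
- rewrite sum_O. apply (is_RInt_ext (f 0%nat)); [|apply H].
  intros u _. symmetry. apply (sum_O (fun r => f r u)).
- rewrite sum_Sn.
  apply (is_RInt_ext (fun u => plus (sum_n (fun r => f r u) M) (f (S M) u))).
  + intros u _. symmetry. apply (sum_Sn (fun r => f r u)).
  + now apply (is_RInt_plus (V := R_NormedModule)).
Qed.

Section RealAverage.

Variables (n : nat) (F : R -> R) (a b : R).
Hypothesis ha : 0 < a.
Hypothesis hab : a <= b.
Hypothesis SF : smooth_on (fun u => 0 < u) F.
Hypothesis ZF : forall u, 0 < u -> F u <> 0 -> a <= u <= b.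

(** Widening [[a, b]] strictly makes the inverted weight vanish at and beyond the end points [/ B]
    and [/ A], as [bump] asks, and gives [A < B] even if [a = b]. *)
Let A := a / 2.
Let B := b + 1.

(** The density [F u * u] in the variable [t = / u]: the Jacobian [t^-2] joins the factor [u = / t].
    The value [0] for [t <= 0] is the one that glues smoothly. *)
Definition inverted_weight (t : R) : R :=
  if Rlt_dec 0 t then F (/ t) * (/ t * (/ t * / t)) else 0.

Let phi := inverted_weight.

Local Lemma F_zero (u : R) : 0 < u -> u < a \/ b < u -> F u = 0.
Proof.
intros hu h. destruct (Req_dec (F u) 0) as [e|ne]; [exact e|].
apply ZF in ne; [lra|easy].
Qed.

Local Lemma AB_pos : 0 < A /\ A < B /\ 0 < / B /\ / B <= / A.
Proof.
unfold A, B. repeat split; try lra.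
- apply Rinv_0_lt_compat. lra.
- apply Rinv_le_contravar; lra.
Qed.

Local Lemma bump_phi : bump (/ B) (/ A) phi.
Proof.
destruct AB_pos as [h1 [h2 [h3 h4]]].
assert (Z1 : forall t, t <= / B -> phi t = 0).
{ intros t ht. unfold phi, inverted_weight. destruct (Rlt_dec 0 t) as [h|h]; [|easy].
  rewrite F_zero; [ring|now apply Rinv_0_lt_compat|]. right.
  apply Rlt_le_trans with B; [unfold B; lra|].
  rewrite <- (Rinv_inv B). now apply Rinv_le_contravar. }
split; [|split].
- apply smooth_glue with (/ B); [easy|intros x hx; apply Z1; lra|].
  apply smooth_on_ext with (fun t => F (/ t) * (/ t * (/ t * / t))).
  + apply open_gt.
  + intros x hx. unfold phi, inverted_weight. now destruct (Rlt_dec 0 x).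
  + apply smooth_on_mult.
    * intros m. apply (derivable_upto_comp _ (fun u => 0 < u) m F Rinv).
      -- intros x hx. now apply Rinv_0_lt_compat.
      -- apply SF.
      -- apply derivable_upto_inv.
    * apply smooth_on_mult; [|apply smooth_on_mult]; exact derivable_upto_inv.
- exact Z1.
- intros t ht. unfold phi, inverted_weight. destruct (Rlt_dec 0 t) as [h|h]; [|easy].
  rewrite F_zero; [ring|now apply Rinv_0_lt_compat|]. left.
  apply Rle_lt_trans with A; [|unfold A; lra].
  rewrite <- (Rinv_inv A). apply Rinv_le_contravar; [|easy].
  now apply Rinv_0_lt_compat.
Qed.

Local Lemma substitution (K : R -> R) : (forall t, 0 < t -> continuous K t) ->
  is_RInt (fun u => F u * u * K (/ u)) A B (RInt (fun t => phi t * K t) (/ B) (/ A)).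
Proof.
intros HK. destruct AB_pos as [h1 [h2 [h3 h4]]].
assert (Hc : forall t, 0 < t -> continuous (fun t => phi t * K t) t).
{ intros t ht. apply (continuous_mult (K := R_AbsRing) phi K); [|auto].
  apply smooth_continuous, bump_phi. }
pose proof (is_RInt_comp (V := R_CompleteNormedModule) (fun t => phi t * K t)
  Rinv (fun u => - (/ u * / u)) A B) as H.
rewrite Rmin_left, Rmax_right in H by lra.
assert (H' := H (fun x hx => Hc (/ x) (Rinv_0_lt_compat x ltac:(lra)))). clear H.
assert (e : opp (RInt (fun t => phi t * K t) (/ A) (/ B))
          = RInt (fun t => phi t * K t) (/ B) (/ A)).
{ apply (opp_RInt_swap (V := R_CompleteNormedModule)).
  apply (ex_RInt_continuous (V := R_CompleteNormedModule)).
  rewrite Rmin_right, Rmax_left by easy. intros z hz. apply Hc. lra. }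
rewrite <- e.
apply (is_RInt_ext (fun u => opp (scal (- (/ u * / u)) (phi (/ u) * K (/ u))))).
- rewrite Rmin_left, Rmax_right by lra. intros u hu.
  unfold opp, scal; simpl; unfold mult; simpl. unfold phi, inverted_weight.
  destruct (Rlt_dec 0 (/ u)) as [h|h].
  + rewrite Rinv_inv. match goal with |- ?u = ?v => change (@eq R u v) end.
    field. lra.
  + exfalso. apply h, Rinv_0_lt_compat. lra.
- apply (is_RInt_opp (V := R_NormedModule)). apply H'. intros x hx. split.
  + auto_derive; [lra|]. field. lra.
  + apply continuous_of_ex_derive. auto_derive. lra.
Qed.

Let Ihalf : R := RInt (fun t => phi t * sqrt t) (/ B) (/ A).
Let Ione : R := RInt (fun t => phi t * t) (/ B) (/ A).

Lemma RInt_weight :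
  is_RInt (fun u => F u * u) A B (RInt phi (/ B) (/ A)).
Proof.
pose proof (substitution (fun _ => 1)) as H.
rewrite (RInt_ext phi (fun t => phi t * 1)) by (intros; symmetry; apply Rmult_1_r).
apply (is_RInt_ext (fun u => F u * u * 1)); [intros; apply Rmult_1_r|].
apply H. intros t _. apply continuous_const.
Qed.

Local Lemma murm_integral (H : R -> R) (M : nat) (y : R) : 0 < y ->
  (forall x, is_RInt (fun t => phi t * (sqrt (t - x ^ 2) * chebyshevV n (x ^ 2 / t)))
               (/ B) (/ A) (H x)) ->
  2 * sqrt (y / A) <= INR (S M) ->
  is_RInt (fun u => murm (2 * n + 2) (y / u) * (F u * u)) A B
    (alpha * (-1) ^ n / (2 * INR n + 1) * (2 * sqrt y)
       * sum_n (fun r => nu (S r) * H (INR (S r) * / (2 * sqrt y))) M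
     + (beta / (2 * INR n + 1) * sqrt y * Ihalf
        + - (gamma * (if Nat.eqb n 0 then 1 else 0) * y) * Ione)).
Proof.
intros hy IH hM. destruct AB_pos as [h1 [h2 [h3 h4]]].
set (c1 := alpha * (-1) ^ n / (2 * INR n + 1) * (2 * sqrt y)).
set (c2 := beta / (2 * INR n + 1) * sqrt y).
set (c3 := gamma * (if Nat.eqb n 0 then 1 else 0) * y).
set (x := fun r => INR (S r) * / (2 * sqrt y)).
apply (is_RInt_ext (fun u =>
  c1 * sum_n (fun r => nu (S r) * (F u * u * (sqrt (/ u - x r ^ 2)
         * chebyshevV n (x r ^ 2 / / u)))) M
  + (c2 * (F u * u * sqrt (/ u)) + - c3 * (F u * u * / u)))).
- rewrite Rmin_left, Rmax_right by lra. intros u hu.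
  (* [y / u] is largest at [u = A], so one cutoff serves the whole interval. *)
  assert (hu' : 2 * sqrt (y / u) <= INR (S M)).
  { refine (Rle_trans _ _ _ _ hM). apply Rmult_le_compat_l; [lra|].
    apply sqrt_le_1_alt. apply Rmult_le_compat_l; [lra|]. apply Rinv_le_contravar; lra. }
  rewrite (murm_explicit n M y u) by lra.
  rewrite (sum_n_ext (fun r => nu (S r) * (F u * u * (sqrt (/ u - x r ^ 2)
         * chebyshevV n (x r ^ 2 / / u)))) (fun r => F u * u * (nu (S r) * (sqrt (/ u - x r ^ 2)
         * chebyshevV n (x r ^ 2 / / u)))))
    by (intros; match goal with |- ?u = ?v => change (@eq R u v) end; ring).
  rewrite sum_n_scal_l. fold c1 c2 c3. unfold x.
  match goal with |- ?u = ?v => change (@eq R u v) end. ring.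
- apply (is_RInt_plus (V := R_NormedModule)); [|apply (is_RInt_plus (V := R_NormedModule))];
    apply (is_RInt_scal (V := R_NormedModule)).
  + apply is_RInt_sum_n. intros r. apply (is_RInt_scal (V := R_NormedModule)).
    pose proof (substitution (fun t => sqrt (t - x r ^ 2) * chebyshevV n (x r ^ 2 / t)))
      as HS.
    cbv beta in HS. rewrite (is_RInt_unique _ _ _ _ (IH (x r))) in HS. apply HS. intros t ht.
    apply (continuous_mult (K := R_AbsRing) (fun t => sqrt (t - x r ^ 2))
      (fun t => chebyshevV n (x r ^ 2 / t))).
    * apply continuous_sqrt_comp. apply continuous_of_ex_derive.
      generalize (x r). intros q. auto_derive. exact I.
    * apply (continuous_comp (fun t => x r ^ 2 / t) (chebyshevV n));
        [|apply continuous_chebyshevV].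
      apply continuous_of_ex_derive. generalize (x r). intros q. auto_derive. lra.
  + apply substitution. intros t _. apply continuous_sqrt.
  + apply (substitution (fun t => t)). intros t _. apply continuous_id.
Qed.

Let J y : R := RInt (fun u => murm (2 * n + 2) (y / u) * (F u * u)) A B.

Local Lemma exists_cutoff (z : R) : exists M : nat, z <= INR (S M).
Proof.
destruct (exists_index_beyond z 1) as [M hM]; [lra|].
exists M. rewrite S_INR. lra.
Qed.

Lemma real_average_ex_RInt (y : R) : 0 < y ->
  ex_RInt (fun u => murm (2 * n + 2) (y / u) * (F u * u)) A B.
Proof.
intros hy. destruct AB_pos as [h1 [h2 [h3 h4]]].
destruct (kernel_profile (/ B) (/ A) n phi h3 h4 bump_phi)
  as [H [k1 [SH [Sk1 [DH [Hz [IH [Ec [Ek E0]]]]]]]]].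
destruct (exists_cutoff (2 * sqrt (y / A))) as [M hM].
eexists. now apply (murm_integral H M).
Qed.

Lemma real_average_continuous (y : R) : 0 < y -> continuous J y.
Proof.
intros hy. destruct AB_pos as [h1 [h2 [h3 h4]]].
destruct (kernel_profile (/ B) (/ A) n phi h3 h4 bump_phi)
  as [H [k1 [SH [Sk1 [DH [Hz [IH [Ec [Ek E0]]]]]]]]].
(* A cutoff for [y + 1] serves all arguments in [(0, y + 1)], so near [y] the average is one finite
   sum. *)
destruct (exists_cutoff (2 * sqrt ((y + 1) / A))) as [M hM].
set (G := fun y =>
  alpha * (-1) ^ n / (2 * INR n + 1) * (2 * sqrt y)
       * sum_n (fun r => nu (S r) * H (INR (S r) * / (2 * sqrt y))) M
     + (beta / (2 * INR n + 1) * sqrt y * Ihalf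
        + - (gamma * (if Nat.eqb n 0 then 1 else 0) * y) * Ione)).
apply (continuous_ext_loc _ G).
- generalize (open_and _ _ (open_gt 0) (open_lt (y + 1)) y ltac:(split; lra)).
  apply filter_imp. intros z [hz1 hz2]. symmetry. unfold J, G.
  apply is_RInt_unique. apply murm_integral; trivial.
  refine (Rle_trans _ _ _ _ hM). apply Rmult_le_compat_l; [lra|].
  apply sqrt_le_1_alt. apply Rmult_le_compat_r; [left; now apply Rinv_0_lt_compat|lra].
- assert (hs : 0 < sqrt y) by now apply sqrt_lt_R0.
  assert (Cs : continuous (fun y => sqrt y) y) by apply continuous_sqrt.
  assert (Csum : forall m, continuous (fun y =>
     sum_n (fun r => nu (S r) * H (INR (S r) * / (2 * sqrt y))) m) y).
  { assert (Ct : forall r, continuous (fun y => nu (S r) * H (INR (S r) * / (2 * sqrt y))) y).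
    { intros r. generalize (INR (S r)) (nu (S r)). intros q w.
      apply continuous_of_ex_derive. auto_derive.
      split; [eexists; apply DH|]. repeat split; lra. }
    induction m as [|m IHm].
    - apply (continuous_ext (fun y => nu 1 * H (INR 1 * / (2 * sqrt y)))); [|apply Ct].
      intros z. symmetry. apply sum_O.
    - apply (continuous_ext (fun y => plus
        (sum_n (fun r => nu (S r) * H (INR (S r) * / (2 * sqrt y))) m)
        (nu (S (S m)) * H (INR (S (S m)) * / (2 * sqrt y))))).
      + intros z. symmetry. apply sum_Sn.
      + apply (continuous_plus (V := R_NormedModule)); [exact IHm|apply Ct]. }
  unfold G. apply (continuous_plus (V := R_NormedModule) (fun y =>
    alpha * (-1) ^ n / (2 * INR n + 1) * (2 * sqrt y)
       * sum_n (fun r => nu (S r) * H (INR (S r) * / (2 * sqrt y))) M)).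
  + apply (continuous_mult (K := R_AbsRing)
      (fun y => alpha * (-1) ^ n / (2 * INR n + 1) * (2 * sqrt y))); [|apply Csum].
    apply continuous_of_ex_derive.
    generalize (alpha * (-1) ^ n / (2 * INR n + 1)). intros q. auto_derive. lra.
  + apply continuous_of_ex_derive.
    generalize (beta / (2 * INR n + 1)) (gamma * (if Nat.eqb n 0 then 1 else 0)) Ihalf Ione.
    intros q1 q2 q3 q4. auto_derive. lra.
Qed.

(** Put [x = 1 / (2 sqrt y)], so that the prefactor is [2 PI / ((2 n + 1) x)] up to sign. For
    [n = 0] the main term carries [2 PI * (PI / 4) * 4 / zeta(2) = 12], the constant of [gamma]. The
    linear term gives [2 PI * (PI / 2) / (12 zeta(2)) = 1 / 2], in which the two factors [2 n + 1]
    and the two signs cancel. *)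
Lemma real_average_limit : forall e, 0 < e -> exists Y0, 0 < Y0 /\ forall y, Y0 < y ->
  Rabs (J y - / 2 * RInt (fun u => F u * u) A B) <= e.
Proof.
intros e he. destruct AB_pos as [h1 [h2 [h3 h4]]].
destruct (kernel_profile (/ B) (/ A) n phi h3 h4 bump_phi)
  as [H [k1 [SH [Sk1 [DH [Hz [IH [Ec [Ek E0]]]]]]]]].
set (L := 1 + / A) in *.
assert (hL : 0 < L) by (unfold L; pose proof (Rinv_0_lt_compat _ h1); lra).
pose proof PI_RGT_0 as hpi.
assert (hN : 0 < 2 * INR n + 1) by (pose proof (pos_INR n); lra).
(* The tolerance becomes [e] after multiplication by the prefactor [2 PI / (2 n + 1)]. *)
destruct (nu_sum_expansion H k1 L hL SH Sk1 DH Hz (e * (2 * INR n + 1) / (2 * PI)))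
  as [d [hd Hd]].
{ apply Rdiv_lt_0_compat; [|lra]. now apply Rmult_lt_0_compat. }
exists (/ d ^ 2). split; [apply Rinv_0_lt_compat, pow_lt; easy|]. intros y hy.
assert (hy0 : 0 < y).
{ refine (Rlt_trans _ _ _ _ hy). apply Rinv_0_lt_compat, pow_lt; easy. }
assert (hs : 0 < sqrt y) by now apply sqrt_lt_R0.
set (x := / (2 * sqrt y)).
assert (hx : 0 < x < d).
{ split; [apply Rinv_0_lt_compat; lra|].
  assert (hd1 : / d < sqrt y).
  { replace (/ d) with (sqrt (/ d ^ 2)).
    - apply sqrt_lt_1_alt. split; [|easy]. left. apply Rinv_0_lt_compat, pow_lt; easy.
    - rewrite <- pow_inv. apply sqrt_pow2. left. now apply Rinv_0_lt_compat. }
  unfold x. rewrite <- (Rinv_inv d). pose proof (Rinv_0_lt_compat d hd).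
  apply Rinv_lt_contravar; [|lra]. apply Rmult_lt_0_compat; lra. }
specialize (Hd x hx).
(* [M] must cover both the range of the sum in [murm] and the support of [H]. *)
destruct (exists_cutoff (Rmax (2 * sqrt (y / A)) (L * (2 * sqrt y)))) as [M hM].
assert (eJ := murm_integral H M y hy0 IH (Rle_trans _ _ _ (Rmax_l _ _) hM)).
apply (is_RInt_unique (V := R_CompleteNormedModule)) in eJ. fold (J y) in eJ.
assert (eW : Series (fun r => nu (S r) * H (INR (S r) * x))
           = sum_n (fun r => nu (S r) * H (INR (S r) * x)) M).
{ apply Series_finite_support. intros m hm. rewrite Hz; [ring|].
  assert (hm' : L * (2 * sqrt y) <= INR (S m)).
  { refine (Rle_trans _ _ _ (Rmax_r (2 * sqrt (y / A)) _) _).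
    refine (Rle_trans _ _ _ hM _). apply le_INR. lia. }
  unfold x. apply Rmult_le_reg_r with (2 * sqrt y); [lra|].
  rewrite Rmult_assoc, Rinv_l by lra. lra. }
fold x in eJ. rewrite <- eW in eJ. set (W := Series _) in *.
assert (ew := RInt_weight). apply (is_RInt_unique (V := R_CompleteNormedModule)) in ew.
rewrite ew. set (Iphi := RInt phi (/ B) (/ A) : R) in *.
fold Ihalf in E0. fold Ione in Ec.
rewrite Ec, Ek, E0, zeta_2 in Hd.
rewrite eJ.
assert (ea : alpha = 2 * PI * prime_product alpha_factor) by reflexivity.
assert (eb : beta = 2 * PI * prime_product beta_factor) by reflexivity.
assert (eg : gamma = 12 * prime_product gamma_factor) by reflexivity.
rewrite ea, eb, eg.
set (pa := prime_product alpha_factor) in *. set (pb := prime_product beta_factor) in *.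
set (pg := prime_product gamma_factor) in *.
assert (sq : (-1) ^ n * (-1) ^ n = 1).
{ rewrite <- Rpow_mult_distr. replace (-1 * -1) with 1 by ring. apply pow1. }
set (sg := (-1) ^ n) in *.
assert (hsg : Rabs sg = 1) by apply pow_1_abs.
assert (ysq : y = sqrt y * sqrt y) by (symmetry; apply sqrt_sqrt; lra).
set (T := pa * W - _) in Hd.
(* With [zeta 2] and the integrals of the profile evaluated, the difference is exactly the prefactor
   times the error [T] of [nu_sum_expansion]. *)
match goal with |- Rabs ?E <= _ =>
  replace E with (2 * PI * sg / (2 * INR n + 1) * (/ x * T)) end.
- rewrite !Rabs_mult. unfold Rdiv at 1.
  rewrite !Rabs_mult, hsg, (Rabs_pos_eq 2), (Rabs_pos_eq PI),
    (Rabs_pos_eq (/ (2 * INR n + 1))), (Rabs_pos_eq (/ x)); try lra.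
  + apply Rle_trans with (2 * PI * 1 * / (2 * INR n + 1)
       * (/ x * (e * (2 * INR n + 1) / (2 * PI) * x))).
    * apply Rmult_le_compat_l.
      -- apply Rmult_le_pos; [lra|]. left. now apply Rinv_0_lt_compat.
      -- apply Rmult_le_compat_l; [left; now apply Rinv_0_lt_compat|exact Hd].
    * right. field. repeat split; lra.
  + left. now apply Rinv_0_lt_compat.
  + left. now apply Rinv_0_lt_compat.
- unfold T. clear T Hd. unfold x. rewrite Rinv_inv.
  assert (sg1 : sg = 1 \/ sg = -1).
  { assert (h : (sg - 1) * (sg + 1) = 0) by lra.
    apply Rmult_integral in h. destruct h; [left|right]; lra. }
  set (s := sqrt y) in *. rewrite ysq. clearbody s.
  assert (n0 : Nat.eqb n 0 = true -> INR n = 0 /\ sg = 1).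
  { intros h. apply Nat.eqb_eq in h. unfold sg. rewrite h. split; reflexivity. }
  (* For [n > 0] both the [gamma] term and the mass of [H] vanish; for [n = 0] the sign is [1]. *)
  destruct (Nat.eqb n 0).
  + destruct (n0 eq_refl) as [en es]. rewrite en, es. field. lra.
  + clear n0. destruct sg1 as [es|es]; rewrite es; field; lra.
Qed.

End RealAverage.

(** * From real to complex weights *)

Lemma is_derive_C_fst (f : R -> C) (x : R) (l : C) :
  @is_derive R_AbsRing C_R_NormedModule f x l -> is_derive (fun t => fst (f t)) x (fst l).
Proof.
intros H.
apply (filterdiff_comp' (U := R_NormedModule)
  (V := prod_NormedModule R_AbsRing R_NormedModule R_NormedModule) (W := R_NormedModule)
  f fst x (fun y => scal y l) fst H).
apply filterdiff_linear, is_linear_fst.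
Qed.

Lemma is_derive_C_snd (f : R -> C) (x : R) (l : C) :
  @is_derive R_AbsRing C_R_NormedModule f x l -> is_derive (fun t => snd (f t)) x (snd l).
Proof.
intros H.
apply (filterdiff_comp' (U := R_NormedModule)
  (V := prod_NormedModule R_AbsRing R_NormedModule R_NormedModule) (W := R_NormedModule)
  f snd x (fun y => scal y l) snd H).
apply filterdiff_linear, is_linear_snd.
Qed.

Lemma smooth_on_pos_component (Phi : R -> C) (pr : C -> R) :
  (forall (f : R -> C) (x : R) (l : C), @is_derive R_AbsRing C_R_NormedModule f x l ->
     is_derive (fun t => pr (f t)) x (pr l)) ->
  smooth_on_pos Phi -> smooth_on (fun u => 0 < u) (fun u => pr (Phi u)).
Proof.
intros hpr [D [D0 DS]].
apply smooth_on_ext with (fun u => pr (D 0%nat u)); [apply open_gt| |].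
- intros u hu. now rewrite D0.
- intros n. generalize 0%nat. induction n as [|n IH]; intros m; [exact I|].
  exists (fun u => pr (D (S m) u)). split; [|apply IH].
  intros u hu. now apply hpr, DS.
Qed.

Lemma filterlim_C_pair (F : (R -> Prop) -> Prop) (FF : Filter F) (f g : R -> R) (l m : R) :
  filterlim f F (locally l) -> filterlim g F (locally m) ->
  filterlim (fun y => (f y, g y) : C) F (locally ((l, m) : C)).
Proof.
intros Hf Hg P [e He].
specialize (Hf (ball l e) (locally_ball l e)). specialize (Hg (ball m e) (locally_ball m e)).
unfold filtermap in *. generalize (filter_and _ _ Hf Hg). apply filter_imp.
intros y [h1 h2]. apply He. split; easy.
Qed.

(** The truncated integrals over [[u, v]] with [0 < u < A] and [v > B] all have the same value, so
    the improper integral is an eventually constant limit. *)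
Lemma integral_pos_support (f : R -> C) (A B : R) (l1 l2 : R) : 0 < A -> A <= B ->
  (forall u, 0 < u -> u < A -> f u = RtoC 0) -> (forall u, B < u -> f u = RtoC 0) ->
  is_RInt (fun u => fst (f u)) A B l1 -> is_RInt (fun u => snd (f u)) A B l2 ->
  integral_pos f = (l1, l2).
Proof.
intros hA hAB Z1 Z2 I1 I2. unfold integral_pos.
apply (is_RInt_gen_unique (V := C_R_CompleteNormedModule)).
assert (I : @is_RInt C_R_NormedModule f A B (l1, l2)).
{ exact (is_RInt_fct_extend_pair (U := R_NormedModule) (V := R_NormedModule) f A B l1 l2 I1 I2). }
assert (Zint : forall u v, u <= v -> (forall t, u < t < v -> f t = RtoC 0) ->
   @is_RInt C_R_NormedModule f u v (RtoC 0)).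
{ intros u v huv H. apply (is_RInt_ext (V := C_R_NormedModule) (fun _ => RtoC 0)).
  - rewrite Rmin_left, Rmax_right by easy. intros t ht. symmetry. now apply H.
  - pose proof (is_RInt_const (V := C_R_NormedModule) u v (RtoC 0)) as h.
    replace (scal (v - u) (RtoC 0 : C_R_NormedModule)) with (RtoC 0) in h; [exact h|].
    symmetry. apply (scal_zero_r (V := C_R_NormedModule)). }
intros P HP.
apply (Filter_prod _ _ _ (fun u => 0 < u < A) (fun v => B < v)).
- unfold at_right, within. generalize (open_lt A 0 hA). apply filter_imp.
  intros u h1 h2. split; easy.
- exists B. easy.
- intros u v hu hv. exists ((l1, l2) : C). split; [|now apply locally_singleton].
  simpl.
  replace ((l1, l2) : C) with (plus (plus (RtoC 0 : C_R_NormedModule) (l1, l2)) (RtoC 0)).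
  + apply (is_RInt_Chasles (V := C_R_NormedModule) f u B v).
    * apply (is_RInt_Chasles (V := C_R_NormedModule) f u A B); [|exact I].
      apply Zint; [lra|]. intros t ht. apply Z1; lra.
    * apply Zint; [lra|]. intros t ht. apply Z2; lra.
  + transitivity (plus (RtoC 0 : C_R_NormedModule) (l1, l2)).
    * apply (plus_zero_r (G := C_R_NormedModule)).
    * apply (plus_zero_l (G := C_R_NormedModule)).
Qed.

Theorem theorem5 (k : nat) (Phi : R -> C)
  (hk2 : (2 <= k)%nat) (hkeven : Nat.Even k)
  (hsmooth : smooth_on_pos Phi)
  (hsupp : compact_support_in_pos Phi)
  (hint : integral_pos (fun u => (Phi u * RtoC (u ^ 2 / u))%C) <> RtoC 0) :
  (forall y : R, 0 < y -> continuous (murm_avg k Phi) y) /\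
  murm_avg k Phi 0 = RtoC 0 /\
  filterlim (murm_avg k Phi) (Rbar_locally p_infty) (locally (RtoC (1 / 2))).
Proof.
(* Evenness and [2 <= k] give [1 <= k'], so the truncated subtraction is exact and
   [n = k / 2 - 1]. *)
destruct hkeven as [k' hk']. set (n := (k' - 1)%nat).
assert (ek : k = (2 * n + 2)%nat) by (unfold n; lia).
destruct hsupp as [a [b [ha [hab hs]]]].
set (F1 := fun u => fst (Phi u)). set (F2 := fun u => snd (Phi u)).
assert (S1 : smooth_on (fun u => 0 < u) F1)
  by exact (smooth_on_pos_component Phi fst is_derive_C_fst hsmooth).
assert (S2 : smooth_on (fun u => 0 < u) F2)
  by exact (smooth_on_pos_component Phi snd is_derive_C_snd hsmooth).
assert (Z1 : forall u, 0 < u -> F1 u <> 0 -> a <= u <= b).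
{ intros u hu h. apply hs; [easy|]. intros e. apply h. unfold F1. now rewrite e. }
assert (Z2 : forall u, 0 < u -> F2 u <> 0 -> a <= u <= b).
{ intros u hu h. apply hs; [easy|]. intros e. apply h. unfold F2. now rewrite e. }
set (A := a / 2). set (B := b + 1).
assert (hA : 0 < A) by (unfold A; lra). assert (hB : A <= B) by (unfold A, B; lra).
assert (Zero : forall u, 0 < u -> u < A \/ B < u -> Phi u = RtoC 0).
{ intros u hu h.
  assert (e1 : F1 u = 0) by (destruct (Req_dec (F1 u) 0) as [|ne]; [easy|];
    apply Z1 in ne; [unfold A, B in h; lra|easy]).
  assert (e2 : F2 u = 0) by (destruct (Req_dec (F2 u) 0) as [|ne]; [easy|];
    apply Z2 in ne; [unfold A, B in h; lra|easy]).
  unfold F1, F2 in e1, e2. destruct (Phi u). simpl in e1, e2. now rewrite e1, e2. }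
set (J := fun (F : R -> R) y => RInt (fun u => murm (2 * n + 2) (y / u) * (F u * u)) A B : R).
set (D := fun F : R -> R => RInt (fun u => F u * u) A B : R).
assert (ED : integral_pos (fun u => (Phi u * RtoC (u ^ 2 / u))%C) = (D F1, D F2)).
{ assert (W : forall F : R -> R, smooth_on (fun u => 0 < u) F ->
    (forall u, 0 < u -> F u <> 0 -> a <= u <= b) ->
    is_RInt (fun u => F u * u) A B (D F)).
  { intros F SF ZF. apply (RInt_correct (V := R_CompleteNormedModule)).
    eexists. now apply (RInt_weight F a b). }
  apply (integral_pos_support _ A B); trivial.
  - intros u h1 h2. rewrite Zero by lra. apply Cmult_0_l.
  - intros u h1. rewrite Zero by lra. apply Cmult_0_l.
  - apply (is_RInt_ext (fun u => F1 u * u)); [|now apply W].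
    rewrite Rmin_left, Rmax_right by easy. intros u hu. unfold F1. simpl. field. lra.
  - apply (is_RInt_ext (fun u => F2 u * u)); [|now apply W].
    rewrite Rmin_left, Rmax_right by easy. intros u hu. unfold F2. simpl. field. lra. }
assert (EJ : forall y, 0 < y ->
  integral_pos (fun u => (RtoC (murm k (y / u)) * Phi u * RtoC (u ^ 2 / u))%C)
  = (J F1 y, J F2 y)).
{ intros y hy.
  assert (W : forall F : R -> R, smooth_on (fun u => 0 < u) F ->
    (forall u, 0 < u -> F u <> 0 -> a <= u <= b) ->
    is_RInt (fun u => murm (2 * n + 2) (y / u) * (F u * u)) A B (J F y)).
  { intros F SF ZF. apply (RInt_correct (V := R_CompleteNormedModule)).
    now apply (real_average_ex_RInt n F a b). }
  apply (integral_pos_support _ A B); trivial.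
  - intros u h1 h2. rewrite Zero by lra. now rewrite Cmult_0_r, Cmult_0_l.
  - intros u h1. rewrite Zero by lra. now rewrite Cmult_0_r, Cmult_0_l.
  - apply (is_RInt_ext (fun u => murm (2 * n + 2) (y / u) * (F1 u * u))); [|now apply W].
    rewrite Rmin_left, Rmax_right by easy. intros u hu. rewrite ek. unfold F1.
    generalize (murm (2 * n + 2) (y / u)). intros m. simpl. field. lra.
  - apply (is_RInt_ext (fun u => murm (2 * n + 2) (y / u) * (F2 u * u))); [|now apply W].
    rewrite Rmin_left, Rmax_right by easy. intros u hu. rewrite ek. unfold F2.
    generalize (murm (2 * n + 2) (y / u)). intros m. simpl. field. lra. }
(* [Q] does not depend on [y], so the average is a fixed linear combination of the averages for the
   real and imaginary parts of [Phi]. *)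
set (Q := (/ integral_pos (fun u => (Phi u * RtoC (u ^ 2 / u))%C))%C).
set (p := fst Q). set (q := snd Q).
assert (Eavg : forall y, 0 < y -> murm_avg k Phi y
  = (J F1 y * p - J F2 y * q, J F1 y * q + J F2 y * p)).
{ intros y hy. unfold murm_avg. rewrite EJ by easy. reflexivity. }
assert (Epos : Rbar_locally p_infty (fun y => 0 < y)) by (exists 0; easy).
split; [|split].
- intros y hy.
  apply (continuous_ext_loc _ (fun y => (J F1 y * p - J F2 y * q, J F1 y * q + J F2 y * p) : C)).
  + generalize (open_gt 0 y hy). apply filter_imp. intros z hz. symmetry. now apply Eavg.
  + assert (C1 : continuous (J F1) y) by now apply (real_average_continuous n F1 a b).
    assert (C2 : continuous (J F2) y) by now apply (real_average_continuous n F2 a b).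
    assert (Cp : forall (f : R -> R) c, continuous f y -> continuous (fun y => f y * c) y).
    { intros f c Hf. apply (continuous_mult (K := R_AbsRing) f (fun _ => c)); [easy|].
      apply continuous_const. }
    apply (filterlim_C_pair (locally y)); [apply locally_filter| |].
    * apply (continuous_minus (V := R_NormedModule) (fun y => J F1 y * p) (fun y => J F2 y * q));
        now apply Cp.
    * apply (continuous_plus (V := R_NormedModule) (fun y => J F1 y * q) (fun y => J F2 y * p));
        now apply Cp.
(* At [y = 0] every argument [0 / u] is [0], where [murm] is [0] by definition. *)
- assert (E0 : forall u, murm k (0 / u) = 0).
  { intros u. replace (0 / u) with 0 by (unfold Rdiv; ring). unfold murm.
    destruct (Rlt_dec 0 0); [lra|reflexivity]. }
  assert (I0 : is_RInt (fun _ : R => 0) A B 0).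
  { pose proof (is_RInt_const (V := R_NormedModule) A B 0) as h.
    rewrite (scal_zero_r (V := R_NormedModule)) in h. exact h. }
  unfold murm_avg.
  rewrite (integral_pos_support _ A B 0 0); trivial.
  + apply Cmult_0_l.
  + intros u h1 h2. rewrite Zero by lra. now rewrite Cmult_0_r, Cmult_0_l.
  + intros u h1. rewrite Zero by lra. now rewrite Cmult_0_r, Cmult_0_l.
  + apply (is_RInt_ext (fun _ => 0)); [|exact I0]. intros u _. rewrite E0. simpl. ring.
  + apply (is_RInt_ext (fun _ => 0)); [|exact I0]. intros u _. rewrite E0. simpl. ring.
- assert (L : forall F : R -> R, smooth_on (fun u => 0 < u) F ->
    (forall u, 0 < u -> F u <> 0 -> a <= u <= b) ->
    filterlim (J F) (Rbar_locally p_infty) (locally (/ 2 * D F))).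
  { intros F SF ZF P [e He].
    destruct (real_average_limit n F a b ha hab SF ZF (e / 2)) as [Y0 [_ HY]];
      [pose proof (cond_pos e); lra|].
    exists Y0. intros y hy. apply He.
    change (Rabs (J F y - / 2 * D F) < e). specialize (HY y hy). fold A B in HY.
    apply Rle_lt_trans with (e / 2); [exact HY|]. pose proof (cond_pos e). lra. }
  apply (filterlim_ext_loc (fun y => (J F1 y * p - J F2 y * q, J F1 y * q + J F2 y * p) : C)).
  + revert Epos. apply filter_imp. intros y hy. symmetry. now apply Eavg.
  + replace (RtoC (1 / 2)) with
      ((/ 2 * D F1 * p - / 2 * D F2 * q, / 2 * D F1 * q + / 2 * D F2 * p) : C).
    * assert (C1 := L F1 S1 Z1). assert (C2 := L F2 S2 Z2).
      assert (M : forall (f : R -> R) (l c : R),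
        filterlim f (Rbar_locally p_infty) (locally l) ->
        filterlim (fun y => f y * c) (Rbar_locally p_infty) (locally (l * c))).
      { intros f l c Hf. exact (is_lim_mult f (fun _ => c) p_infty l c Hf
          (is_lim_const c p_infty) I). }
      apply (filterlim_C_pair (Rbar_locally p_infty)); [apply Rbar_locally_filter| |].
      -- exact (is_lim_minus' _ _ p_infty _ _ (M _ _ p C1) (M _ _ q C2)).
      -- exact (is_lim_plus' _ _ p_infty _ _ (M _ _ q C1) (M _ _ p C2)).
    (* The limit is [1 / 2] times [Q] times the complex number with components [D F1] and [D F2],
       and [hint] makes [Q] its true inverse. *)
    * assert (e := Cinv_r _ hint). fold Q in e. rewrite ED in e.
      transitivity (RtoC (1 / 2) * RtoC 1)%C; [|apply Cmult_1_r].
      rewrite <- e. clear - Q. clearbody Q. apply injective_projections; unfold p, q; simpl; field.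
Qed.
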